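(* Let $a,m\ge0$, $\ell\ge1$ and $0\le p\le\ell$ be integers, and let $\mathcal{B}^p_\ell(m,a)$ be the arrangement in $\mathbb{R}^\ell$ consisting of the hyperplanes $x_i+x_j=s$ and $x_i-x_j=s$ for $1\le i<j\le\ell$ and integers $-a\le s\le a$; $x_i=s$ for $1\le i\le p$ and integers $1-m\le s\le m$; and $x_i=s$ for $p<i\le\ell$ and integers $-m\le s\le m$. Then the cone $\mathbf{c}\mathcal{B}^p_\ell(m,a)$ is recursively free with exponents $$\big(1,\ c+2\ell-p-1,\ c+1,\ c+3,\ c+5,\dots,\ c+2\ell-3\big),\qquad c=2m+2a\ell-2a.$$
   Context: For an affine arrangement $\mathcal{A}$ in $\mathbb{R}^\ell$, its cone $\mathbf{c}\mathcal{A}$ is the central arrangement in $\mathbb{R}^{\ell+1}$ (extra coordinate $z$) consisting of the hyperplanes $a_1x_1+\dots+a_\ell x_\ell=dz$ for each hyperplane $a_1x_1+\dots+a_\ell x_\ell=d$ of $\mathcal{A}$, together with $z=0$. For a central arrangement $\mathcal{A}$ and $H\in\mathcal{A}$ let $\mathcal{A}'=\mathcal{A}\setminus\{H\}$, $\mathcal{A}''=\mathcal{A}^H=\{K\cap H:K\in\mathcal{A}'\}$. Free arrangements and exponents are defined via the module $D(\mathcal{A})$ of logarithmic derivations. The class of recursively free arrangements is the smallest class containing all empty arrangements such that: if $H\in\mathcal{A}$ with $\mathcal{A}'$, $\mathcal{A}''$ in the class and $\exp(\mathcal{A}'')\subseteq\exp(\mathcal{A}')$ then $\mathcal{A}$ is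 in the class; and if $H\in\mathcal{A}$ with $\mathcal{A}$, $\mathcal{A}''$ in the class and $\exp(\mathcal{A}'')\subseteq\exp(\mathcal{A})$ then $\mathcal{A}'$ is in the class. (Recursively free arrangements are free.) *)

(* Defs.v *)
From HB Require Import structures.
From mathcomp Require Import all_boot all_order all_algebra.
From mathcomp Require Import finmap reals mpoly zify.

Set Implicit Arguments.
Unset Strict Implicit.
Unset Printing Implicit Defensive.

Import Order.TTheory GRing.Theory Num.Theory.
Local Open Scope fset_scope.
Local Open Scope ring_scope.

Section CentralArrangements.
Variables (F : fieldType) (V : vectType F).
Implicit Types (A : {fset {vspace V}}) (H K : {vspace V}).

(* A finite set of linear hyperplanes of V; V may have any dimension,
   including 0. *)
Definition central_arrangement A : Prop :=
  forall H, H \in A -> (\dim H).+1 = \dim {:V}.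

Definition deletion A H : {fset {vspace V}} := A `\ H.

(* The preimage of K under the inclusion of H in V is K :&: H, seen as a
   subspace of the vector space H. *)
Definition restriction A H : {fset {vspace (subvs_of H)}} :=
  [fset (linfun vsval @^-1: K)%VS | K in A `\ H].

(* The symmetric algebra of the dual of V, in the coordinates 'X_i dual to the
   basis vbasis {:V}. *)
Local Notation n := (\dim {:V}).
Local Notation S := {mpoly F[n]}.

Definition form_poly (alpha : 'Hom(V, F^o)) : S :=
  \sum_(i < n) (alpha (vbasis {:V})`_i : F) *: 'X_i.

(* The row theta stands for the derivation \sum_i theta_i d/dX_i of S. *)
Definition der_app (theta : 'rV[S]_n) (f : S) : S :=
  \sum_(i < n) theta 0 i * f^`M(i).

(* theta is in D(A).  The form alpha_H is determined by H up to a nonzero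
   scalar, which does not affect the condition. *)
Definition log_derivation A (theta : 'rV[S]_n) : Prop :=
  forall H (alpha : 'Hom(V, F^o)), H \in A -> lker alpha = H ->
  exists q : S, der_app theta (form_poly alpha) = q * form_poly alpha.

Definition log_basis A (k : nat) (theta : 'I_k -> 'rV[S]_n) : Prop :=
  [/\ forall i, log_derivation A (theta i),
      forall eta, log_derivation A eta ->
        exists f : 'I_k -> S, eta = \sum_i f i *: theta i
    & forall f : 'I_k -> S,
        \sum_i f i *: theta i = 0 -> forall i, f i = 0].

(* D(A) is a free S-module having a homogeneous basis whose polynomial degrees
   are the entries of e; the order of e is irrelevant. *)
Definition free_with_exponents A (e : seq nat) : Prop :=
  exists theta : 'I_(size e) -> 'rV[S]_n,
    log_basis A theta /\
    forall i j, theta i 0 j \is (nth 0%N e i).-homog.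

End CentralArrangements.

Definition multiset_sub (s t : seq nat) : Prop :=
  forall x, (count_mem x s <= count_mem x t)%N.

Inductive recursively_free (F : fieldType) :
    forall V : vectType F, {fset {vspace V}} -> Prop :=
| RecFreeEmpty (V : vectType F) : recursively_free (fset0 : {fset {vspace V}})
| RecFreeAdd (V : vectType F) (A : {fset {vspace V}}) (H : {vspace V})
    (e' e'' : seq nat) :
    central_arrangement A -> H \in A ->
    recursively_free (deletion A H) -> recursively_free (restriction A H) ->
    free_with_exponents (deletion A H) e' ->
    free_with_exponents (restriction A H) e'' ->
    multiset_sub e'' e' -> recursively_free A
| RecFreeDel (V : vectType F) (A : {fset {vspace V}}) (H : {vspace V})
    (e e'' : seq nat) :
    central_arrangement A -> H \in A ->
    recursively_free A -> recursively_free (restriction A H) ->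
    free_with_exponents A e ->
    free_with_exponents (restriction A H) e'' ->
    multiset_sub e'' e -> recursively_free (deletion A H).

Definition hplane (F : fieldType) (n : nat) (c : 'rV[F]_n) :
    {vspace 'rV[F]_n} :=
  lker (linfun (mulmxr c^T : 'rV[F]_n -> 'rV[F]_1)).

Lemma mem_hplane (F : fieldType) (n : nat) (c v : 'rV[F]_n) :
  (v \in hplane c) = (\sum_i c 0 i * v 0 i == 0).
Proof.
rewrite memv_ker lfunE /=; apply/eqP/eqP => [/matrixP/(_ 0 0)|E].
  rewrite !mxE => E; rewrite -[RHS]E; apply: eq_bigr => i _.
  by rewrite mxE mulrC.
apply/matrixP => i j; rewrite !ord1 !mxE -[RHS]E; apply: eq_bigr => k _.
by rewrite mxE mulrC.
Qed.

(* An affine arrangement in F^l is given by equations; (u, d) is the hyperplane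
   \sum_i u_i x_i = d.  The last coordinate of F^(l + 1) is z. *)
Definition cone (F : fieldType) (l : nat) (B : seq ('rV[F]_l * F)) :
    {fset {vspace 'rV[F]_(l + 1)}} :=
  [fset H in hplane (row_mx 0 1%:M)
             :: [seq hplane (row_mx b.1 (- b.2)%:M) | b <- B]].

Definition int_range (lo hi : int) : seq int :=
  if lo <= hi then [seq lo + k%:Z | k <- iota 0 `|hi - lo|.+1] else [::].

Lemma mem_int_range (lo hi s : int) :
  (s \in int_range lo hi) = (lo <= s <= hi).
Proof.
rewrite /int_range; case: ifPn => [le_lh | nle]; last first.
  by rewrite in_nil; apply/esym/negP => /andP[h1 /(le_trans h1)]; apply/negP.
apply/mapP/andP => [[k] | [h1 h2]].
  rewrite mem_iota add0n ltnS /= => hk ->; rewrite lerDl lez_nat leq0n.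
  split=> //; lia.
exists `|s - lo|%N; last by lia.
by rewrite mem_iota add0n ltnS /=; lia.
Qed.

(* Coordinates are numbered from 0, so that 1 <= i <= p becomes i < p. *)
Definition B_arr (F : fieldType) (l p m a : nat) : seq ('rV[F]_l * F) :=
  let x (i : 'I_l) : 'rV[F]_l := delta_mx 0 i in
  let pairs := [seq ij : 'I_l * 'I_l <- enum {: 'I_l * 'I_l} | ij.1 < ij.2]%N in
  [seq (x ij.1 + x ij.2, s%:~R) | ij <- pairs, s <- int_range (- a%:Z) a]
  ++ [seq (x ij.1 - x ij.2, s%:~R) | ij <- pairs, s <- int_range (- a%:Z) a]
  ++ [seq (x i, s%:~R) | i <- enum 'I_l,
        s <- int_range (if (i < p)%N then 1 - m%:Z else - m%:Z) m].

(* Main.v *)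
Require Import Defs.
From HB Require Import structures.
From mathcomp Require Import all_boot all_order all_algebra.
From mathcomp Require Import finmap reals mpoly zify ring lra.
Set Implicit Arguments.
Unset Strict Implicit.
Unset Printing Implicit Defensive.
Import Order.TTheory GRing.Theory Num.Theory.
Local Open Scope fset_scope.
Local Open Scope ring_scope.

(* The arrangements are embedded in a family that is closed under the
   restrictions needed. Each coordinate Y_i carries a radius R_i, and the
   hyperplanes are Y_i +- Y_j = t with |t| <= R_i + R_j, t = R_i + R_j mod 2,
   and Y_i = t with |t| <= U + R_i or |t| <= W + R_i, again in steps of 2, where
   U and W have opposite parity; this describes packings of intervals on a
   half-circle with two walls. With k coordinates and c = U + W + 1 + 2 sum R_i
   the exponents of the cone are 1, c+1, c+3, ..., c+2k-1. If U, W >= -1, a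
   coordinate of radius 0 can be inserted, and a radius can be raised by 1 (after
   a translation), adding hyperplanes one by one: by Terao's addition theorem
   this works because each restriction is again a member of the family with one
   coordinate less, two coordinates merging into one of radius R_i + R_j + 1.
   Finally, for all radii equal to a, deleting the outermost hyperplanes Y_i = t
   lowers U and W, the restrictions being members with larger U; with Y = 2x,
   U = 2m - a and W = -a - 1 one reaches the arrangement for p = 0, and deleting
   Y_i = -2m for i <= p gives the general case.

   The addition and deletion theorems rest on two facts. If H = ker a, then a
   derivation theta logarithmic along the other hyperplanes has theta(a)|_H
   divisible by a polynomial of degree |A'| - |A''|; and if the exponents of A''
   are too few in low degrees, the restrictions to H of the low degree basis
   elements satisfy a homogeneous relation with a constant coefficient. *)

(** * Pullback of polynomials along linear maps *)

(** The shape of the family is dictated by what merging requires. When Y_i and Y_j become one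
    coordinate, their translated ranges must fill a symmetric range again. They do so without a gap
    if U, W >= 0; for the value -1 exactly one number is left out, and the pair of opposite sign
    supplies it. Below -1 this argument fails, which is why a target with W = -a - 1 is reached by
    deletions from larger members. The opposite parity of U and W enters because Y_i + Y_j = t and
    Y_i - Y_j = t' together give 2Y = t + t', whose solutions have both parities. The constant c
    comes from counting: k coordinates carry k(U + W + 2) + 2 sum R_i lines and 2(R_i + R_j + 1)
    hyperplanes for each pair i < j, in total the sum of c + 2i + 1 over i < k. Along one chain of
    additions or deletions every restriction is the same member of the family, whichever hyperplanes
    of the chain are already present. A chain therefore moves a single exponent, by its own length,
    and the order within a chain is irrelevant. *)

Section Homogeneous.
Variables (F : fieldType) (n : nat).
Implicit Types (p q h : {mpoly F[n]}).

Lemma pihomogM_homog d e p h : h \is e.-homog ->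
  pihomog mdeg d (p * h) = if (e <= d)%N then pihomog mdeg (d - e) p * h else 0.
Proof.
move=> hh; rewrite {1}(pihomog_partitionE (leqnn (mmeasure mdeg p))).
rewrite mulr_suml raddf_sum /=.
have E (i : nat) : pihomog mdeg d (pihomog mdeg i p * h) =
    if (i + e == d)%N then pihomog mdeg i p * h else 0.
  have H := dhomogM (pihomogP mdeg i p) hh.
  case: eqP => [<-|/eqP ne]; first exact: pihomog_dE H.
  exact: pihomog_ne0 H.
under eq_bigr do rewrite E.
case: leqP => [le_ed|lt_de]; last first.
  by apply: big1 => i _; rewrite ifN //; apply/eqP; lia.
rewrite -big_mkcond /=.
have [lt|ge] := ltnP (d - e) (mmeasure mdeg p).
  rewrite (big_pred1 (Ordinal lt)) // => i /=; rewrite -val_eqE /=; lia.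
rewrite big_pred0; last by move=> i; have := ltn_ord i; lia.
rewrite pihomogE big_seq_cond big1 ?mul0r // => m /andP[hm /eqP e'].
by have := mmeasure_mnm_lt mdeg hm; rewrite ltnNge; move: ge; rewrite -e' => ->.
Qed.

Lemma homog0_const p : p \is 0.-homog -> exists c, p = c%:MP.
Proof.
move=> hp; exists p@_0; apply/mpolyP => m; rewrite mcoeffC.
case: eqP => [<-|ne]; first by rewrite mulr1.
rewrite mulr0 (dhomog_nemf_coeff hp) // mdeg_eq0; apply/eqP => e; exact: ne.
Qed.

Lemma homogC (c : F) : c%:MP_[n] \is 0.-homog.
Proof. by rewrite -[c%:MP]mulr1 mul_mpolyC; apply: dhomogZ; apply: dhomog1. Qed.

End Homogeneous.

Section Forms.
Variables (F : fieldType).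

Definition coordform (V : vectType F) (i : 'I_(\dim {:V})) : 'Hom(V, F^o) :=
  linfun (coord (vbasis {:V}) i : V -> F^o).

Lemma coordformE (V : vectType F) (i : 'I_(\dim {:V})) v :
  coordform i v = coord (vbasis {:V}) i v.
Proof. by rewrite lfunE. Qed.

Lemma form_expand (V : vectType F) (g : 'Hom(V, F^o)) :
  g = \sum_(i < \dim {:V}) (g (vbasis {:V})`_i) *: coordform i.
Proof.
apply/lfunP => v; rewrite {1}(coord_vbasis (memvf v)) linear_sum sum_lfunE.
apply: eq_bigr => i _; rewrite linearZ scale_lfunE coordformE /=.
exact: mulrC.
Qed.

Lemma form_poly_is_linear (V : vectType F) : linear (@form_poly F V).
Proof.
move=> c f g; rewrite /form_poly scaler_sumr -big_split /=.
apply: eq_bigr => i _; rewrite add_lfunE scale_lfunE scalerDl scalerA.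
by congr (_ + _).
Qed.
HB.instance Definition _ (V : vectType F) :=
  GRing.isLinear.Build F 'Hom(V, F^o) {mpoly F[\dim {:V}]} _ (@form_poly F V)
    (@form_poly_is_linear V).

Lemma form_polyD (V : vectType F) (f g : 'Hom(V, F^o)) :
  form_poly (f + g) = form_poly f + form_poly g.
Proof. exact: linearD. Qed.

Lemma form_polyZ (V : vectType F) c (g : 'Hom(V, F^o)) :
  form_poly (c *: g) = c *: form_poly g.
Proof. exact: linearZ. Qed.

Lemma form_poly_coord (V : vectType F) (i : 'I_(\dim {:V})) :
  form_poly (coordform i) = 'X_i.
Proof.
have fr : free (vbasis {:V}) by apply: basis_free (vbasisP _).
rewrite /form_poly (bigD1 i) //= coordformE coord_free // eqxx scale1r.
rewrite big1 ?addr0 // => j ne; rewrite coordformE coord_free //.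
by rewrite (negPf ne) scale0r.
Qed.

Lemma form_poly_homog (V : vectType F) (g : 'Hom(V, F^o)) :
  form_poly g \is 1.-homog.
Proof.
by apply: rpred_sum => i _; apply: dhomogZ; rewrite dhomogX /= mdeg1.
Qed.

Lemma form_poly_eq0 (V : vectType F) (g : 'Hom(V, F^o)) :
  (form_poly g == 0) = (g == 0).
Proof.
apply/eqP/eqP => [E|->]; last exact: linear0.
rewrite [g]form_expand; apply: big1 => i _.
have := congr1 (fun p : {mpoly F[_]} => p@_U_(i)) E.
rewrite mcoeff0 /form_poly raddf_sum (bigD1 i) //= mcoeffZ mcoeffXU eqxx mulr1.
rewrite big1 ?addr0 => [->|j /negPf ne]; first by rewrite scale0r.
by rewrite mcoeffZ mcoeffXU ne mulr0.
Qed.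

Lemma lker_le (V : vectType F) (f g : 'Hom(V, F^o)) :
  (lker f <= lker g)%VS -> exists c, g = c *: f.
Proof.
move=> /subvP sub; have [f0|nz] := eqVneq f 0.
  exists 0; rewrite f0 scaler0; apply/lfunP => v; rewrite zero_lfunE.
  by apply/eqP; rewrite -memv_ker sub // memv_ker f0 zero_lfunE.
have [v fv] : exists v, f v != 0.
  have /subvPn[v _] : ~~ (fullv <= lker f)%VS.
    apply/negP => /subvP h; case/eqP: nz; apply/lfunP => v.
    by rewrite zero_lfunE; apply/eqP; rewrite -memv_ker h ?memvf.
  by rewrite memv_ker; exists v.
exists (g v / f v); apply/lfunP => w; rewrite scale_lfunE /=.
have : w - (f w / f v) *: v \in lker g.
  apply: sub; rewrite memv_ker linearB linearZ /= -[_ *: _]/(_ * _).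
  by rewrite divfK // subrr.
rewrite memv_ker linearB linearZ /= subr_eq0 => /eqP ->.
exact: (eq_trans (mulrAC _ _ _) (eq_trans (congr1 ( *%R^~ _) (mulrC _ _)) (mulrAC _ _ _))).
Qed.

Lemma lker_scale (V : vectType F) (c : F) (f : 'Hom(V, F^o)) : c != 0 ->
  lker (c *: f) = lker f.
Proof.
move=> nz; apply/vspaceP => v; rewrite !memv_ker scale_lfunE.
by rewrite -[_ *: _]/(_ * _) mulf_eq0 (negPf nz).
Qed.

(** Composition of polynomial functions with [phi]. A subspace carries its own basis, unrelated to
    that of the ambient space, so restricting to a hyperplane is a linear substitution and not the
    vanishing of one variable. *)
Definition pullback (W V : vectType F) (phi : 'Hom(W, V))
    (p : {mpoly F[\dim {:V}]}) : {mpoly F[\dim {:W}]} :=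
  p \mPo [tuple form_poly (coordform i \o phi)%VF | i < \dim {:V}].

HB.instance Definition _ (W V : vectType F) (phi : 'Hom(W, V)) :=
  GRing.RMorphism.copy (pullback phi)
    (comp_mpoly [tuple form_poly (coordform i \o phi)%VF | i < \dim {:V}]).
HB.instance Definition _ (W V : vectType F) (phi : 'Hom(W, V)) :=
  GRing.Linear.copy (pullback phi)
    (comp_mpoly [tuple form_poly (coordform i \o phi)%VF | i < \dim {:V}]).

Section Pullback.
Variables (W V : vectType F) (phi : 'Hom(W, V)).

Lemma pullbackX i : pullback phi 'X_i = form_poly (coordform i \o phi)%VF.
Proof. by rewrite /pullback comp_mpolyXU -tnth_nth tnth_mktuple. Qed.

Lemma pullbackC c : pullback phi c%:MP = c%:MP.
Proof. exact: comp_mpolyC. Qed.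

Lemma pullback_form g : pullback phi (form_poly g) = form_poly (g \o phi)%VF.
Proof.
rewrite {1}/form_poly raddf_sum /=.
have -> : (g \o phi)%VF =
    \sum_(i < \dim {:V}) (g (vbasis {:V})`_i) *: (coordform i \o phi)%VF.
  apply/lfunP => v; rewrite comp_lfunE {1}(form_expand g) !sum_lfunE.
  by apply: eq_bigr => i _; rewrite !scale_lfunE comp_lfunE.
rewrite linear_sum; apply: eq_bigr => i _.
by rewrite !linearZ /= pullbackX.
Qed.

Lemma pullback_homog d p : p \is d.-homog -> pullback phi p \is d.-homog.
Proof.
move=> /dhomogP hp; rewrite /pullback comp_mpolyEX.
rewrite big_seq; apply: rpred_sum => m /hp <-.
apply: dhomogZ; rewrite comp_mpolyX /= mdegE.
elim/big_rec2: _ => [|i d' q _ hq]; first exact: dhomog1.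
apply: dhomogM hq; rewrite tnth_mktuple.
by have := dhomogMn (m i) (form_poly_homog (coordform i \o phi)%VF); rewrite mul1n.
Qed.
End Pullback.

Lemma pullback_comp (U W V : vectType F) (psi : 'Hom(U, W)) (phi : 'Hom(W, V)) p :
  pullback psi (pullback phi p) = pullback (phi \o psi)%VF p.
Proof.
elim/mpolyind: p => [|c m p _ _ IH]; first by rewrite !raddf0.
rewrite !raddfD /= {}IH; congr (_ + _); rewrite !linearZ /=; congr (_ *: _).
rewrite mpolyXE_id !rmorph_prod /=; apply: eq_bigr => i _.
by rewrite !rmorphXn /= !pullbackX pullback_form comp_lfunA.
Qed.

Lemma pullback_id (V : vectType F) p : pullback (\1%VF : 'Hom(V, V)) p = p.
Proof.
rewrite -[RHS]comp_mpoly_id /pullback; congr (_ \mPo _).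
apply: eq_mktuple => i; by rewrite comp_lfun1r form_poly_coord.
Qed.

End Forms.

(** * Derivations and their restriction to a hyperplane *)

Definition divides (n : nat) (F : fieldType) (a f : {mpoly F[n]}) : Prop :=
  exists q, f = q * a.

Section Derivations.
Variables (F : fieldType) (V : vectType F).
Local Notation n := (\dim {:V}).
Local Notation S := {mpoly F[n]}.
Implicit Types (theta : 'rV[S]_n) (g : 'Hom(V, F^o)) (H : {vspace V}).

Definition dv theta g : S := der_app theta (form_poly g).

Lemma dvE theta g :
  dv theta g = \sum_(i < n) g (vbasis {:V})`_i *: theta 0 i.
Proof.
apply: eq_bigr => i _; rewrite /form_poly raddf_sum /= (bigD1 i) //=.
rewrite big1 => [|j ne]; last first.
  by rewrite mderivZ mderivX mnm1E (negPf ne) scale0r scaler0.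
rewrite mderivZ mderivX mnm1E eqxx scale1r addr0 (_ : U_(i) - U_(i) = 0)%MM ?mpolyX0; last first.
  by apply/mnmP => k; rewrite mnmBE mnm0E subnn.
by rewrite -mul_mpolyC mulr1 mulrC mul_mpolyC.
Qed.

Lemma dv_coord theta i : dv theta (coordform i) = theta 0 i.
Proof.
have fr : free (vbasis {:V}) by apply: basis_free (vbasisP _).
rewrite dvE (bigD1 i) //= coordformE coord_free // eqxx scale1r.
rewrite big1 ?addr0 // => j ne; rewrite coordformE coord_free //.
by rewrite (negPf ne) scale0r.
Qed.

Lemma dvDr theta f g : dv theta (f + g) = dv theta f + dv theta g.
Proof.
rewrite !dvE -big_split; apply: eq_bigr => i _.
by rewrite add_lfunE scalerDl.
Qed.

Lemma dvZr theta c g : dv theta (c *: g) = c *: dv theta g.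
Proof.
rewrite !dvE scaler_sumr; apply: eq_bigr => i _.
by rewrite scale_lfunE -scalerA.
Qed.

Lemma dvDl t1 t2 g : dv (t1 + t2) g = dv t1 g + dv t2 g.
Proof.
rewrite !dvE -big_split; apply: eq_bigr => i _.
by rewrite mxE scalerDr.
Qed.

Lemma dvZl (f : S) theta g : dv (f *: theta) g = f * dv theta g.
Proof.
rewrite !dvE mulr_sumr; apply: eq_bigr => i _.
by rewrite mxE scalerAr.
Qed.

Lemma dv0l g : dv 0 g = 0.
Proof. by rewrite dvE big1 // => i _; rewrite mxE scaler0. Qed.

Lemma dv_suml (I : Type) (r : seq I) (P : pred I) (t : I -> 'rV[S]_n) g :
  dv (\sum_(i <- r | P i) t i) g = \sum_(i <- r | P i) dv (t i) g.
Proof.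
by elim/big_rec2: _ => [|i x y _ <-]; rewrite ?dv0l ?dvDl.
Qed.

Lemma dv_homog d theta g : (forall j, theta 0 j \is d.-homog) ->
  dv theta g \is d.-homog.
Proof.
by move=> h; rewrite dvE; apply: rpred_sum => i _; apply: dhomogZ.
Qed.

End Derivations.

Section Restrict.
Variables (F : fieldType) (V : vectType F) (H : {vspace V}).
Local Notation n := (\dim {:V}).
Local Notation S := {mpoly F[n]}.
Implicit Types (theta : 'rV[S]_n) (g : 'Hom(V, F^o)).

Definition incl : 'Hom(subvs_of H, V) := linfun vsval.
Definition proj : 'Hom(V, subvs_of H) := linfun (vsproj H).
Definition res := pullback incl.
(** A ring section of [res], used to lift coefficients from H to V; it depends on the retraction
    [vsproj] of V onto H. *)
Definition ext := pullback proj.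
HB.instance Definition _ := GRing.RMorphism.copy res (pullback incl).
HB.instance Definition _ := GRing.Linear.copy res (pullback incl).
HB.instance Definition _ := GRing.RMorphism.copy ext (pullback proj).
HB.instance Definition _ := GRing.Linear.copy ext (pullback proj).

Lemma inclE v : incl v = vsval v. Proof. by rewrite lfunE. Qed.
Lemma projE v : proj v = vsproj H v. Proof. by rewrite lfunE. Qed.

Lemma proj_incl : (proj \o incl)%VF = \1%VF.
Proof.
by apply/lfunP => v; rewrite comp_lfunE id_lfunE inclE projE vsvalK.
Qed.

Lemma res_ext p : res (ext p) = p.
Proof. by rewrite /res /ext pullback_comp proj_incl pullback_id. Qed.

Lemma resC c : res c%:MP = c%:MP. Proof. exact: pullbackC. Qed.

Lemma res_form g : res (form_poly g) = form_poly (g \o incl)%VF.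
Proof. exact: pullback_form. Qed.

(** If theta(a) vanishes on H = ker a, this is the derivation that theta induces on the quotient of
    S by the form of [a]; in general it depends on the chosen projection. *)
Definition restr_der theta : 'rV[{mpoly F[\dim {:subvs_of H}]}]_(\dim {:subvs_of H}) :=
  \row_k \sum_(i < n) coordform k (proj (vbasis {:V})`_i) *: res (theta 0 i).

Lemma dv_restr theta (g : 'Hom(subvs_of H, F^o)) :
  dv (restr_der theta) g = res (dv theta (g \o proj)%VF).
Proof.
rewrite !dvE raddf_sum /=.
under eq_bigr => k _ do rewrite mxE scaler_sumr.
rewrite exchange_big /=; apply: eq_bigr => i _.
rewrite comp_lfunE linearZ /= {2}(form_expand g) sum_lfunE scaler_suml.
by apply: eq_bigr => k _; rewrite scale_lfunE scalerA.
Qed.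

Lemma restr_derD t1 t2 : restr_der (t1 + t2) = restr_der t1 + restr_der t2.
Proof.
apply/rowP => k; rewrite !mxE -big_split; apply: eq_bigr => i _.
by rewrite mxE rmorphD scalerDr.
Qed.

Lemma restr_derZ f theta : restr_der (f *: theta) = res f *: restr_der theta.
Proof.
apply/rowP => k; rewrite !mxE mulr_sumr; apply: eq_bigr => i _.
by rewrite mxE rmorphM /= scalerAr.
Qed.

Lemma restr_der0 : restr_der 0 = 0.
Proof.
apply/rowP => k; rewrite !mxE big1 // => i _.
by rewrite mxE rmorph0 scaler0.
Qed.

Lemma restr_der_sum (I : Type) (r : seq I) (P : pred I) (t : I -> 'rV[S]_n) :
  restr_der (\sum_(i <- r | P i) t i) = \sum_(i <- r | P i) restr_der (t i).
Proof.
by elim/big_rec2: _ => [|i x y _ <-]; rewrite ?restr_der0 ?restr_derD.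
Qed.

Lemma restr_der_homog d theta : (forall j, theta 0 j \is d.-homog) ->
  forall j, restr_der theta 0 j \is d.-homog.
Proof.
move=> h j; rewrite mxE; apply: rpred_sum => i _; apply: dhomogZ.
exact: pullback_homog.
Qed.

Variable a : 'Hom(V, F^o).
Hypothesis aH : lker a = H.

Lemma form_split g : exists c, g = (g \o incl \o proj)%VF + c *: a.
Proof.
have /lker_le[c E] : (lker a <= lker (g - (g \o incl \o proj)%VF)%R)%VS.
  apply/subvP => v; rewrite aH => vH; rewrite memv_ker add_lfunE opp_lfunE.
  by rewrite !comp_lfunE projE inclE vsprojK // subrr.
by exists c; rewrite -E addrC subrK.
Qed.

Lemma res_form_self : res (form_poly a) = 0.
Proof.
rewrite res_form; apply/eqP; rewrite form_poly_eq0; apply/eqP/lfunP => v.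
rewrite comp_lfunE zero_lfunE inclE; apply/eqP; rewrite -memv_ker aH.
exact: subvsP.
Qed.

(** Since [ext] after [res] is a ring morphism, the polynomials f congruent to [ext (res f)] modulo
    the form of [a] are closed under sums and products; the variables are among them by
    [form_split]. *)
Lemma res_eq0 f : res f = 0 <-> divides (form_poly a) f.
Proof.
split=> [E|[q ->]]; last by rewrite rmorphM /= res_form_self mulr0.
suff [q Eq] : divides (form_poly a) (f - ext (res f)).
  by exists q; rewrite -Eq E rmorph0 subr0.
elim/mpolyind: f {E} => [|c m p _ _ [q IH]].
  by exists 0; rewrite !rmorph0 subr0 mul0r.
suff [q' Eq] : divides (form_poly a) ('X_[m] - ext (res 'X_[m])).
  exists (c *: q' + q); rewrite !rmorphD /= !linearZ /=.
  by rewrite opprD addrACA IH -scalerBr Eq mulrDl scalerAl.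
have M p1 p2 : divides (form_poly a) (p1 - ext (res p1)) ->
    divides (form_poly a) (p2 - ext (res p2)) ->
    divides (form_poly a) (p1 * p2 - ext (res (p1 * p2))).
  move=> [q1 E1] [q2 E2]; exists (q1 * p2 + ext (res p1) * q2).
  rewrite !rmorphM /= mulrDl mulrAC -E1 -mulrA -E2.
  by rewrite mulrBl mulrBr addrA subrK.
rewrite mpolyXE_id; elim/big_rec: _ => [|i p' _ IHp].
  by exists 0; rewrite !rmorph1 subrr mul0r.
apply: (M _ _ _ IHp); elim: (m i) => [|k IHk].
  by exists 0; rewrite !rmorph1 subrr mul0r.
rewrite exprS; apply: (M _ _ _ IHk).
have [d Ed] := form_split (coordform i).
exists d%:MP; rewrite -form_poly_coord res_form /ext pullback_form.
by rewrite {1}Ed raddfD /= addrC addKr linearZ /= mul_mpolyC.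
Qed.

(** Each coordinate form is, up to a multiple of [a], pulled back from H, so all coefficients of
    theta vanish on H. This is what lies behind exactness in the middle of 0 -> D(A') -> D(A) ->
    D(A''), where the first map multiplies by the form of H. *)
Lemma restr_der_eq0 theta : res (dv theta a) = 0 ->
  (restr_der theta = 0 <-> exists zeta, theta = form_poly a *: zeta).
Proof.
move=> ta0; split=> [t0|[z ->]]; last by rewrite restr_derZ res_form_self scale0r.
have R0 i : divides (form_poly a) (theta 0 i).
  apply/res_eq0; have [c E] := form_split (coordform i).
  rewrite -dv_coord E dvDr rmorphD /= dvZr linearZ /= ta0 scaler0 addr0.
  by rewrite -dv_restr t0 dv0l.
have [q Eq] := fin_all_exists R0.
exists (\row_i q i); apply/rowP => i; rewrite !mxE Eq; exact: mulrC.
Qed.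

End Restrict.
Arguments ext {F V} H p.

(** * Linear forms are prime *)

Section Primes.
Variables (F : fieldType) (V : vectType F).
Implicit Types (p q : {mpoly F[\dim {:V}]}) (a g : 'Hom(V, F^o)).

(** The quotient by a nonzero linear form is the polynomial ring of its kernel, hence a domain. *)
Lemma mpoly_prime a p q : a != 0 ->
  divides (form_poly a) (p * q) -> divides (form_poly a) p \/ divides (form_poly a) q.
Proof.
move=> nz; have D := res_eq0 (erefl (lker a)).
rewrite -!D rmorphM /= => /eqP; rewrite mulf_eq0.
by case/orP => /eqP; [left|right].
Qed.

Lemma divides_form a g : divides (form_poly a) (form_poly g) <-> (lker a <= lker g)%VS.
Proof.
rewrite -(res_eq0 (erefl (lker a))) res_form; split.
  move/eqP; rewrite form_poly_eq0 => /eqP E; apply/subvP => v va.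
  have := congr1 (fun f : 'Hom(_, _) => f (vsproj (lker a) v)) E.
  by rewrite comp_lfunE inclE vsprojK // zero_lfunE memv_ker => ->.
move=> /lker_le[c ->]; apply/eqP; rewrite form_poly_eq0; apply/eqP/lfunP => v.
rewrite comp_lfunE scale_lfunE inclE.
by have := subvsP v; rewrite memv_ker => /eqP ->; rewrite scaler0 zero_lfunE.
Qed.

End Primes.

(** * Logarithmic derivations *)

Section LogDerivations.
Variables (F : fieldType) (V : vectType F).
Local Notation n := (\dim {:V}).
Local Notation S := {mpoly F[n]}.
Implicit Types (theta : 'rV[S]_n) (a g : 'Hom(V, F^o)) (H : {vspace V})
  (A : {fset {vspace V}}) (p q f : S).

Definition has_forms A : Prop :=
  forall H, H \in A -> exists2 a : 'Hom(V, F^o), a != 0 & lker a = H.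

Lemma dim_lker_form a : a != 0 -> (\dim (lker a)).+1 = n.
Proof.
move=> nz; have := limg_ker_dim a fullv; rewrite capfv => <-.
suff -> : \dim (limg a) = 1%N by rewrite addn1.
apply/eqP; rewrite eqn_leq; apply/andP; split.
  by rewrite -[X in (_ <= X)%N](dimvf F^o) dimvS ?subvf.
rewrite lt0n dimv_eq0; apply: contra nz => /eqP E; apply/eqP/lfunP => v.
by rewrite zero_lfunE; apply/eqP; rewrite -memv0 -E memv_img ?memvf.
Qed.

Lemma has_forms_central A : has_forms A -> central_arrangement A.
Proof. by move=> h H /h[a nz <-]; apply: dim_lker_form. Qed.

Lemma divides_lker a g : a != 0 -> g != 0 ->
  divides (form_poly a) (form_poly g) -> lker a = lker g.
Proof.
move=> anz gnz /divides_form /lker_le[c E]; rewrite E lker_scale //.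
by apply: contraNneq gnz => c0; rewrite E c0 scale0r.
Qed.

Lemma divides_pow a p k : a != 0 ->
  divides (form_poly a) (p ^+ k) -> divides (form_poly a) p.
Proof.
move=> nz; elim: k => [|k IH]; last by rewrite exprS => /(mpoly_prime nz)[|/IH].
move/(res_eq0 (erefl _)); rewrite rmorph1 => /eqP.
by rewrite oner_eq0.
Qed.

Lemma divides_gauss a p q k : a != 0 -> ~ divides (form_poly a) q ->
  divides (form_poly a ^+ k) (p * q) -> divides (form_poly a ^+ k) p.
Proof.
move=> nz nq; elim: k p => [|k IH] p; first by exists p; rewrite expr0 mulr1.
move=> [r Er].
have [|//|[p' Ep']] := mpoly_prime nz (p := q) (q := p).
  by exists (r * form_poly a ^+ k); rewrite mulrC Er exprSr mulrA.
have [|r' Er'] := IH p'; last by exists r'; rewrite Ep' Er' exprSr mulrA.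
exists r; apply: (@mulIf _ (form_poly a)); first by rewrite form_poly_eq0.
by rewrite mulrAC -Ep' -mulrA -exprSr.
Qed.

(** Forms with distinct kernels do not divide one another and each is prime, so the powers can be
    split off one at a time; this takes the place of unique factorization. *)
Lemma prod_divides (I : eqType) (r : seq I) (u : I -> 'Hom(V, F^o))
    (e : I -> nat) f :
  uniq r -> {in r, forall i, u i != 0} ->
  {in r &, forall i j, lker (u i) = lker (u j) -> i = j} ->
  {in r, forall i, divides (form_poly (u i) ^+ e i) f} ->
  divides (\prod_(i <- r) form_poly (u i) ^+ e i) f.
Proof.
elim: r => [|i r IH] /=; first by exists f; rewrite big_nil mulr1.
case/andP=> nir ur nz inj hd.
have [|||q Eq] := IH ur.
- by move=> j jr; apply: nz; rewrite inE jr orbT.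
- by move=> j k jr kr; apply: inj; rewrite inE ?jr ?kr orbT.
- by move=> j jr; apply: hd; rewrite inE jr orbT.
have inz : u i != 0 by apply: nz; rewrite inE eqxx.
have [||q' Eq'] := @divides_gauss (u i) q (\prod_(j <- r) form_poly (u j) ^+ e j) (e i) inz.
- rewrite big_seq; elim/big_rec: _ => [|j P jr IHP].
    by move=> /(@divides_pow _ 1 1 inz) /(res_eq0 (erefl _))/eqP; rewrite rmorph1 oner_eq0.
  case/(mpoly_prime inz) => // /(divides_pow inz).
  have jr' : j \in i :: r by rewrite inE jr orbT.
  move/(divides_lker inz (nz _ jr'))/inj => E.
  by move: nir; rewrite E ?jr // inE eqxx.
- by rewrite -Eq; apply: hd; rewrite inE eqxx.
by exists q'; rewrite big_cons mulrA -Eq'.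
Qed.

Lemma logderD A t1 t2 :
  log_derivation A t1 -> log_derivation A t2 -> log_derivation A (t1 + t2).
Proof.
move=> h1 h2 H a HA aH; have [q1 E1] := h1 H a HA aH; have [q2 E2] := h2 H a HA aH.
by exists (q1 + q2); rewrite -[LHS]/(dv _ _) dvDl /dv E1 E2 mulrDl.
Qed.

Lemma logderZ A f theta : log_derivation A theta -> log_derivation A (f *: theta).
Proof.
move=> h H a HA aH; have [q E] := h H a HA aH.
by exists (f * q); rewrite -[LHS]/(dv _ _) dvZl /dv E mulrA.
Qed.

Lemma logder0 A : log_derivation A (0 : 'rV[S]_n).
Proof.
by move=> H a _ _; exists 0; rewrite -[LHS]/(dv _ _) dv0l mul0r.
Qed.

Lemma logder_sum A (I : Type) (r : seq I) (P : pred I) (t : I -> 'rV[S]_n) :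
  (forall i, P i -> log_derivation A (t i)) ->
  log_derivation A (\sum_(i <- r | P i) t i).
Proof.
by move=> h; elim/big_rec: _ => [|i x Pi hx]; [apply: logder0|apply: logderD (h _ Pi) hx].
Qed.

Lemma logder_deletion A a theta : lker a \in A ->
  log_derivation A theta <->
  log_derivation (deletion A (lker a)) theta /\ res (lker a) (dv theta a) = 0.
Proof.
move=> aA; split=> [h|[h1 h2] H g HA gH].
  split=> [H g|]; first by rewrite in_fsetD1 => /andP[_]; apply: h.
  by apply/(res_eq0 (erefl (lker a))); apply: (h (lker a)).
have [E|ne] := eqVneq H (lker a); last by apply: h1 gH; rewrite in_fsetD1 ne.
have [c ->] : exists c, g = c *: a by apply: lker_le; rewrite gH E.
have [->|nz] := eqVneq c 0.
  by exists 0; rewrite scale0r -[LHS]/(dv _ _) linear0 mulr0 dvE big1 // => i _;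
     rewrite zero_lfunE scale0r.
have [q Eq] := (res_eq0 (erefl _) _).1 h2.
exists q; rewrite -[LHS]/(dv _ _) dvZr Eq linearZ /=.
by rewrite scalerAr.
Qed.

(** No form of [A] is proportional to [a], so primality passes the divisibility from the product to
    the value of theta. *)
Lemma logder_cancel A a theta : a != 0 -> has_forms A -> lker a \notin A ->
  log_derivation A (form_poly a *: theta) -> log_derivation A theta.
Proof.
move=> nz fA na h H g HA gH.
have [q] := h H g HA gH; rewrite -[LHS]/(dv _ _) dvZl => E.
have [g0|gnz] := eqVneq g 0.
  by exists 0; rewrite g0 -[LHS]/(dv _ _) linear0 mulr0 dvE big1 // => i _;
     rewrite zero_lfunE scale0r.
have [|/(divides_lker gnz nz) E'|//] := @mpoly_prime _ _ g (form_poly a) (dv theta g) gnz.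
  by exists q.
by case/negP: na; rewrite -E' gH.
Qed.

Lemma lker_incl H g : lker (g \o incl H)%VF = (incl H @^-1: lker g)%VS.
Proof. by apply/vspaceP => v; rewrite -memv_preim !memv_ker comp_lfunE. Qed.

Lemma in_restriction A H (K : {vspace (subvs_of H)}) : K \in restriction A H <->
  exists2 L, (L \in A) && (L != H) & K = (incl H @^-1: L)%VS.
Proof.
split=> [/imfsetP[L /=]|[L /andP[LA ne] ->]].
  by rewrite in_fsetD1 andbC; exists L.
by apply/imfsetP; exists L => //=; rewrite in_fsetD1 ne.
Qed.

Lemma restr_logder A a theta : a != 0 -> lker a \in A -> has_forms A ->
  log_derivation A theta -> log_derivation (restriction A (lker a)) (restr_der (lker a) theta).
Proof.
move=> nz aA fA h K b /in_restriction[L /andP[LA Lne] ->] bK.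
have [g gnz gL] := fA L LA.
have [c Ec] : exists c, b = c *: (g \o incl (lker a))%VF.
  by apply: lker_le; rewrite lker_incl bK gL.
have [d Ed] := form_split (erefl (lker a)) (c *: g).
have Eb : (c *: g \o incl (lker a))%VF = b.
  by rewrite Ec; apply/lfunP => v; rewrite !(comp_lfunE, scale_lfunE).
rewrite Eb in Ed.
rewrite -[der_app _ _]/(dv _ _) dv_restr.
(* The lift of b along the projection differs from a multiple of g by a multiple of [a], and
   theta(a) vanishes on H. *)
have -> : (b \o proj (lker a))%VF = c *: g - d *: a by rewrite Ed addrK.
rewrite dvDr -scaleNr !dvZr rmorphD /= !linearZ /=.
have [q Eq] := h _ a aA (erefl _); have [r Er] := h _ g LA gL.
rewrite /dv Eq Er !rmorphM /= (res_form_self (erefl (lker a))) mulr0 scaler0 addr0.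
exists (res _ r); rewrite Ec linearZ /= res_form; by rewrite scalerAr.
Qed.

End LogDerivations.

(** * The polynomial dividing theta(a) on H *)

Section RestrictionDivisor.
Variables (F : fieldType) (V : vectType F).
Implicit Types (A : {fset {vspace V}}) (a : 'Hom(V, F^o)).

Lemma sum_fibers (T U : eqType) (f : T -> U) (s : seq T) (t : seq U) :
  uniq t -> {in s, forall x, f x \in t} ->
  (\sum_(y <- t) count (fun x => f x == y) s)%N = size s.
Proof.
move=> ut st; elim: s st => [|x s IH] st; first by rewrite big1.
rewrite /= big_split /= IH => [|y ys]; last by apply: st; rewrite inE ys orbT.
rewrite (eq_bigr (fun y => (if y == f x then 1 else 0)%N)) => [|y _]; last first.
  by rewrite eq_sym; case: eqP.
rewrite -big_mkcond /= -(big_filter _ (fun y => y == f x)) sum1_size size_filter.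
by rewrite (count_uniq_mem _ ut) st ?inE ?eqxx // add1n.
Qed.

Lemma has_forms_restriction A a : has_forms A -> lker a \in A ->
  has_forms (restriction A (lker a)).
Proof.
move=> fA aA K /in_restriction[L /andP[LA Lne] ->].
have [g gnz gL] := fA L LA; exists (g \o incl (lker a))%VF; last first.
  by rewrite lker_incl gL.
apply: contra_neq Lne => E; rewrite -gL; apply/esym/divides_lker => //.
  apply: contraTneq LA => a0; have : lker a = fullv.
    by apply/vspaceP => v; rewrite memv_ker a0 zero_lfunE eqxx memvf.
  have [b bnz bE] := fA _ aA; have := dim_lker_form bnz.
  by rewrite bE => + E'; rewrite E' => /eqP; rewrite -[X in _ == X]addn0 -addn1 eqn_add2l.
by apply/(res_eq0 (erefl _)); rewrite res_form E linear0.
Qed.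

(* Two hyperplanes with the same trace on ker a, and ker a itself, have linearly
   dependent forms, so theta(a) picks up a factor for all but one hyperplane of
   each fiber of the restriction map. *)
Lemma fiber_divides A a (g : {vspace V} -> 'Hom(V, F^o))
    (u : 'Hom(subvs_of (lker a), F^o)) theta (r : seq {vspace V}) :
  a != 0 -> u != 0 -> log_derivation (deletion A (lker a)) theta -> uniq r ->
  {in r, forall K, [/\ K \in deletion A (lker a), g K != 0, lker (g K) = K
     & (incl (lker a) @^-1: K)%VS = lker u]} ->
  divides (form_poly u ^+ (size r).-1) (res (lker a) (dv theta a)).
Proof.
set H := lker a => nz unz tD ur hr.
case: r ur hr => [|K0 r] ur hr.
  by exists (res H (dv theta a)); rewrite mulr1.
have hc K : K \in K0 :: r -> exists2 c : F, c != 0 & (g K \o incl H)%VF = c *: u.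
  move=> Kr; have [KA gnz gK KX] := hr K Kr.
  have [c Ec] : exists c, (g K \o incl H)%VF = c *: u.
    by apply: lker_le; rewrite lker_incl gK KX.
  exists c => //; apply/eqP => c0; rewrite c0 scale0r in Ec.
  have : divides (form_poly a) (form_poly (g K)).
    by apply/(res_eq0 (erefl H)); rewrite res_form Ec linear0.
  move/(divides_lker nz gnz); rewrite gK => E.
  by move: KA; rewrite -E in_fsetD1 eqxx.
have K0r : K0 \in K0 :: r by rewrite inE eqxx.
have [c0 c0nz Ec0] := hc K0 K0r.
(* A 2x2 determinant. Any form in the span of [a] and [g K0] may replace [g K0] at the cost of a
   scalar, and with [g K] in that place both terms are divisible by [g K]. *)
set N := form_poly a * dv theta (g K0) - form_poly (g K0) * dv theta a.
have : divides (\prod_(K <- K0 :: r) form_poly (g K) ^+ 1) N.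
  apply: prod_divides => // [K Kr|K L Kr Lr|K Kr].
  - by have [] := hr K Kr.
  - by have [_ _ -> _] := hr K Kr; have [_ _ -> _] := hr L Lr.
  have [KA gnz gK KX] := hr K Kr; have [c cnz Ec] := hc K Kr.
  have [d Ed] : exists d, g K - (c / c0) *: g K0 = d *: a.
    apply: lker_le; apply/subvP => v va; rewrite memv_ker add_lfunE opp_lfunE.
    have Ev : incl H (vsproj H v) = v by rewrite inclE vsprojK.
    rewrite -Ev scale_lfunE -!comp_lfunE Ec Ec0 !scale_lfunE.
    by rewrite scalerA divfK // subrr.
  have EK : g K = (c / c0) *: g K0 + d *: a by rewrite -Ed addrC subrK.
  have [q Eq] := tD _ (g K) KA gK.
  have nz' : c / c0 != 0 by rewrite mulf_neq0 ?invr_eq0.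
  rewrite expr1; exists ((c / c0)^-1 *: (form_poly a * q - dv theta a)).
  have Eq' : dv theta (g K) = q * form_poly (g K) by [].
  apply: (scalerI nz'); rewrite -scalerAl scalerA mulfV // scale1r.
  rewrite mulrBl -mulrA -Eq' EK dvDr !dvZr form_polyD !form_polyZ.
  rewrite /N scalerBr mulrDr mulrDr -!scalerAr [_ * form_poly (g K0)]mulrC.
  rewrite [dv theta a * _]mulrC opprD addrACA subrr addr0.
  by [].
(* On H only the term with theta(a) survives in N, with one factor [u], while the product becomes a
   multiple of [u] to the size of the fiber; cancelling one [u] gives the claim. *)
case=> q /(congr1 (res H)); rewrite rmorphB !rmorphM /= (res_form_self (erefl H)).
rewrite mul0r sub0r res_form Ec0 form_polyZ rmorph_prod /=.
have [q' ->] : divides (form_poly u ^+ (size r).+1)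
    (\prod_(K <- K0 :: r) res H (form_poly (g K) ^+ 1)).
  have: {subset K0 :: r <= K0 :: r} by [].
  rewrite -[(size r).+1]/(size (K0 :: r)); elim: {1 3 4}(K0 :: r) => [|K s IH] sub.
    by exists 1; rewrite big_nil mulr1.
  have [|p Ep] := IH; first by move=> L Ls; apply: sub; rewrite inE Ls orbT.
  have [|c _ Ec] := hc K; first by apply: sub; rewrite inE eqxx.
  rewrite big_cons Ep expr1 res_form Ec form_polyZ; exists (c *: p).
  by rewrite exprS -!scalerAl mulrCA.
move=> E; exists (- c0^-1 *: (res H q * q')).
apply: (@mulfI _ (form_poly u)); first by rewrite form_poly_eq0.
apply: (scalerI c0nz); rewrite scalerAl -[LHS]opprK E.
rewrite -!scalerAl -!scalerAr scalerA mulrN mulfV // scaleN1r; congr (- _).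
by rewrite exprS; ring.
Qed.

Lemma restriction_divisor A a : a != 0 -> lker a \in A -> has_forms A ->
  exists B, [/\ B != 0,
    (#|` restriction A (lker a)| <= #|` deletion A (lker a)|)%N,
    B \is (#|` deletion A (lker a)| - #|` restriction A (lker a)|).-homog
    & forall theta, log_derivation (deletion A (lker a)) theta ->
        divides B (res (lker a) (dv theta a))].
Proof.
set H := lker a => nz aA fA; have fR := has_forms_restriction fA aA.
(* A form for each hyperplane, with the default value 0 outside [A]. *)
have [g hg] := boolp.choice (fun K => let P g := K \in A -> g != 0 /\ lker g = K in
  match boolP (K \in A) return exists g : 'Hom(V, F^o), P g with
  | AltTrue h => let: ex_intro2 b p q := fA K h in ex_intro P b (fun _ => conj p q)
  | AltFalse h => ex_intro P 0 (fun h' => False_ind _ (negP h h'))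
  end).
have [u hu] := boolp.choice (fun K => let P g := K \in restriction A H -> g != 0 /\ lker g = K in
  match boolP (K \in restriction A H) return exists g : 'Hom(subvs_of H, F^o), P g with
  | AltTrue h => let: ex_intro2 b p q := fR K h in ex_intro P b (fun _ => conj p q)
  | AltFalse h => ex_intro P 0 (fun h' => False_ind _ (negP h h'))
  end).
pose f (K : {vspace V}) := (incl H @^-1: K)%VS.
pose e X := (count (fun K => f K == X) (deletion A H)).-1.
have ec X : X \in restriction A H ->
    count (fun K => f K == X) (deletion A H) = (e X).+1.
  move=> /imfsetP[K /= KA EX]; rewrite /e prednK // -has_count.
  by apply/hasP; exists K => //; apply/eqP.
have se : (\sum_(X <- restriction A H) e X + #|` restriction A H| = #|` deletion A H|)%N.
  rewrite -(@sum_fibers _ _ f (deletion A H) (restriction A H)) ?fset_uniq //; last first.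
    by move=> K KA; apply/imfsetP; exists K.
  rewrite -[#|` restriction A H|]sum1_size -big_split /= big_seq [RHS]big_seq.
  by apply: eq_bigr => X /ec ->; rewrite addn1.
(* The power of [u X] is one less than the number of hyperplanes of A' with trace X, so the degrees
   add up to |A'| - |A''|. *)
exists (\prod_(X <- restriction A H) form_poly (u X) ^+ e X); split.
- rewrite prodf_seq_neq0; apply/allP => X /hu[unz _] /=.
  by rewrite expf_eq0 form_poly_eq0 negb_and unz orbT.
- by rewrite -se leq_addl.
- rewrite -se addnK; elim/big_rec2: _ => [|X d q _ hq]; first exact: dhomog1.
  apply: dhomogM hq.
  by have := dhomogMn (e X) (form_poly_homog (u X)); rewrite mul1n.
move=> theta tD; apply: prod_divides; first exact: fset_uniq.
- by move=> X /hu[].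
- by move=> X Y /hu[_ ->] /hu[_ ->].
move=> X XR; have [unz uX] := hu X XR.
rewrite /e -size_filter; apply: (@fiber_divides A a g) => //.
  by rewrite filter_uniq // fset_uniq.
move=> K; rewrite mem_filter => /andP[/eqP EX KA].
have KA' : K \in A by move: KA; rewrite in_fsetD1 => /andP[].
by have [? ?] := hg K KA'; split; rewrite // uX.
Qed.

End RestrictionDivisor.

(** * Relations between homogeneous vectors *)

Section GradedRelation.
Variables (F : fieldType) (n k : nat).
Local Notation S := {mpoly F[n]}.
Local Notation M := 'rV[S]_k.

Definition homv (d : nat) (w : M) : Prop := forall j, w 0 j \is d.-homog.

(** The parts of the wrong degree cancel, so each coefficient can be replaced by its component of
    complementary degree. *)
Lemma homv_sum d (I : finType) (P : pred I) (w : I -> M) (e : I -> nat) (f : I -> S) :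
  (forall i, P i -> homv (e i) (w i)) ->
  homv d (\sum_(i | P i) f i *: w i) ->
  \sum_(i | P i) f i *: w i =
  \sum_(i | P i) (if (e i <= d)%N then pihomog mdeg (d - e i) (f i) else 0) *: w i.
Proof.
move=> hw hs; apply/rowP => j; rewrite -(pihomog_dE (hs j)) !summxE raddf_sum /=.
apply: eq_bigr => i Pi; rewrite !mxE (pihomogM_homog _ _ (hw i Pi j)).
by case: ifP; rewrite ?mul0r.
Qed.

(** In the application [eta] is a homogeneous basis of D(A'') and the [w i] are the restrictions to
    H of a basis upstairs. Only those of degree at most [delta] are assumed to lie in the span of
    [eta]: the others may come from derivations that are not tangent to H. *)
Variables (m r : nat) (eta : 'I_m -> M) (e : 'I_m -> nat).
Variables (w : 'I_r -> M) (d : 'I_r -> nat) (delta : nat).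
Hypothesis eta_hom : forall s, homv (e s) (eta s).
Hypothesis w_hom : forall i, (d i <= delta)%N -> homv (d i) (w i).
Hypothesis w_span : forall i, (d i <= delta)%N ->
  exists f : 'I_m -> S, w i = \sum_s f s *: eta s.

Definition low_span eps (v : M) : Prop := exists g : 'I_r -> S,
  (forall i, (eps <= d i)%N -> g i = 0) /\ v = \sum_i g i *: w i.

Lemma low_spanD eps u v : low_span eps u -> low_span eps v -> low_span eps (u + v).
Proof.
move=> [f [f0 ->]] [g [g0 ->]]; exists (fun i => f i + g i); split.
  by move=> i h; rewrite f0 // g0 // addr0.
by rewrite -big_split; apply: eq_bigr => i _; rewrite scalerDl.
Qed.

Lemma low_spanZ eps c v : low_span eps v -> low_span eps (c *: v).
Proof.
move=> [f [f0 ->]]; exists (fun i => c * f i); split.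
  by move=> i h; rewrite f0 // mulr0.
by rewrite scaler_sumr; apply: eq_bigr => i _; rewrite scalerA.
Qed.

Lemma low_span_sum eps (I : finType) (P : pred I) (f : I -> S) (v : I -> M) :
  (forall i, P i -> low_span eps (v i)) -> low_span eps (\sum_(i | P i) f i *: v i).
Proof.
move=> h; elim/big_rec: _ => [|i x Pi hx]; last exact: low_spanD (low_spanZ _ (h i Pi)) hx.
by exists (fun=> 0); split=> //; rewrite big1 // => i _; rewrite scale0r.
Qed.

Lemma low_span_gen i : low_span (d i).+1 (w i).
Proof.
exists (fun j => (j == i)%:R); split=> [j|].
  by case: eqP => // ->; rewrite ltnn.
rewrite (bigD1 i) //= eqxx scale1r big1 ?addr0 // => j /negPf ->.
by rewrite scale0r.
Qed.

Lemma low_spanS eps eps' v : (eps <= eps')%N -> low_span eps v -> low_span eps' v.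
Proof.
move=> le [g [g0 E]]; exists g; split=> // i h; apply: g0; exact: leq_trans h.
Qed.

(** A homogeneous relation of degree [d j] in which [w j] has a nonzero constant coefficient, so
    that [w j] is redundant. *)
Definition unit_relation : Prop := exists (f : 'I_r -> S) (j : 'I_r) (c : F),
  [/\ (d j <= delta)%N, c != 0, f j = c%:MP,
      forall i, (d j < d i)%N -> f i = 0 &
      forall i, f i \is (d j - d i).-homog] /\ \sum_i f i *: w i = 0.

(** Modulo combinations of lower [w], the [w] of degree [eps] are combinations of the [eta] of
    degree [eps] with coefficients in F, collected in the matrix C. A linear dependence between rows
    of C is a unit relation. Independent rows bound the number of rows by that of columns, and in
    case of equality C is invertible and recovers the [eta] of degree [eps] from the [w]. *)
Lemma relation_step eps : (eps <= delta)%N ->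
  (forall s, (e s < eps)%N -> low_span eps (eta s)) ->
  unit_relation \/ (#|[pred i | d i == eps]| <= #|[pred s | e s == eps]|)%N /\
    (#|[pred i | d i == eps]| = #|[pred s | e s == eps]| ->
      forall s, (e s < eps.+1)%N -> low_span eps.+1 (eta s)).
Proof.
move=> le_eps low.
set R := [pred i | d i == eps]; set T := [pred s | e s == eps].
have wE i : exists a : 'I_m -> S, d i = eps ->
    w i = \sum_(s in T) ((a s)@_0%MM)%:MP *: eta s + \sum_(s | (e s < eps)%N) a s *: eta s.
  have [di|ne] := eqVneq (d i) eps; last by exists (fun=> 0) => E; rewrite E eqxx in ne.
  have dle : (d i <= delta)%N by rewrite di.
  have [f Ef] := w_span dle.
  have := w_hom dle; rewrite di Ef.
  move/(homv_sum (fun s _ => eta_hom s)) => E.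
  exists (fun s => pihomog mdeg (eps - e s) (f s)) => _; rewrite E.
  rewrite (bigID (mem T)) /=; congr (_ + _).
    apply: eq_bigr => s /eqP es; rewrite es leqnn subnn.
    have [c Ec] := homog0_const (pihomogP mdeg 0 (f s)).
    by rewrite {2}Ec mcoeffC eqxx mulr1 -Ec.
  rewrite big_mkcond [RHS]big_mkcond; apply: eq_bigr => s _.
  rewrite inE; case: ltngtP => //= _; by rewrite scale0r.
have [a Ea] := fin_all_exists wE.
pose C : 'M[F]_(#|R|, #|T|) := \matrix_(x, y) (a (enum_val x) (enum_val y))@_0%MM.
have wC x : low_span eps (w (enum_val x) - \sum_y (C x y)%:MP *: eta (enum_val y)).
  have /eqP/Ea -> := enum_valP x.
  rewrite [X in X + _ - _]big_enum_val /=.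
  under [X in _ - X]eq_bigr => y _ do rewrite mxE.
  by rewrite addrC addKr; apply: low_span_sum.
have [rf|nrf] := boolP (row_free C); last first.
  left; have /rowV0Pn[v /sub_kermxP vC vnz] : kermx C != 0 by rewrite kermx_eq0.
  have [x vx] : exists x, v 0 x != 0.
    apply/existsP; apply: contraNT vnz; rewrite negb_exists => /forallP h.
    by apply/eqP/rowP => x; rewrite mxE; apply/eqP; move: (h x); rewrite negbK.
  have [g [g0 Eg]] : low_span eps (\sum_x (v 0 x)%:MP *: w (enum_val x)).
    have -> : \sum_x (v 0 x)%:MP *: w (enum_val x) = \sum_x (v 0 x)%:MP *:
        (w (enum_val x) - \sum_y (C x y)%:MP *: eta (enum_val y)).
      apply/eqP; rewrite -subr_eq0 -sumrB; apply/eqP.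
      under eq_bigr => z _ do rewrite scalerBr opprB addrC subrK scaler_sumr.
      rewrite exchange_big big1 //= => y _.
      under eq_bigr => z _ do rewrite scalerA -mpolyCM.
      rewrite -scaler_suml -raddf_sum /=.
      have := congr1 (fun A : 'rV_#|T| => A 0 y) vC; rewrite !mxE => ->.
      by rewrite raddf0 scale0r.
    by apply: low_span_sum.
  have hg : homv eps (\sum_i g i *: w i).
    rewrite -Eg => j; rewrite summxE; apply: rpred_sum => z _.
    rewrite !mxE mul_mpolyC; apply: dhomogZ.
    have /eqP dz := enum_valP z.
    by rewrite -dz; apply: w_hom; rewrite dz.
  have Eg' : \sum_i g i *: w i = \sum_(i | (d i < eps)%N) g i *: w i.
    rewrite [RHS]big_mkcond; apply: eq_bigr => i _; case: ltnP => // h.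
    by rewrite g0 // scale0r.
  rewrite Eg' in Eg hg.
  have {Eg'} Eg' := homv_sum (fun i (h : (d i < eps)%N) =>
     w_hom (leq_trans (ltnW h) le_eps)) hg.
  have /eqP dx := enum_valP x.
  (* The row v of the kernel, extended by 0 to all indices. *)
  pose c i := \sum_(z | enum_val z == i) v 0 z.
  have cE z : c (enum_val z) = v 0 z.
    by rewrite /c (big_pred1 z) // => z' /=; rewrite (inj_eq enum_val_inj).
  have c0 i : d i != eps -> c i = 0.
    move=> ne; rewrite /c big1 // => z /eqP zi; have /eqP := enum_valP z.
    by rewrite zi => E; rewrite E eqxx in ne.
  exists (fun i => (c i)%:MP -
    if (d i < eps)%N then pihomog mdeg (eps - d i) (g i) else 0), (enum_val x), (v 0 x).
  rewrite dx; split; [split=> //|].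
  - by rewrite cE ltnn subr0.
  - by move=> i lt; rewrite ltnNge (ltnW lt) subr0 c0 ?raddf0 // gtn_eqF.
  - move=> i; case: ltngtP => [lt|gt|E].
    + by rewrite c0 ?ltn_eqF // raddf0 sub0r dhomogN; apply: pihomogP.
    + by rewrite c0 ?gtn_eqF // raddf0 subr0 dhomog0.
    + by rewrite E subnn subr0; apply: homogC.
  under eq_bigr => i _ do rewrite scalerBl.
  rewrite sumrB; apply/eqP; rewrite subr_eq0; apply/eqP.
  transitivity (\sum_z (v 0 z)%:MP *: w (enum_val z)).
    under eq_bigr => i _ do rewrite /c raddf_sum scaler_suml big_mkcond.
    rewrite exchange_big /=; apply: eq_bigr => z _.
    by rewrite -big_mkcond (big_pred1 (enum_val z)) // => i; rewrite eq_sym.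
  rewrite Eg Eg' big_mkcond; apply: eq_bigr => i _.
  by case: ltnP => // h; rewrite ?scale0r // (ltnW h).
right; have rk : \rank C = #|R| by apply/eqP.
split; first by rewrite -rk rank_leq_col.
move=> ERT s; rewrite ltnS leq_eqVlt => /predU1P[es|]; last first.
  by move/low; apply: low_spanS.
have rF : row_full C by rewrite /row_full rk ERT.
have [C' EC'] := row_fullP rF.
have sT : s \in T by rewrite inE es.
set y := enum_rank_in sT s.
have ys : enum_val y = s by rewrite enum_rankK_in.
have -> : eta s = \sum_x (C' y x)%:MP *: (w (enum_val x)
     - (w (enum_val x) - \sum_y (C x y)%:MP *: eta (enum_val y))).
  under eq_bigr => x _ do rewrite opprB addrC subrK scaler_sumr.
  rewrite exchange_big /= (bigD1 y) //=.
  have E z : \sum_x (C' y x)%:MP *: ((C x z)%:MP *: eta (enum_val z)) =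
      ((1%:M : 'M[F]_#|T|) y z)%:MP *: eta (enum_val z).
    rewrite -EC' mxE raddf_sum scaler_suml; apply: eq_bigr => x _.
    by rewrite scalerA -mpolyCM.
  rewrite E big1 => [|z ne]; last by rewrite E mxE eq_sym (negPf ne) raddf0 scale0r.
  by rewrite mxE eqxx mpolyC1 scale1r addr0 ys.
apply: low_span_sum => x _; apply: low_spanD.
  by have /eqP <- := enum_valP x; apply: low_span_gen.
by rewrite -scaleN1r; apply: low_spanZ; apply: low_spanS (wC x).
Qed.

(** Below [delta] the numbers of generators agree, so degree by degree the [eta] become combinations
    of the [w] unless a unit relation has occurred; in degree [delta] there are too many [w] for
    independent rows. *)
Lemma graded_relation :
  (forall eps, (eps < delta)%N ->
     #|[pred s | e s == eps]| = #|[pred i | d i == eps]|) ->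
  (#|[pred s | e s == delta]| < #|[pred i | d i == delta]|)%N ->
  unit_relation.
Proof.
move=> heq hlt.
have Q eps : (eps <= delta)%N ->
    unit_relation \/ forall s, (e s < eps)%N -> low_span eps (eta s).
  elim: eps => [|eps IH] le; first by right.
  have [ur|low] := IH (ltnW le); first by left.
  have [ur|[_ h]] := relation_step (ltnW le) low; first by left.
  by right; apply: h; rewrite heq.
have [//|low] := Q _ (leqnn _).
by have [//|[]] := relation_step (leqnn _) low; rewrite leqNgt hlt.
Qed.

End GradedRelation.

(** * Terao's addition and deletion theorems *)

Section AdditionDeletion.
Variables (F : fieldType) (V : vectType F).
Local Notation n := (\dim {:V}).
Local Notation S := {mpoly F[n]}.
Implicit Types (A : {fset {vspace V}}) (a : 'Hom(V, F^o)).

Lemma count_exponents (e : seq nat) x :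
  #|[pred i : 'I_(size e) | nth 0%N e i == x]| = count_mem x e.
Proof.
rewrite -sum1_card -sum1_count (big_nth 0%N) big_mkord.
by apply: eq_bigl => i; rewrite inE.
Qed.

Lemma free_of_basis A k (d : 'I_k -> nat) (theta : 'I_k -> 'rV[S]_n) e :
  log_basis A theta -> (forall i, homv (d i) (theta i)) ->
  perm_eq [seq d i | i <- enum 'I_k] e -> free_with_exponents A e.
Proof.
move=> [tD span indep] hom pe.
have ek : size e = k by rewrite -(perm_size pe) size_map size_enum_ord.
have /(perm_iotaP 0%N)[s ps Es] : perm_eq e [seq d i | i <- enum 'I_k].
  by rewrite perm_sym.
rewrite size_map size_enum_ord in ps.
have ss : size s = k by rewrite (perm_size ps) size_iota.
have sk (i : 'I_(size e)) : (nth 0 s i < k)%N.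
  have : nth 0%N s i \in s by rewrite mem_nth // ss -ek.
  by rewrite (perm_mem ps) mem_iota.
pose p i := Ordinal (sk i).
have pinj : injective p.
  move=> i j /(congr1 val) /= /eqP; rewrite nth_uniq ?ss -?ek //.
    by move/eqP/val_inj.
  by rewrite (perm_uniq ps) iota_uniq.
have [p' pK p'K] : bijective p by apply: inj_card_bij pinj _; rewrite !card_ord ek.
have dp i : d (p i) = nth 0%N e i.
  have -> : nth 0%N e i = nth 0%N (map (nth 0%N [seq d i | i <- enum 'I_k]) s) i.
    by rewrite -Es.
  rewrite (nth_map 0%N) ?ss -?ek //.
  by rewrite (nth_map (p i)) ?size_enum_ord ?sk // -[nth 0%N s i]/(val (p i)) nth_ord_enum.
have reidx (f : 'I_(size e) -> S) : \sum_i f i *: theta (p i) = \sum_i f (p' i) *: theta i.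
  rewrite [RHS](reindex p) /=; first by apply: eq_bigr => i _; rewrite pK.
  by exists p' => i _; rewrite ?pK ?p'K.
exists (fun i => theta (p i)); split; last by move=> i j; rewrite -dp; apply: hom.
split=> [i|eta /span[f ->]|f]; first exact: tD.
  exists (fun i => f (p i)); rewrite reidx; apply: eq_bigr => i _.
  by rewrite p'K.
by rewrite reidx => /indep h i; rewrite -[i]pK h.
Qed.

Lemma perm_pivot k (d : 'I_k -> nat) i0 x r :
  perm_eq [seq d i | i <- enum 'I_k] (d i0 :: r) ->
  perm_eq [seq (if i == i0 then x else d i) | i <- enum 'I_k] (x :: r).
Proof.
have h := perm_to_rem (mem_enum 'I_k i0).
move=> pe; have := perm_map (fun i => if i == i0 then x else d i) h.
move/perm_trans; apply; rewrite /= eqxx perm_cons.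
have : perm_eq (map d (i0 :: rem i0 (enum 'I_k))) (d i0 :: r).
  by apply: perm_trans pe; rewrite perm_sym; apply: perm_map.
rewrite /= perm_cons => /(perm_trans _); apply.
rewrite (_ : map _ _ = map d (rem i0 (enum 'I_k))) //.
apply/eq_in_map => i; rewrite mem_rem_uniq ?enum_uniq //.
by rewrite inE => /andP[/negPf ->].
Qed.

Lemma divides_homog (m : nat) (B p : {mpoly F[m]}) b d :
  B \is b.-homog -> p \is d.-homog -> divides B p ->
  exists g, [/\ p = g * B, g \is (d - b).-homog & (d < b)%N -> g = 0].
Proof.
move=> hB hp [q Eq]; rewrite -(pihomog_dE hp) Eq (pihomogM_homog _ _ hB).
case: leqP => h; first by exists (pihomog mdeg (d - b) q); split=> //; apply: pihomogP.
by exists 0; split=> //; rewrite ?mul0r ?dhomog0.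
Qed.

(** Comparing coefficients in the basis would make the nonzero constant c a multiple of the form of
    [a]. *)
Lemma unit_not_multiple A a k (theta : 'I_k -> 'rV[S]_n) (f : 'I_k -> S) j (c : F) zeta :
  log_basis A theta -> f j = c%:MP -> c != 0 ->
  \sum_i f i *: theta i = form_poly a *: zeta -> ~ log_derivation A zeta.
Proof.
move=> [_ span indep] fj cnz Ef /span[h Eh].
have /indep/(_ j)/eqP : \sum_i (f i - form_poly a * h i) *: theta i = 0.
  under eq_bigr => i _ do rewrite scalerBl -scalerA.
  by rewrite sumrB -scaler_sumr -Eh Ef subrr.
rewrite subr_eq0 fj => /eqP/(congr1 (res (lker a))).
rewrite rmorphM /= (res_form_self (erefl _)) mul0r resC => /eqP.
by rewrite mpolyC_eq0 (negPf cnz).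
Qed.

(** By the count, the degrees upstairs are those of D(A'') with one extra [delta], so the
    restrictions to H satisfy a unit relation. Lifted by [ext], the relation becomes a combination
    with zero restriction, which is a multiple of the form of [a]. *)
Lemma relation_lift A a k (theta : 'I_k -> 'rV[S]_n) d r delta :
  a != 0 -> lker a \in A -> has_forms A ->
  free_with_exponents (restriction A (lker a)) r ->
  (forall i, homv (d i) (theta i)) ->
  (forall i, (d i <= delta)%N -> log_derivation A (theta i)) ->
  (forall x, #|[pred i | d i == x]| = count_mem x (delta :: r)) ->
  exists (f : 'I_k -> S) j (c : F) zeta, [/\ (d j <= delta)%N, c != 0, f j = c%:MP,
      forall i, (d j < d i)%N -> f i = 0 & forall i, f i \is (d j - d i).-homog] /\
    \sum_i f i *: theta i = form_poly a *: zeta.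
Proof.
move=> nz aA fA [eta [[etaD etaspan etaind] etahom]] hom tD cnt.
set H := lker a in etaD etaspan etaind etahom *.
have [|||||f [j [c [[dj cnz fj fgt fhom] Ef]]]] :=
  @graded_relation F _ _ _ _ eta (nth 0%N r) (fun i => restr_der H (theta i)) d delta.
- by move=> s i; apply: etahom.
- by move=> i _; apply: restr_der_homog; apply: hom.
- by move=> i di; apply: etaspan; apply: restr_logder => //; apply: tD.
- by move=> x lt; rewrite count_exponents cnt /= gtn_eqF.
- by rewrite count_exponents cnt /= eqxx.
have [||zeta Ez] := (restr_der_eq0 (erefl H) (theta := \sum_i ext H (f i) *: theta i) _).1.
- rewrite dv_suml raddf_sum /= big1 // => i _; rewrite dvZl rmorphM /= res_ext.
  (* Derivations of degree above [d j] may fail to be tangent to H, but their coefficients are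
     zero. *)
  have [le|lt] := leqP (d i) (d j); last by rewrite fgt // mul0r.
  have /(logder_deletion _ aA)[_ ->] := tD i (leq_trans le dj).
  by rewrite mulr0.
- rewrite restr_der_sum -[RHS]Ef; apply: eq_bigr => i _.
  by rewrite restr_derZ res_ext.
exists (fun i => ext H (f i)), j, c, zeta; split=> //; split=> //.
- by rewrite fj; apply: pullbackC.
- by move=> i /fgt ->; rewrite rmorph0.
- by move=> i; apply: pullback_homog.
Qed.

(** If every basis element of degree at most e0 were tangent to H, the lifted unit relation would
    contradict independence in D(A'). So some theta i0 of such degree has theta(a) nonzero on H;
    there it is a multiple of B, of degree e0 by the count, hence a constant times B. The other
    basis elements are made tangent by subtracting multiples of theta i0, which is itself multiplied
    by the form of [a]. *)
Theorem addition A a e0 r :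
  a != 0 -> lker a \in A -> has_forms A ->
  free_with_exponents (deletion A (lker a)) (e0 :: r) ->
  free_with_exponents (restriction A (lker a)) r ->
  #|` deletion A (lker a)| = (e0 + #|` restriction A (lker a)|)%N ->
  free_with_exponents A (e0.+1 :: r).
Proof.
move=> nz aA fA [theta [tB hom]] fR card.
have [tD span indep] := tB.
set H := lker a in theta tB hom fR card tD span indep *.
pose k := size (e0 :: r); pose d (i : 'I_k) := nth 0%N (e0 :: r) i.
have [B [Bnz _ Bhom Bdiv]] := restriction_divisor nz aA fA.
rewrite -/H card addnK in Bhom.
have Rg i : exists g, [/\ res H (dv (theta i) a) = g * B, g \is (d i - e0).-homog
    & (d i < e0)%N -> g = 0].
  apply: divides_homog => //; last exact: Bdiv.
  by apply: pullback_homog; apply: dv_homog; apply: hom.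
have [g Eg] := fin_all_exists Rg.
have fA' : has_forms (deletion A H).
  by move=> L; rewrite in_fsetD1 => /andP[_ /fA].
have [i0 di0 gi0] : exists2 i, (d i <= e0)%N & g i != 0.
  have [/existsP[i /andP[]]|] := boolP [exists i, (d i <= e0)%N && (g i != 0)].
    by exists i.
  rewrite negb_exists => /forallP no.
  have tA i : (d i <= e0)%N -> log_derivation A (theta i).
    move=> di; apply/(logder_deletion _ aA); split; first exact: tD.
    have [-> _ _] := Eg i; have := no i; rewrite di /= negbK => /eqP ->.
    by rewrite mul0r.
  have [|f [j [c [zeta [[_ cnz fj _ _] Ez]]]]] :=
    relation_lift (delta := e0) nz aA fA fR hom tA.
    by move=> x; apply: (count_exponents (e0 :: r)).
  case: (unit_not_multiple tB fj cnz Ez).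
  apply: logder_cancel nz fA' _ _; first by rewrite in_fsetD1 eqxx.
  by rewrite -Ez; apply: logder_sum => i _; apply: logderZ.
have [Ei0 gh0 glow] := Eg i0.
have di0E : d i0 = e0.
  by apply/eqP; rewrite eqn_leq di0 leqNgt; apply: contra gi0 => /glow ->.
have [c0 Ec0] : exists c0, g i0 = c0%:MP by apply: homog0_const; move: gh0; rewrite di0E subnn.
have c0nz : c0 != 0 by move: gi0; rewrite Ec0 mpolyC_eq0.
pose h i := c0^-1 *: ext H (g i).
pose t i := if i == i0 then form_poly a *: theta i else theta i - h i *: theta i0.
have tsum f : \sum_i f i *: t i = \sum_i (if i == i0 then f i * form_poly a -
    \sum_(j | j != i0) f j * h j else f i) *: theta i.
  rewrite (bigD1 i0) // [RHS](bigD1 i0) //= /t eqxx scalerBl -scalerA -addrA; congr (_ + _).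
  under eq_bigr => i /negPf ne do rewrite ne scalerBr scalerA.
  rewrite sumrB addrC scaler_suml; congr (_ + _).
  by apply: eq_bigr => i /negPf ->.
apply: (@free_of_basis A k (fun i => if i == i0 then e0.+1 else d i) t).
- split=> [i|eta etaD|f].
  + rewrite /t; case: eqP => [->|_]; apply/(logder_deletion _ aA); split.
    * exact/logderZ/tD.
    * by rewrite dvZl rmorphM /= (res_form_self (erefl H)) mul0r.
    * by rewrite -scaleNr; apply: logderD => //; apply: logderZ.
    have [Ei _ _] := Eg i.
    rewrite -scaleNr dvDl dvZl rmorphD rmorphM /= Ei Ei0 Ec0 rmorphN /= linearZ /= res_ext.
    by rewrite mulNr -scalerAl mul_mpolyC -scalerAr scalerA mulVf // scale1r subrr.
  + have [etaD' eta0] := (logder_deletion _ aA).1 etaD.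
    have [f Ef] := span _ etaD'.
    (* The coefficient of theta i0 relative to the corrected elements. Tangency of [eta] makes u
       times B vanish on H, so u is divisible by the form of [a]. *)
    pose u := f i0 + \sum_(j | j != i0) f j * h j.
    have : res H u = 0.
      move: eta0; rewrite Ef dv_suml raddf_sum /=.
      under eq_bigr => i _.
        have [Ei _ _] := Eg i.
        have -> : res H (dv (f i *: theta i) a) =
           res H (if i == i0 then f i else f i * h i) * (c0 *: B).
          rewrite dvZl rmorphM /= Ei; case: eqP => [->|_].
            by rewrite Ec0 mul_mpolyC.
          rewrite rmorphM /= /h linearZ /= res_ext -scalerAr -scalerAr -scalerAl.
          by rewrite scalerA mulfV // scale1r mulrA.
        over.
      rewrite -mulr_suml -raddf_sum /=; move/eqP; rewrite mulf_eq0 scaler_eq0.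
      rewrite (negPf c0nz) (negPf Bnz) !orbF => /eqP E; rewrite -[RHS]E; congr (res H _).
      rewrite (bigD1 i0) //= eqxx; congr (_ + _).
      by apply: eq_bigr => i /negPf ->.
    case/(res_eq0 (erefl H)) => q Eq.
    exists (fun i => if i == i0 then q else f i); rewrite tsum Ef.
    apply: eq_bigr => i _; case: eqP => // ->; congr (_ *: _).
    rewrite -Eq (eq_bigr (fun j => f j * h j)) => [|j /negPf ->] //.
    by rewrite addrK.
  rewrite tsum => /indep z.
  have fz i : i != i0 -> f i = 0 by move=> ne; have := z i; rewrite (negPf ne).
  move=> i; have [->|/fz//] := eqVneq i i0.
  have := z i0; rewrite eqxx big1 => [|j /fz ->]; last by rewrite mul0r.
  by rewrite subr0 => /eqP; rewrite mulf_eq0 form_poly_eq0 (negPf nz) orbF => /eqP.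
- move=> i j; rewrite /t; case: eqP => [->|ne].
    by have := dhomogM (form_poly_homog a) (hom i0 j); rewrite -/(d i0) di0E add1n mxE.
  rewrite !mxE rpredB ?hom // -scalerAl dhomogZ //.
  have [_ gh gl] := Eg i.
  have [lt|le] := ltnP (d i) e0; first by rewrite gl // rmorph0 mul0r dhomog0.
  rewrite -(subnK le); apply: dhomogM; first exact: pullback_homog.
  by have := hom i0 j; rewrite -/(d i0) di0E.
apply: (@perm_pivot k d i0); rewrite di0E.
rewrite (_ : map _ _ = e0 :: r) //; apply: (@eq_from_nth _ 0%N).
  by rewrite size_map size_enum_ord.
move=> i; rewrite size_map size_enum_ord => ik.
by rewrite (nth_map (Ordinal ik)) ?size_enum_ord // /d nth_enum_ord.
Qed.

(** The unit relation equals the form of [a] times some zeta, which lies in D(A') but not in D(A).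
    Then zeta(a) is a nonzero multiple of B on H, so zeta has degree at least e0, while the relation
    has degree at most e0 + 1. Hence zeta has degree e0 and replaces theta j. *)
Theorem restriction_deletion A a e0 r :
  a != 0 -> lker a \in A -> has_forms A ->
  free_with_exponents A (e0.+1 :: r) ->
  free_with_exponents (restriction A (lker a)) r ->
  #|` deletion A (lker a)| = (e0 + #|` restriction A (lker a)|)%N ->
  free_with_exponents (deletion A (lker a)) (e0 :: r).
Proof.
move=> nz aA fA [theta [tB hom]] fR card.
have [tD span indep] := tB.
set H := lker a in fR card *.
pose k := size (e0.+1 :: r); pose d (i : 'I_k) := nth 0%N (e0.+1 :: r) i.
have [B [Bnz _ Bhom Bdiv]] := restriction_divisor nz aA fA.
rewrite -/H card addnK in Bhom.
have fA' : has_forms (deletion A H).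
  by move=> L; rewrite in_fsetD1 => /andP[_ /fA].
have [|f [j [c [zeta [[dj cnz fj flow fhom] Ez]]]]] :=
    relation_lift (delta := e0.+1) nz aA fA fR hom (fun i _ => tD i).
  by move=> x; apply: (count_exponents (e0.+1 :: r)).
have zD : log_derivation (deletion A H) zeta.
  apply: logder_cancel nz fA' _ _; first by rewrite in_fsetD1 eqxx.
  have : log_derivation A (form_poly a *: zeta).
    by rewrite -Ez; apply: logder_sum => i _; apply: logderZ.
  by case/(logder_deletion _ aA).
have Rz : res H (dv zeta a) != 0.
  apply/eqP => R0; case: (unit_not_multiple tB fj cnz Ez).
  by apply/(logder_deletion _ aA).
have azhom i : form_poly a * zeta 0 i \is (d j).-homog.
  have -> : form_poly a * zeta 0 i = (form_poly a *: zeta) 0 i by rewrite mxE.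
  rewrite -Ez summxE; apply: rpred_sum => l _; rewrite mxE.
  have [le|lt] := leqP (d l) (d j); last by rewrite flow // mul0r dhomog0.
  by rewrite -(subnK le); apply: dhomogM; [apply: fhom|apply: hom].
(* Homogeneity of zeta is read off from that of its product with the form of [a]. *)
have zhom i : zeta 0 i = if (0 < d j)%N then pihomog mdeg (d j).-1 (zeta 0 i) else 0.
  have := pihomog_dE (azhom i); rewrite mulrC (pihomogM_homog _ _ (form_poly_homog a)).
  rewrite subn1; case: ifP => _ E; apply: (@mulIf _ (form_poly a)) => //;
    by rewrite ?form_poly_eq0 // -E ?mul0r.
have dj0 : (0 < d j)%N.
  rewrite lt0n; apply: contraNneq Rz => dj0; rewrite dvE big1 ?rmorph0 // => i _.
  by rewrite zhom dj0 scaler0.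
have {}zhom : homv (d j).-1 zeta by move=> i; rewrite zhom dj0; apply: pihomogP.
have [|g [Eg gh gl]] := divides_homog Bhom _ (Bdiv _ zD) (d := (d j).-1).
  by apply: pullback_homog; apply: dv_homog.
have gnz : g != 0 by apply: contraNneq Rz => g0; rewrite Eg g0 mul0r.
have djE : (d j).-1 = e0.
  have : (e0 <= (d j).-1)%N by rewrite leqNgt; apply: contra gnz => /gl ->.
  by move: dj; rewrite -/(d j); case: (d j) dj0 => // x _; lia.
have [c1 Ec1] : exists c1, g = c1%:MP by apply: homog0_const; move: gh; rewrite djE subnn.
have c1nz : c1 != 0 by move: gnz; rewrite Ec1 mpolyC_eq0.
have Ef : \sum_i f i *: theta i = c%:MP *: theta j + \sum_(i | i != j) f i *: theta i.
  by rewrite (bigD1 j) //= fj.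
pose t i := if i == j then zeta else theta i.
(* Independence is tested after multiplying by the form of [a], which turns zeta into a combination
   of the theta i. *)
have tsum u : form_poly a *: (\sum_i u i *: t i) =
    \sum_i (if i == j then u j * c%:MP else u i * form_poly a + u j * f i) *: theta i.
  transitivity (\sum_(i | i != j) (u i * form_poly a) *: theta i + u j *: (form_poly a *: zeta)).
    rewrite scaler_sumr (bigD1 j) //= /t eqxx addrC scalerA mulrC -scalerA; congr (_ + _).
    by apply: eq_bigr => i /negPf ->; rewrite scalerA mulrC.
  rewrite -Ez Ef [RHS](bigD1 j) //= eqxx scalerDr scalerA addrCA; congr (_ + _).
  rewrite scaler_sumr -big_split; apply: eq_bigr => i /negPf ->.
  by rewrite scalerDl scalerA.
apply: (@free_of_basis _ k (fun i => if i == j then e0 else d i) t).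
- split=> [i|eta etaD|u E].
  + rewrite /t; case: eqP => // _.
    by have := tD i; case/(logder_deletion _ aA).
  + have [q Eq] := Bdiv _ etaD.
    pose s := c1^-1 *: ext H q.
    have : log_derivation A (eta - s *: zeta).
      apply/(logder_deletion _ aA); split.
        by rewrite -scaleNr; apply: logderD => //; apply: logderZ.
      rewrite -scaleNr dvDl dvZl rmorphD rmorphM /= Eq Eg Ec1 rmorphN /= linearZ /= res_ext.
      by rewrite mulNr -scalerAl mul_mpolyC -scalerAr scalerA mulVf // scale1r subrr.
    case/span => u Eu.
    (* Here theta j is eliminated by solving the unit relation for it. *)
    pose v := c^-1%:MP * u j.
    exists (fun i => if i == j then s + v * form_poly a else u i - v * f i).
    rewrite -[LHS](subrK (s *: zeta)) Eu (bigD1 j) //= [RHS](bigD1 j) //= /t eqxx.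
    have -> : u j *: theta j = v *: (form_poly a *: zeta) -
        \sum_(i | i != j) (v * f i) *: theta i.
      rewrite -Ez Ef scalerDr scalerA /v -mulrA [u j * _]mulrC mulrA.
      rewrite -mpolyCM mulVf // mpolyC1 mul1r scaler_sumr.
      by under [X in _ - X]eq_bigr => i _ do rewrite -scalerA; rewrite addrK.
    rewrite scalerDl scalerA -!addrA [RHS]addrCA; congr (_ + _).
    rewrite addrA [RHS]addrC; congr (_ + _).
    transitivity (\sum_(i < k | i != j) (u i *: theta i - (v * f i) *: theta i)).
      by rewrite sumrB addrC.
    by apply: eq_bigr => i /negPf ->; rewrite scalerBl.
  have := tsum u; rewrite E scaler0 => /esym/indep z.
  have uj : u j = 0.
    have := z j; rewrite eqxx mulrC mul_mpolyC => /eqP.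
    by rewrite scaler_eq0 (negPf cnz) => /eqP.
  move=> i; have [->//|ne] := eqVneq i j.
  have := z i; rewrite (negPf ne) uj mul0r addr0 => /eqP.
  by rewrite mulf_eq0 form_poly_eq0 (negPf nz) orbF => /eqP.
- by move=> i; rewrite /t; case: eqP => _; [rewrite -djE | apply: hom].
apply: (@perm_pivot k d j); rewrite (_ : d j = e0.+1); last by rewrite -djE prednK.
rewrite (_ : map _ _ = e0.+1 :: r) //; apply: (@eq_from_nth _ 0%N).
  by rewrite size_map size_enum_ord.
move=> i; rewrite size_map size_enum_ord => ik.
by rewrite (nth_map (Ordinal ik)) ?size_enum_ord // /d nth_enum_ord.
Qed.

End AdditionDeletion.

(** * Chains of additions and deletions *)

Section Good.
Variables (F : fieldType).

(** The last clause, a general property of free arrangements, is carried along because it yields the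
    cardinality hypothesis of [addition] and [restriction_deletion]: with exponents e0 :: r and r
    the difference |A'| - |A''| is e0. *)
Definition good (V : vectType F) (A : {fset {vspace V}}) (e : seq nat) : Prop :=
  [/\ recursively_free A, has_forms A, free_with_exponents A e & #|` A| = sumn e].

Lemma good_perm (V : vectType F) (A : {fset {vspace V}}) e e' :
  perm_eq e e' -> good A e -> good A e'.
Proof.
move=> pe [rA fA [theta [tB hom]] cA]; split=> //; last by rewrite cA; apply: perm_sumn.
apply: (free_of_basis tB hom); apply: perm_trans pe.
rewrite (_ : map _ _ = e) //; apply: (@eq_from_nth _ 0%N).
  by rewrite size_map size_enum_ord.
move=> i; rewrite size_map size_enum_ord => ik.
by rewrite (nth_map (Ordinal ik)) ?size_enum_ord // nth_enum_ord.
Qed.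

Lemma good_empty (V : vectType F) :
  good (fset0 : {fset {vspace V}}) (nseq (\dim {:V}) 0%N).
Proof.
split; [exact: RecFreeEmpty | by [] | | by rewrite cardfs0 sumn_nseq].
apply: (@free_of_basis _ _ _ (\dim {:V}) (fun=> 0%N) (fun i => delta_mx 0 i)).
- split=> [i H a|eta _|f E i]; first by rewrite in_fset0.
  + exists (fun i => eta 0 i); exact: row_sum_delta.
  have := congr1 (fun M : 'rV_ _ => M 0 i) E; rewrite summxE [RHS]mxE (bigD1 i) //=.
  rewrite !mxE !eqxx mulr1 big1 ?addr0 // => j ne.
  by rewrite !mxE eqxx eq_sym (negPf ne) mulr0.
- by move=> i j; rewrite mxE; case: (_ && _); [exact: dhomog1|exact: dhomog0].
rewrite (_ : map _ _ = nseq (\dim {:V}) 0%N) //.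
apply: (@eq_from_nth _ 0%N); first by rewrite size_map size_enum_ord size_nseq.
move=> i; rewrite size_map size_enum_ord => ik.
by rewrite (nth_map (Ordinal ik)) ?size_enum_ord // nth_nseq ik.
Qed.

Section Steps.
Variable V : vectType F.
Implicit Types (A : {fset {vspace V}}) (H K : {vspace V}) (a : 'Hom(V, F^o)).

Lemma multiset_sub_cons x (r : seq nat) : multiset_sub r (x :: r).
Proof. by move=> y; rewrite /= leq_addl. Qed.

Lemma good_add A a e0 r : a != 0 -> lker a \in A ->
  good (deletion A (lker a)) (e0 :: r) -> good (restriction A (lker a)) r ->
  good A (e0.+1 :: r).
Proof.
move=> nz aA [rA' fA' eA' cA'] [rA'' fA'' eA'' cA''].
have fA : has_forms A.
  move=> K KA; have [->|ne] := eqVneq K (lker a); first by exists a.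
  by apply: fA'; rewrite in_fsetD1 ne.
split=> //.
- exact: (RecFreeAdd (has_forms_central fA) aA rA' rA'' eA' eA'' (multiset_sub_cons e0 r)).
- by apply: (addition nz aA fA eA' eA''); rewrite cA' cA''.
by rewrite (cardfsD1 (lker a)) aA -/(deletion A (lker a)) cA'.
Qed.

Lemma good_del A a e0 r : a != 0 -> lker a \in A ->
  good A (e0.+1 :: r) -> good (restriction A (lker a)) r ->
  good (deletion A (lker a)) (e0 :: r).
Proof.
move=> nz aA [rA fA eA cA] [rA'' fA'' eA'' cA''].
have cA' : #|` deletion A (lker a)| = sumn (e0 :: r).
  by move: cA; rewrite (cardfsD1 (lker a)) aA => -[].
split=> //.
- exact: (RecFreeDel (has_forms_central fA) aA rA rA'' eA eA'' (multiset_sub_cons _ r)).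
- by move=> K; rewrite in_fsetD1 => /andP[_ /fA].
by apply: (restriction_deletion nz aA fA eA eA''); rewrite cA' cA''.
Qed.

(** Quantifying over all intermediate arrangements makes the order of additions or deletions
    irrelevant. *)
Definition restr_good A0 A r H : Prop :=
  forall A1, H \in A1 -> {subset A0 <= A1} -> {subset A1 <= A} ->
  good (restriction A1 H) r.

(** All restrictions have the same exponents r, so each step raises the same exponent by one. *)
Lemma good_chain_add (hs : seq {vspace V}) A0 A e0 r :
  uniq hs -> {in hs, forall H, H \notin A0} ->
  (forall K, (K \in A) = (K \in A0) || (K \in hs)) ->
  {in hs, forall H, exists2 a : 'Hom(V, F^o), a != 0 & lker a = H} ->
  {in hs, forall H, restr_good A0 A r H} ->
  good A0 (e0 :: r) -> good A (e0 + size hs :: r)%N.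
Proof.
elim: hs A0 e0 => [|H hs IH] A0 e0 /=.
  move=> _ _ E _ _; rewrite addn0 (_ : A0 = A) //.
  by apply/fsetP => K; rewrite E in_nil orbF.
case/andP=> nH us nA E fs rs g0.
have HH : H \in H :: hs by rewrite inE eqxx.
have [a nz aH] := fs H HH.
have E1 : deletion (H |` A0) (lker a) = A0.
  by rewrite aH /deletion fsetU1K // nA.
have sub : {subset H |` A0 <= A}.
  by move=> K; rewrite in_fset1U E inE => /orP[->|->]; rewrite ?orbT.
rewrite -addSnnS; apply: (IH (H |` A0)) => //.
- move=> K Kh; rewrite in_fset1U negb_or nA ?inE ?Kh ?orbT // andbT.
  by apply: contraNneq nH => <-.
- by move=> K; rewrite E in_fset1U inE orbCA orbA.
- by move=> K Kh; apply: fs; rewrite inE Kh orbT.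
- move=> K Kh A1 KA1 s0 s1; apply: rs => //; first by rewrite inE Kh orbT.
  by move=> L L0; apply: s0; rewrite in_fset1U L0 orbT.
apply: (good_add nz); rewrite ?E1 // aH ?fset1U1 //.
by apply: rs => //; [rewrite fset1U1|move=> L L0; rewrite in_fset1U L0 orbT].
Qed.

Lemma good_chain_del (hs : seq {vspace V}) A0 A e0 r :
  uniq hs -> {in hs, forall H, H \notin A0} ->
  (forall K, (K \in A) = (K \in A0) || (K \in hs)) ->
  {in hs, forall H, exists2 a : 'Hom(V, F^o), a != 0 & lker a = H} ->
  {in hs, forall H, restr_good A0 A r H} ->
  good A (e0 + size hs :: r)%N -> good A0 (e0 :: r).
Proof.
elim: hs A => [|H hs IH] A /=.
  move=> _ _ E _ _; rewrite addn0 (_ : A0 = A) //.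
  by apply/fsetP => K; rewrite E in_nil orbF.
case/andP=> nH us nA E fs rs g.
have HH : H \in H :: hs by rewrite inE eqxx.
have [a nz aH] := fs H HH.
have HA : H \in A by rewrite E HH orbT.
have sub : {subset A `\ H <= A} by move=> K; rewrite in_fsetD1 => /andP[].
apply: (IH (A `\ H)) => //.
- by move=> K Kh; apply: nA; rewrite inE Kh orbT.
- move=> K; rewrite in_fsetD1 E inE; have [->|ne] /= := eqVneq K H.
    by rewrite (negPf nH) orbF; apply/esym/negbTE/nA.
  by [].
- by move=> K Kh; apply: fs; rewrite inE Kh orbT.
- move=> K Kh A1 KA1 s0 s1; apply: rs => //; first by rewrite inE Kh orbT.
  by move=> L /s1/sub.
rewrite -aH; apply: (good_del nz); rewrite ?aH //; first by rewrite -addnS.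
apply: rs => // L L0; by rewrite E L0.
Qed.

End Steps.

Lemma dim_subvs (V : vectType F) (H : {vspace V}) : \dim {:subvs_of H} = \dim H.
Proof. by rewrite dimvf. Qed.

(** The start of the induction, with only the hyperplane at infinity: its restriction is empty, and
    each further dimension contributes an exponent 0. *)
Lemma good_single (V : vectType F) (A : {fset {vspace V}}) (z : 'Hom(V, F^o)) k :
  z != 0 -> (forall K, (K \in A) = (K == lker z)) -> \dim {:V} = k.+1 ->
  good A (1%N :: nseq k 0%N).
Proof.
move=> nz EA dV; have := good_empty V; rewrite dV /= => g0.
apply: (@good_chain_add V [:: lker z] fset0 A 0 (nseq k 0%N)) => //.
- by move=> K; rewrite EA in_fset0 inE.
- by move=> H; rewrite inE => /eqP ->; exists z.
move=> H; rewrite inE => /eqP -> A1 zA1 _ sub.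
rewrite (_ : restriction _ _ = fset0).
  have := good_empty (subvs_of (lker z)); rewrite dim_subvs.
  by have := dim_lker_form nz; rewrite dV => -[->].
apply/fsetP => K; rewrite in_fset0; apply/negP => /in_restriction[L /andP[LA ne] _].
by move: ne (sub _ LA); rewrite EA => /negPf ->.
Qed.

End Good.

(** * Deformations of type B with radii *)

(** The symmetric range -m, -m + 2, ..., m. It has m + 1 elements for m >= -1, so m = -1 encodes an
    absent parity class. *)
Definition steps (m x : int) : bool := [&& - m <= x, x <= m & (2 %| x - m)%Z].

Section Families.
Variables (F : realFieldType) (I : finType).
Local Notation partner := (option (I * bool)).

Definition partner_in (J : {set I}) (i : I) (o : partner) : bool :=
  if o is Some (j, _) then (j \in J) && (j != i) else true.

(* The parameters U and W bound the two parity classes of the equations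
   Y_i = t; a partner Some (j, b) stands for the summand (-1)^b Y_j. *)
Definition admissible (D : {set I}) (R : I -> nat) (U W : int) (i : I) (o : partner)
    (t : int) : bool :=
  if o is Some (j, _) then [&& j \in D, j != i & steps (R i + R j)%N t]
  else steps (U + R i) t || steps (W + R i) t.

Section Space.
Variable V : vectType F.
Implicit Types (z : 'Hom(V, F^o)) (Y : I -> 'Hom(V, F^o)) (D J : {set I})
  (R : I -> nat) (U W : int) (o : partner) (A : {fset {vspace V}}).

Definition form z Y i o (t : int) : 'Hom(V, F^o) :=
  Y i + oapp (fun jb => (-1) ^+ (jb.2 : bool) *: Y jb.1) 0 o - t%:~R *: z.

Lemma formE z Y i o t v : form z Y i o t v =
  (Y i v : F) + oapp (fun jb => (-1) ^+ (jb.2 : bool) * (Y jb.1 v : F)) 0 o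
  - t%:~R * (z v : F).
Proof.
rewrite /form !add_lfunE opp_lfunE scale_lfunE; congr (_ + _ - _).
by case: o => [[j b]|] /=; rewrite ?scale_lfunE ?zero_lfunE.
Qed.

Definition memfam z Y D R U W (K : {vspace V}) : Prop :=
  K = lker z \/ exists i o t,
    [/\ i \in D, admissible D R U W i o t & K = lker (form z Y i o t)].

(** The hyperplanes through coordinate i, with equations normalised to have coefficient 1 at Y_i;
    [ok] selects the equations present. *)
Definition memstar z Y i (ok : partner -> int -> bool) (K : {vspace V}) : Prop :=
  exists o t, ok o t /\ K = lker (form z Y i o t).

(** By the dimension count, z and the Y_j with j in J form a basis of the dual space. J may be
    larger than the set D of active coordinates; the surplus accounts for zero exponents. *)
Definition frame z Y J : Prop :=
  #|J|.+1 = \dim {:V} /\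
  forall v, z v = 0 -> (forall i, i \in J -> Y i v = 0) -> v = 0.

Lemma lker_form_eq (f g : 'Hom(V, F^o)) :
  (forall v, (f v == 0) = (g v == 0)) -> lker f = lker g.
Proof. by move=> E; apply/vspaceP => v; rewrite !memv_ker. Qed.

Lemma lker_formP (f g : 'Hom(V, F^o)) v :
  lker f = lker g -> f v = 0 -> g v = 0.
Proof. by move=> E f0; apply/eqP; rewrite -memv_ker -E memv_ker f0. Qed.

Lemma form_swap z Y i k b t :
  lker (form z Y k (Some (i, b)) t) = lker (form z Y i (Some (k, b)) (if b then - t else t)).
Proof.
apply: lker_form_eq => v; rewrite !formE /=.
case: b => /=; last by congr (_ == _); ring.
by rewrite -oppr_eq0; congr (_ == _); rewrite mulrNz; ring.
Qed.

Lemma steps_opp m x : steps m (- x) = steps m x.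
Proof. by rewrite /steps; apply/and3P/and3P => -[]; split; lia. Qed.

Lemma memfam_star z Y D R U W i K : i \in D ->
  memfam z Y D R U W K <->
  memfam z Y (D :\ i) R U W K \/ memstar z Y i (admissible D R U W i) K.
Proof.
move=> iD; split; last first.
  case=> [[->|[k [o [t [kD okt ->]]]]]|[o [t [okt ->]]]]; first by left.
    right; exists k, o, t; split=> //; first by move: kD; rewrite inE => /andP[].
    case: o okt => [[j b]|] //=; rewrite !inE -andbA => /and4P[_ -> -> ->] //.
  by right; exists i, o, t.
case=> [->|[k [o [t [kD okt ->]]]]]; first by left; left.
have [<-|ne] := eqVneq k i; first by right; exists o, t.
case: o okt => [[j b]|] /=; last first.
  by move=> h; left; right; exists k, None, t; rewrite !inE ne.
case/and3P=> jD jk st; have [ji|nj] := eqVneq j i.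
  right; exists (Some (k, b)), (if b then - t else t); split=> /=; last first.
    by rewrite ji form_swap.
  rewrite kD ne /= -ji addnC; case: b; rewrite ?steps_opp //.
left; right; exists k, (Some (j, b)), t; rewrite /= !inE ne nj jD jk kD.
by split.
Qed.

Section Frame.
Variables (z : 'Hom(V, F^o)) (Y : I -> 'Hom(V, F^o)) (J : {set I}).
Hypothesis fr : frame z Y J.

Lemma frame_interp (c0 : F) (c : I -> F) :
  exists v, z v = c0 /\ forall i, i \in J -> Y i v = c i.
Proof.
case: fr => dV inj.
pose g (v : V) : 'rV[F]_(1 + #|J|) :=
  row_mx (const_mx (z v : F)) (\row_x (Y (enum_val x) v : F)).
have lg : linear g.
  move=> a u v; apply/rowP => x; rewrite !mxE.
  by case: split => y; rewrite !mxE linearP.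
pose lf := GRing.isLinear.Build _ _ _ _ g lg.
pose gL : {linear V -> 'rV[F]_(1 + #|J|)} := HB.pack g lf.
pose G := linfun gL.
have kG : lker G = 0%VS.
  apply/eqP; rewrite -subv0; apply/subvP => v; rewrite memv_ker lfunE /= => /eqP E.
  rewrite memv0; apply/eqP; apply: inj => [|i iJ].
    by have := congr1 (fun M : 'rV_ _ => M 0 (lshift _ 0)) E; rewrite row_mxEl !mxE.
  have := congr1 (fun M : 'rV_ _ => M 0 (rshift 1 (enum_rank_in iJ i))) E.
  by rewrite row_mxEr !mxE enum_rankK_in.
have iG : limg G = fullv.
  apply/eqP; rewrite eqEdim subvf /= dimvf /dim /= mul1n.
  have := limg_ker_dim G fullv; rewrite kG capv0 dimv0 add0n => ->.
  by rewrite -dV add1n.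
have /memv_imgP[v _ Ev] : row_mx (const_mx c0) (\row_x c (enum_val x)) \in limg G.
  by rewrite iG memvf.
rewrite lfunE /= in Ev; exists v; split=> [|i iJ].
  by have := congr1 (fun M : 'rV_ _ => M 0 (lshift _ 0)) Ev; rewrite !row_mxEl !mxE.
have := congr1 (fun M : 'rV_ _ => M 0 (rshift 1 (enum_rank_in iJ i))) Ev.
by rewrite !row_mxEr !mxE enum_rankK_in.
Qed.

Lemma frame_z_neq0 : z != 0.
Proof.
have [v [zv _]] := frame_interp 1 (fun=> 0).
by apply: contra_eq_neq zv => ->; rewrite zero_lfunE eq_sym oner_eq0.
Qed.

Lemma form_dual i o t : i \in J -> partner_in J i o -> exists v,
  [/\ z v = 0, Y i v = 1, forall k, k \in J -> k != i -> Y k v = 0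
    & form z Y i o t v = 1].
Proof.
move=> iJ oJ; have [v [zv Yv]] := frame_interp 0 (fun k => (k == i)%:R).
exists v; split=> //; first by rewrite Yv ?eqxx.
  by move=> k kJ /negPf ne; rewrite Yv // ne.
rewrite formE Yv // eqxx zv mulr0 subr0.
by case: o oJ => [[j b]|] /=; rewrite ?addr0 // => /andP[jJ /negPf ne]; rewrite Yv // ne mulr0 addr0.
Qed.

Lemma form_neq0 i o t : i \in J -> partner_in J i o -> form z Y i o t != 0.
Proof.
move=> iJ oJ; have [v [_ _ _ E]] := form_dual t iJ oJ.
by apply: contra_eq_neq E => ->; rewrite zero_lfunE eq_sym oner_eq0.
Qed.

Lemma form_not_memfam D R U W i o t : i \in J -> partner_in J i o ->
  D \subset J :\ i -> ~ memfam z Y D R U W (lker (form z Y i o t)).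
Proof.
move=> iJ oJ /subsetP DJ; have [v [zv Yi Yv E]] := form_dual t iJ oJ.
have Y0 k : k \in D -> Y k v = 0.
  by move/DJ; rewrite !inE => /andP[? ?]; apply: Yv.
have no (f : 'Hom(V, F^o)) : f v = 0 -> lker (form z Y i o t) <> lker f.
  move=> f0 /esym/lker_formP/(_ f0)/eqP; by rewrite E oner_eq0.
case=> [|[k [o' [s [kD oks]]]]]; first exact: no.
apply: no; rewrite formE zv mulr0 subr0 Y0 // add0r.
by case: o' oks => [[j b]|] //= /and3P[jD _ _]; rewrite Y0 // mulr0.
Qed.

(** Proportional equations coincide because both have coefficient 1 at Y_i; evaluation at vectors
    dual to the frame then separates partner, sign and constant. *)
Lemma form_inj i o t o' t' : i \in J -> partner_in J i o -> partner_in J i o' ->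
  lker (form z Y i o t) = lker (form z Y i o' t') -> (o, t) = (o', t').
Proof.
move=> iJ oJ oJ' E.
have [|c Ec] := @lker_le _ _ (form z Y i o t) (form z Y i o' t'); first by rewrite E.
have {E}Ec v : form z Y i o' t' v = c * form z Y i o t v :> F by rewrite Ec scale_lfunE.
have c1 : c = 1.
  have [v [zv Yi Yv E]] := form_dual t iJ oJ; have := Ec v; rewrite E mulr1 => <-.
  rewrite formE zv Yi mulr0 subr0.
  by case: o' oJ' {Ec} => [[j b]|] /=; rewrite ?addr0 // => /andP[? ?]; rewrite Yv // mulr0 addr0.
have {c c1}Ec v : form z Y i o' t' v = form z Y i o t v :> F by rewrite Ec c1 mul1r.
congr (_, _); last first.
  have [v [zv Yv]] := frame_interp 1 (fun=> 0); have := Ec v; rewrite !formE zv Yv // !mulr1.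
  have h q : partner_in J i q -> oapp (fun jb => (-1) ^+ (jb.2 : bool) * (Y jb.1 v : F)) 0 q = 0.
    by case: q => [[j b]|] //= /andP[? _]; rewrite Yv // mulr0.
  by rewrite !h // => /addrI/oppr_inj/intr_inj.
have coef j : j \in J -> j != i ->
    oapp (fun jb => (-1) ^+ (jb.2 : bool) * ((jb.1 == j)%:R : F)) 0 o =
    oapp (fun jb => (-1) ^+ (jb.2 : bool) * ((jb.1 == j)%:R : F)) 0 o'.
  move=> jJ ji; have [v [zv Yv]] := frame_interp 0 (fun k => (k == j)%:R).
  have := Ec v; rewrite !formE zv !mulr0 !subr0 => /addrI.
  have h q : partner_in J i q -> oapp (fun jb => (-1) ^+ (jb.2 : bool) * (Y jb.1 v : F)) 0 q =
      oapp (fun jb => (-1) ^+ (jb.2 : bool) * ((jb.1 == j)%:R : F)) 0 q.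
    by case: q => [[k b]|] //= /andP[? _]; rewrite Yv.
  by rewrite !h.
have nz (b : bool) : (-1) ^+ b != 0 :> F by rewrite signr_eq0.
case: o oJ {Ec} coef => [[j b]|]; case: o' oJ' => [[j' b']|] //=.
- move=> /andP[j'J j'i] /andP[jJ ji] h; have := h j jJ ji.
  rewrite eqxx mulr1; case: eqP => [->|_]; last by move=> /eqP; rewrite mulr0 (negPf (nz b)).
  rewrite mulr1; move/eqP; have N1 : (-1 == 1 :> F) = false by apply/negP => /eqP; lra.
  by case: b {h}; case: b'; rewrite // ?expr0 ?expr1 ?N1 // eq_sym N1.
- move=> _ /andP[jJ ji] /(_ j jJ ji) /eqP; by rewrite eqxx mulr1 (negPf (nz b)).
- move=> /andP[jJ ji] _ /(_ j' jJ ji) /eqP; by rewrite eqxx mulr1 eq_sym (negPf (nz b')).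
Qed.

Lemma star_split D R U W i (ok0 ok1 : partner -> int -> bool) (E : seq (partner * int)) A :
  i \in J -> D \subset J :\ i ->
  (forall o t, ok1 o t -> partner_in J i o) ->
  uniq E -> (forall o t, ok1 o t = ok0 o t || ((o, t) \in E)) ->
  (forall o t, (o, t) \in E -> ~~ ok0 o t) ->
  (forall K, K \in A <-> memfam z Y D R U W K \/ memstar z Y i ok1 K) ->
  let hs := [seq lker (form z Y i x.1 x.2) | x <- E] in
  let A0 := [fset K in A | K \notin hs] in
  [/\ uniq hs, forall K, K \in A0 <-> memfam z Y D R U W K \/ memstar z Y i ok0 K,
    {in hs, forall H, H \notin A0},
    (forall K, (K \in A) = (K \in A0) || (K \in hs)) &
    {in hs, forall H, exists2 a : 'Hom(V, F^o), a != 0 & lker a = H}].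
Proof.
move=> iJ DJ pJ uE okE nE EA hs A0.
have EJ x : x \in E -> partner_in J i x.1.
  by case: x => o t xE; apply: (pJ o t); rewrite okE xE orbT.
have in0 K : K \in A0 = (K \in A) && (K \notin hs) by rewrite !inE.
have hsA K : K \in hs -> K \in A.
  by case/mapP=> -[o t] xE ->; apply/EA; right; exists o, t; rewrite okE xE orbT.
split.
- rewrite map_inj_in_uniq // => -[o t] [o' t'] xE yE.
  exact: (form_inj iJ (EJ _ xE) (EJ _ yE)).
- move=> K; rewrite in0; split=> [/andP[/EA KA nh]|h].
  + case: KA nh => [|[o [t [okt ->]]] nh]; first by left.
    right; exists o, t; split=> //.
    move: okt; rewrite okE => /orP[//|xE]; case/mapP: nh; by exists (o, t).
  apply/andP; split; first by apply/EA; case: h => [|[o [t [h ->]]]]; [left|right; exists o, t; rewrite okE h].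
  apply/mapP => -[[o t] xE /= EK]; move: h; rewrite EK => -[].
    exact: (form_not_memfam iJ (EJ _ xE) DJ).
  case=> o' [t' [ok' E']].
  have oJ' : partner_in J i o' by apply: (pJ o' t'); rewrite okE ok'.
  have [eo et] := form_inj iJ (EJ _ xE) oJ' E'.
  by have := nE _ _ xE; rewrite eo et ok'.
- by move=> H Hh; rewrite in0 Hh andbF.
- by move=> K; rewrite in0; case Kh: (K \in hs); rewrite ?andbT ?orbF ?orbT // hsA.
move=> H /mapP[[o t] xE ->]; exists (form z Y i o t) => //.
by apply: form_neq0 => //; apply: (EJ _ xE).
Qed.

(** E lists the equations that enlarge the star of i from [ok0] to [ok1]; the chain adds them one by
    one. *)
Lemma star_add D R U W i (ok0 ok1 : partner -> int -> bool) (E : seq (partner * int)) A e0 r :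
  i \in J -> D \subset J :\ i ->
  (forall o t, ok1 o t -> partner_in J i o) ->
  uniq E -> (forall o t, ok1 o t = ok0 o t || ((o, t) \in E)) ->
  (forall o t, (o, t) \in E -> ~~ ok0 o t) ->
  (forall K, K \in A <-> memfam z Y D R U W K \/ memstar z Y i ok1 K) ->
  (forall A0, (forall K, K \in A0 <-> memfam z Y D R U W K \/ memstar z Y i ok0 K) ->
     good A0 (e0 :: r)) ->
  (forall o t, (o, t) \in E -> forall A1,
     (forall K, memfam z Y D R U W K \/ memstar z Y i ok0 K -> K \in A1) ->
     (forall K, K \in A1 -> memfam z Y D R U W K \/ memstar z Y i ok1 K) ->
     good (restriction A1 (lker (form z Y i o t))) r) ->
  good A (e0 + size E :: r)%N.
Proof.
move=> iJ DJ pJ uE okE nE EA g0 gr.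
have [uhs E0 d0 EhA fh] := star_split iJ DJ pJ uE okE nE EA.
have -> : size E = size [seq lker (form z Y i x.1 x.2) | x <- E] by rewrite size_map.
apply: (good_chain_add uhs d0 EhA fh _ (g0 _ E0)).
move=> H /mapP[[o t] xE ->] A1 _ s0 s1; apply: gr => // K.
  by move/E0/s0.
by move/s1/EA.
Qed.

End Frame.
End Space.
End Families.

(** * Restrictions of the families *)

Section MemberForms.
Variables (F : realFieldType) (I : finType) (V : vectType F).
Implicit Types (z h f g : 'Hom(V, F^o)) (Y : I -> 'Hom(V, F^o)) (D J : {set I})
  (R : I -> nat) (U W : int) (o : option (I * bool)) (A : {fset {vspace V}}).

Definition memform z Y D R U W g : Prop :=
  g = z \/ exists i o t, [/\ i \in D, admissible D R U W i o t & g = form z Y i o t].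

Lemma memfamE z Y D R U W K :
  memfam z Y D R U W K <-> exists2 g, memform z Y D R U W g & K = lker g.
Proof.
split=> [[->|[i [o [t [iD okt ->]]]]]|[g [->|[i [o [t [iD okt ->]]]]] ->]].
- by exists z => //; left.
- by exists (form z Y i o t) => //; right; exists i, o, t.
- by left.
- by right; exists i, o, t.
Qed.

End MemberForms.

Section Traces.
Variables (F : realFieldType) (I : finType) (V : vectType F).
Implicit Types (z h f g : 'Hom(V, F^o)) (Y : I -> 'Hom(V, F^o)) (D J : {set I})
  (R : I -> nat) (U W : int) (o : option (I * bool)) (A : {fset {vspace V}}).

(** The two forms cut out the same subspace of ker h. Restrictions are thus compared through
    equations on V, before passing to the space ker h. *)
Definition same_trace h f g : Prop := forall v, h v = 0 -> (f v == 0) = (g v == 0).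

Lemma same_trace_scale h f g (c : F) : c != 0 ->
  (forall v, h v = 0 -> f v = c * g v :> F) -> same_trace h f g.
Proof. by move=> nz E v hv; rewrite E // mulf_eq0 (negPf nz). Qed.

Definition restr_form h f : 'Hom(subvs_of (lker h), F^o) := (f \o incl (lker h))%VF.

Lemma form_comp h z Y i o t :
  form (restr_form h z) (fun k => restr_form h (Y k)) i o t = restr_form h (form z Y i o t).
Proof.
apply/lfunP => v; rewrite comp_lfunE !formE !comp_lfunE; congr (_ + _ - _).
by case: o => [[j b]|] //=; rewrite comp_lfunE.
Qed.

Lemma frame_restr h z Y (Yt : I -> 'Hom(V, F^o)) J j : frame z Y J -> j \in J -> h != 0 ->
  (forall v, h v = 0 -> z v = 0 -> (forall k, k \in J :\ j -> Yt k v = 0) ->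
     forall k, k \in J -> Y k v = 0) ->
  frame (restr_form h z) (fun k => restr_form h (Yt k)) (J :\ j).
Proof.
move=> [dV inj] jJ nz hY; split.
  apply: succn_inj; rewrite dim_subvs dim_lker_form // -dV.
  by rewrite (cardsD1 j J) jJ.
move=> v; rewrite comp_lfunE inclE => zv Yv; apply: val_inj => /=.
have hv : h (vsval v) = 0 by apply/eqP; rewrite -memv_ker; apply: subvsP.
apply: inj => // k kJ; apply: hY => // l lJ.
by have := Yv l lJ; rewrite comp_lfunE inclE.
Qed.

Lemma restr_memfam h z Y D J R U W A :
  frame (restr_form h z) (fun k => restr_form h (Y k)) J -> D \subset J ->
  (forall K, K \in A -> K != lker h -> exists f g,
     [/\ K = lker f, memform z Y D R U W g & same_trace h f g]) ->
  (forall g, memform z Y D R U W g -> exists f, lker f \in A /\ same_trace h f g) ->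
  forall K, K \in restriction A (lker h) <->
    memfam (restr_form h z) (fun k => restr_form h (Y k)) D R U W K.
Proof.
move=> fr /subsetP DJ sub sup K.
have tr f g : same_trace h f g -> (incl (lker h) @^-1: lker f)%VS = lker (restr_form h g).
  move=> E; apply/vspaceP => v; rewrite -memv_preim !memv_ker comp_lfunE inclE; apply: E.
  by apply/eqP; rewrite -memv_ker; apply: subvsP.
have mf g : memform z Y D R U W g ->
    memform (restr_form h z) (fun k => restr_form h (Y k)) D R U W (restr_form h g).
  case=> [->|[i [o [t [iD okt ->]]]]]; first by left.
  by right; exists i, o, t; split=> //; rewrite form_comp.
have nz g : memform z Y D R U W g -> restr_form h g != 0.
  case=> [->|[i [o [t [iD okt ->]]]]]; first exact: (frame_z_neq0 fr).
  rewrite -form_comp; apply: (form_neq0 fr t); first exact: DJ.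
  by case: o okt => [[j b]|] //= /and3P[/DJ -> ->].
rewrite in_restriction memfamE; split.
  case=> L /andP[LA ne] ->; have [f [g [-> /mf gm /tr ->]]] := sub L LA ne.
  by exists (restr_form h g).
have mf' (g : 'Hom(subvs_of (lker h), F^o)) : memform (restr_form h z) (fun k => restr_form h (Y k)) D R U W g ->
    exists2 g', memform z Y D R U W g' & g = restr_form h g'.
  case=> [->|[i [o [t [iD okt ->]]]]]; first by exists z => //; left.
  by exists (form z Y i o t); [right; exists i, o, t | rewrite form_comp].
case=> _ /mf'[g gm ->] ->; have [f [fA E]] := sup g gm; exists (lker f).
  rewrite fA; apply: contraNneq (nz g gm) => fh.
  apply/eqP/lfunP => v; rewrite comp_lfunE zero_lfunE inclE; apply/eqP.
  have hv : vsval v \in lker h by apply: subvsP.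
  rewrite -(E (vsval v)); last by apply/eqP; rewrite -memv_ker.
  by rewrite -memv_ker fh.
by rewrite (tr _ _ E).
Qed.

Definition sgint (b : bool) (t : int) : int := if b then - t else t.

Lemma sgintE b t : (sgint b t)%:~R = (-1) ^+ b * t%:~R :> F.
Proof. by case: b; rewrite /sgint ?mulrNz; ring. Qed.

Lemma steps_sgint b m t : steps m (sgint b t) = steps m t.
Proof. by case: b; rewrite /sgint ?steps_opp. Qed.

Lemma form_line h z Y i o t : form z Y i o t = h -> forall v, h v = 0 ->
  (Y i v : F) = t%:~R * (z v : F) - oapp (fun jb => (-1) ^+ (jb.2 : bool) * (Y jb.1 v : F)) 0 o.
Proof.
move=> <- v; rewrite formE => E; apply/eqP; rewrite -subr_eq0 -[X in _ == X]E.
by apply/eqP; ring.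
Qed.

End Traces.

Ltac steps_lia := unfold steps in *; lia.

Section Restrictions.
Variables (F : realFieldType) (I : finType) (V : vectType F).
Variables (z : 'Hom(V, F^o)) (Y : I -> 'Hom(V, F^o)) (J : {set I}).
Hypothesis fr : frame z Y J.
Implicit Types (h f g : 'Hom(V, F^o)) (D : {set I}) (R : I -> nat) (U W : int)
  (o : option (I * bool)) (A : {fset {vspace V}}).

Lemma admissible_partner D R U W i o t :
  i \in J -> D \subset J -> admissible D R U W i o t -> partner_in J i o.
Proof. by move=> iJ /subsetP DJ; case: o => [[j b]|] //= /and3P[/DJ -> ->]. Qed.

Lemma admissibleUW D R U W i o t : admissible D R U W i o t = admissible D R W U i o t.
Proof. by case: o => [[j b]|] //=; rewrite orbC. Qed.

Lemma memformUW Yt D R U W g : memform z Yt D R U W g <-> memform z Yt D R W U g.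
Proof.
by split=> -[->|[i [o [t [iD okt ->]]]]]; first [by left | right];
   exists i, o, t; rewrite admissibleUW.
Qed.

Lemma same_trace_z h f (s s' : int) : s != s' ->
  (forall v, h v = 0 -> f v = (s%:~R - s'%:~R) * z v :> F) -> same_trace h f z.
Proof.
move=> ne E; apply: same_trace_scale E.
by rewrite -rmorphB /= intr_eq0 subr_eq0.
Qed.

Lemma same_trace_lker h f g g' : lker g = lker g' ->
  same_trace h f g' -> same_trace h f g.
Proof. by move=> E T v /T ->; rewrite -!memv_ker E. Qed.

Lemma frame_drop i o t : i \in J -> partner_in J i o ->
  let h := form z Y i o t in
  frame (restr_form h z) (fun k => restr_form h (Y k)) (J :\ i).
Proof.
move=> iJ oJ h; apply: (frame_restr fr iJ); first exact: (form_neq0 fr t iJ oJ).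
move=> v hv zv Yv k kJ; have [->|ne] := eqVneq k i; last by apply: Yv; rewrite !inE ne.
rewrite (form_line (erefl h) hv) zv mulr0 sub0r.
case: o oJ {h hv} => [[j b]|] /=; rewrite ?oppr0 // => /andP[jJ ji].
by rewrite Yv ?mulr0 ?oppr0 // !inE ji.
Qed.

Lemma memform_lker D R U W g A :
  (forall K, memfam z Y D R U W K -> K \in A) -> memform z Y D R U W g -> lker g \in A.
Proof. by move=> h gm; apply: h; apply/memfamE; exists g. Qed.

(** A coordinate of radius 0 that meets Y_j or a wall stays inside the ranges already present, so
    every equation of its star restricts to an equation of the family on D or to z = 0. *)
Lemma restr_activate D R U W i o t A : i \in J -> D \subset J :\ i -> R i = 0%N ->
  -1 <= U -> -1 <= W -> ~~ (2 %| U - W)%Z -> admissible D R U W i o t ->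
  (forall K, memfam z Y D R U W K -> K \in A) ->
  (forall K, K \in A -> memfam z Y D R U W K \/ memstar z Y i (admissible D R U W i) K) ->
  let h := form z Y i o t in
  frame (restr_form h z) (fun k => restr_form h (Y k)) (J :\ i) /\
  forall K, K \in restriction A (lker h) <->
    memfam (restr_form h z) (fun k => restr_form h (Y k)) D R U W K.
Proof.
move=> iJ DJ Ri0 U1 W1 UW okt sA As h.
have DJ' : D \subset J by apply: subset_trans DJ (subD1set _ _).
have fr' := frame_drop t iJ (admissible_partner iJ DJ' okt).
split; [exact: fr'|]; apply: (restr_memfam fr' DJ); last first.
  by move=> g gm; exists g; split; [apply: memform_lker gm | ].
move=> K /As[/memfamE[g gm ->] _|[o' [t' [okt' ->]]] ne]; first by exists g, g.
exists (form z Y i o' t').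
have X v (hv : h v = 0) := form_line (erefl h) hv.
case: o @h okt fr' X ne => [[j b]|] h /=.
- case/and3P=> jD ji st _ X ne; case: o' okt' ne => [[k c]|] /=; last first.
    move=> ln _; exists (form z Y j None (sgint b (t - t'))); split=> //.
      right; exists j, None, (sgint b (t - t')); split=> //=.
      by rewrite !steps_sgint; clear -st ln Ri0; steps_lia.
    apply: (@same_trace_scale _ _ _ _ _ (- (-1) ^+ b)); first by rewrite oppr_eq0 signr_eq0.
    move=> v /X E; rewrite !formE E /= sgintE rmorphB /=.
    by case: b {h E st X} => /=; rewrite ?expr0 ?expr1; ring.
  case/and3P=> kD ki st' ne; have [kj|nkj] := eqVneq k j; last first.
    exists (form z Y j (Some (k, ~~ (b (+) c))) (sgint b (t - t'))); split=> //.
      right; exists j, (Some (k, ~~ (b (+) c))), (sgint b (t - t')); split=> //=.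
      by rewrite kD nkj steps_sgint; clear -st st' Ri0; steps_lia.
    apply: (@same_trace_scale _ _ _ _ _ (- (-1) ^+ b)); first by rewrite oppr_eq0 signr_eq0.
    move=> v /X E; rewrite !formE E /= sgintE rmorphB /=.
    by case: b {h E st X ne}; case: c => /=; rewrite ?expr0 ?expr1; ring.
  rewrite kj in st' ne *; have [cb|ncb] := eqVneq c b.
    exists z; split=> //; first by left.
    apply: (@same_trace_z _ _ t t').
      by apply: contraNneq ne => tt'; rewrite cb -tt'.
    by move=> v /X E; rewrite !formE E /= cb; ring.
  (* The pair with the opposite sign gives Y_j = q or -q with |q| <= R_j and no control over the
     parity of q. It belongs to the U class or the W class because these have opposite parities, and
     U, W >= -1 is just enough for the bound. *)
  have [q Eq] : exists q, t - t' = 2 * q by exists ((t - t') %/ 2)%Z; clear -st st'; steps_lia.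
  exists (form z Y j None (sgint b q)); split=> //.
    right; exists j, None, (sgint b q); split=> //=.
    by rewrite !steps_sgint; clear -st st' Eq Ri0 U1 W1 UW; steps_lia.
  apply: (@same_trace_scale _ _ _ _ _ (- 2 * (-1) ^+ b)).
    by rewrite mulf_neq0 ?signr_eq0 // oppr_eq0 pnatr_eq0.
  move=> v /X E; rewrite !formE E /= sgintE.
  have -> : t' = t - 2 * q by clear -Eq; lia.
  rewrite rmorphB rmorphM /=.
  by case: b ncb {h E st X ne}; case: c => //= _; rewrite ?expr0 ?expr1; ring.
move=> ln _ X ne; case: o' okt' ne => [[k c]|] /=; last first.
  move=> ln' ne; exists z; split=> //; first by left.
  apply: (@same_trace_z _ _ t t').
    by apply: contraNneq ne => tt'; rewrite -tt'.
  by move=> v /X E; rewrite !formE E /=; ring.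
case/and3P=> kD ki st' ne.
exists (form z Y k None (sgint c (t' - t))); split=> //.
  right; exists k, None, (sgint c (t' - t)); split=> //=.
  by rewrite !steps_sgint; clear -ln st' Ri0; steps_lia.
apply: (@same_trace_scale _ _ _ _ _ ((-1) ^+ c)); first by rewrite signr_eq0.
move=> v /X E; rewrite !formE E /= sgintE rmorphB /=.
by case: c {ne} => /=; rewrite ?expr0 ?expr1; ring.
Qed.

(** The star of i after its radius grows by 1 and Y_i is translated by z: the old symmetric ranges
    are kept, and each gains one value at the upper end. *)
Definition raised D R U W i o (t : int) : bool :=
  if o is Some (j, _) then
    [&& j \in D, j != i & steps (R i + R j)%N t || (t == (R i + R j)%N%:Z + 2)]
  else [|| steps (U + R i) t, t == U + R i + 2, steps (W + R i) t | t == W + R i + 2].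

Lemma raisedUW D R U W i o t : raised D R U W i o t = raised D R W U i o t.
Proof. by case: o => [[j b]|] //=; rewrite orbA orbC -orbA. Qed.

(** On Y_i = U + R_i + 2 the pairs of i give lines Y_k = s that extend the U class of Y_k up to U +
    2R_i + 2 + R_k without a gap, while the W class is unchanged. *)
Lemma restr_raise_line D R U W i t A : i \in J -> D \subset J -> i \in D ->
  -1 <= U -> -1 <= W -> ~~ (2 %| U - W)%Z -> t = U + R i + 2 ->
  (forall K, memfam z Y (D :\ i) R U W K \/ memstar z Y i (admissible D R U W i) K ->
     K \in A) ->
  (forall K, K \in A ->
     memfam z Y (D :\ i) R U W K \/ memstar z Y i (raised D R U W i) K) ->
  let h := form z Y i None t in
  frame (restr_form h z) (fun k => restr_form h (Y k)) (J :\ i) /\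
  forall K, K \in restriction A (lker h) <->
    memfam (restr_form h z) (fun k => restr_form h (Y k)) (D :\ i) R
      (U + 2 * (R i)%:Z + 2) W K.
Proof.
move=> iJ DJ iD U1 W1 UW Et sA As h.
have fr' := @frame_drop i None t iJ isT.
split; [exact: fr'|]; apply: (restr_memfam fr' (setSD _ DJ)).
  have X v (hv : h v = 0) := form_line (erefl h) hv.
  move=> K /As[/memfamE[g gm ->] _|[o' [t' [okt' ->]]] ne].
    exists g, g; split=> //.
    case: gm => [->|[k [o [s [kD oks ->]]]]]; first by left.
    right; exists k, o, s; split=> //; case: o oks => [[l b]|] //=.
    by clear -U1; steps_lia.
  exists (form z Y i o' t'); case: o' okt' ne => [[k c]|] /=; last first.
    move=> ln' ne; exists z; split=> //; first by left.
    apply: (@same_trace_z _ _ t t').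
      by apply: contraNneq ne => tt'; rewrite -tt'.
    by move=> v /X E; rewrite !formE E /=; ring.
  case/and3P=> kD ki st' ne.
  exists (form z Y k None (sgint c (t' - t))); split=> //.
    right; exists k, None, (sgint c (t' - t)); rewrite !inE ki kD; split=> //=.
    by rewrite !steps_sgint; clear -st' Et U1; steps_lia.
  apply: (@same_trace_scale _ _ _ _ _ ((-1) ^+ c)); first by rewrite signr_eq0.
  move=> v /X E; rewrite !formE E /= sgintE rmorphB /=.
  by case: c {ne} => /=; rewrite ?expr0 ?expr1; ring.
move=> g [->|[k [o [s [kD oks ->]]]]].
  by exists z; split=> //; apply: sA; left; left.
have old : admissible (D :\ i) R U W k o s -> exists f, lker f \in A /\
    same_trace h f (form z Y k o s).
  move=> oks'; exists (form z Y k o s); split=> //; apply: sA; left; right.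
  by exists k, o, s.
have [/old//|nok] := boolP (admissible (D :\ i) R U W k o s).
case: o oks nok {old} => [[l b]|] /=; first by move=> ->.
move: kD; rewrite !inE => /andP[ki kD] oks nok.
(* A value s outside the old range is reached through the pair whose sign yields the constant t -
   |s|, up to the case s = 0. *)
have [c stc] : exists c : bool, steps (R i + R k)%N (if c then t - s else t + s).
  exists (0 <= s); clear -oks nok Et U1; case: ifP => s0; steps_lia.
exists (form z Y i (Some (k, c)) (if c then t - s else t + s)); split.
  apply: sA; right; exists (Some (k, c)), (if c then t - s else t + s).
  by split=> //=; rewrite kD ki.
have X v (hv : h v = 0) := form_line (erefl h) hv.
apply: (@same_trace_scale _ _ _ _ _ ((-1) ^+ c)); first by rewrite signr_eq0.
move=> v /X E; rewrite !formE E /=.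
by case: c {stc} => /=; rewrite ?expr0 ?expr1 ?rmorphB ?rmorphD /=; ring.
Qed.

Lemma form_ext (Y' : I -> 'Hom(V, F^o)) k o s : Y' k = Y k ->
  (if o is Some (l, _) then Y' l = Y l else True) -> form z Y' k o s = form z Y k o s.
Proof. by rewrite /form => -> ; case: o => [[l b]|] //= ->. Qed.

(** * Merging of two coordinates *)

Section Merge.
Variables (D : {set I}) (R : I -> nat) (U W : int) (i j : I) (b : bool) (A : {fset {vspace V}}).
Hypotheses (DJ : D \subset J) (iD : i \in D) (jD : j \in D) (ji : j != i).
Hypotheses (U1 : -1 <= U) (W1 : -1 <= W) (UW : ~~ (2 %| U - W)%Z).
Let h := form z Y i (Some (j, b)) ((R i + R j)%N%:Z + 2).
(* On ker h the coordinates Y_i and -(-1)^b Y_j are translates of one coordinate,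
   recentred so that the merged range is symmetric. *)
Definition mergeY k := if k == i then Y i - (R j).+1%:R *: z else Y k.
Definition mergeR k := if k == i then (R i + R j).+1 else R k.
Hypothesis sA : forall K,
  memfam z Y (D :\ i) R U W K \/ memstar z Y i (admissible D R U W i) K -> K \in A.
Hypothesis As : forall K, K \in A ->
  memfam z Y (D :\ i) R U W K \/ memstar z Y i (raised D R U W i) K.

Let Yi v : (Y i v : F) = mergeY i v + (R j).+1%:R * (z v : F).
Proof. by rewrite /mergeY eqxx add_lfunE opp_lfunE scale_lfunE subrK. Qed.

Let Yj v : h v = 0 ->
  (Y j v : F) = - (-1) ^+ b * ((mergeY i v : F) - (R i).+1%:R * (z v : F)).
Proof.
rewrite formE /= Yi; set m := mergeY i v => E.
apply/eqP; rewrite -subr_eq0 -[X in _ == X](mulr0 ((-1) ^+ b)) -[X in _ == _ * X]E.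
apply/eqP; clear E; rewrite rmorphD /=; case: (b) => /=; rewrite ?expr0 ?expr1; ring.
Qed.

Let mYl l : l != i -> mergeY l = Y l.
Proof. by rewrite /mergeY => /negPf ->. Qed.

Lemma merge_frame :
  frame (restr_form h z) (fun k => restr_form h (mergeY k)) (J :\ j).
Proof.
have iJ := subsetP DJ _ iD; have jJ := subsetP DJ _ jD.
apply: (frame_restr fr jJ); first by apply: (form_neq0 fr) => //=; rewrite jJ.
move=> v hv zv mv k kJ.
have mi : mergeY i v = 0 by apply: mv; rewrite !inE eq_sym ji.
have [->|kj] := eqVneq k j; first by rewrite (Yj hv) mi zv mulr0 subr0 mulr0.
have [->|ki] := eqVneq k i; first by rewrite Yi mi zv mulr0 addr0.
by rewrite -mYl //; apply: mv; rewrite !inE kj.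
Qed.

Let merged g := memform z mergeY (D :\ j) mergeR U W g.

Let merged_i o s : (if o is Some (l, _) then [&& l \in D, l != j, l != i &
      steps ((R i + R j).+1 + R l)%N s]
    else steps (U + (R i + R j).+1) s || steps (W + (R i + R j).+1) s) ->
  merged (form z mergeY i o s).
Proof.
move=> ok; right; exists i, o, s; split=> //; first by rewrite !inE eq_sym ji.
case: o ok => [[l c]|] /=; rewrite /mergeR eqxx // => /and4P[lD lj li st].
by rewrite !inE lj lD li (negPf li).
Qed.

Let into_merged_j o t : admissible (D :\ i) R U W j o t ->
  exists g, merged g /\ same_trace h (form z Y j o t) g.
Proof.
case: o => [[l c]|] /=.
  rewrite !inE => /and3P[/andP[li lD] lj st].
  exists (form z mergeY i (Some (l, ~~ (b (+) c))) ((R i).+1%:Z - sgint b t)); split.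
    apply: merged_i; rewrite lD lj li /= /sgint; clear -st; case: ifP => _; steps_lia.
  apply: (@same_trace_scale _ _ _ _ _ (- (-1) ^+ b)); first by rewrite oppr_eq0 signr_eq0.
  move=> v hv; rewrite !formE /= (Yj hv) (mYl li) rmorphB /= sgintE.
  by clear hv; case: (b); case: c => /=; rewrite ?expr0 ?expr1; ring.
move=> st; exists (form z mergeY i None ((R i).+1%:Z - sgint b t)); split.
  apply: merged_i; rewrite /sgint; clear -st U1 W1; case: ifP => _; steps_lia.
apply: (@same_trace_scale _ _ _ _ _ (- (-1) ^+ b)); first by rewrite oppr_eq0 signr_eq0.
move=> v hv; rewrite !formE /= (Yj hv) rmorphB /= sgintE.
by clear hv; case: (b) => /=; rewrite ?expr0 ?expr1; ring.
Qed.

Let into_merged_i o t : raised D R U W i o t ->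
  lker (form z Y i o t) != lker h ->
  exists g, merged g /\ same_trace h (form z Y i o t) g.
Proof.
case: o => [[l c]|] /= ok ne; last first.
  exists (form z mergeY i None (t - (R j).+1%:Z)); split.
    by apply: merged_i; clear -ok U1 W1; steps_lia.
  apply: (@same_trace_scale _ _ _ _ _ 1); first by rewrite oner_eq0.
  by move=> v hv; rewrite !formE /= Yi rmorphB /=; ring.
case/and3P: ok => lD li st; have [lj|nlj] := eqVneq l j; last first.
  exists (form z mergeY i (Some (l, c)) (t - (R j).+1%:Z)); split.
    by apply: merged_i; rewrite lD nlj li /=; clear -st; steps_lia.
  apply: (@same_trace_scale _ _ _ _ _ 1); first by rewrite oner_eq0.
  by move=> v hv; rewrite !formE /= Yi (mYl li) rmorphB /=; ring.
rewrite lj in st ne *; have [cb|ncb] := eqVneq c b.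
  exists z; split; first by left.
  apply: (@same_trace_z _ _ ((R i + R j)%N%:Z + 2) t).
    by apply: contraNneq ne => tt'; rewrite cb -tt'.
  move=> v hv; rewrite !formE /= Yi (Yj hv) cb rmorphD /=.
  by clear hv; case: (b) => /=; rewrite ?expr0 ?expr1; ring.
(* The opposite pair becomes twice the merged coordinate, so q may have either parity and needs both
   classes of lines. *)
have [q Eq] : exists q, t + (R i)%:Z - (R j)%:Z = 2 * q.
  by exists ((t + (R i)%:Z - (R j)%:Z) %/ 2)%Z; clear -st; steps_lia.
exists (form z mergeY i None q); split.
  by apply: merged_i; clear -st Eq U1 W1 UW; steps_lia.
apply: (@same_trace_scale _ _ _ _ _ 2); first by rewrite pnatr_eq0.
move=> v hv; rewrite !formE /= Yi (Yj hv).
have -> : t = 2 * q - (R i)%:Z + (R j)%:Z by clear -Eq; lia.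
rewrite rmorphD rmorphB rmorphM /=.
by clear hv ne; case: (b) ncb; case: c => //= _; rewrite ?expr0 ?expr1; ring.
Qed.

(** The lines of i, shifted by R_j + 1, fill the lower part of the merged range and those of j,
    shifted by R_i + 1, the upper part. *)
Let from_merged_line (U' W' : int) s : -1 <= U' ->
  (forall t, steps (U' + R i) t -> lker (form z Y i None t) \in A) ->
  (forall t, steps (U' + R j) t -> lker (form z Y j None t) \in A) ->
  steps (U' + (R i + R j).+1) s ->
  exists f, lker f \in A /\ same_trace h f (form z mergeY i None s).
Proof.
move=> U'1 Ai Aj st.
have [sti|nsti] := boolP (steps (U' + R i) (s + (R j).+1%:Z)).
  exists (form z Y i None (s + (R j).+1%:Z)); split; first exact: Ai.
  apply: (@same_trace_scale _ _ _ _ _ 1); first by rewrite oner_eq0.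
  by move=> v hv; rewrite !formE /= Yi rmorphD /=; ring.
have [stj|nstj] := boolP (steps (U' + R j) ((R i).+1%:Z - s)).
  exists (form z Y j None (sgint b ((R i).+1%:Z - s))); split.
    by apply: Aj; rewrite steps_sgint.
  apply: (@same_trace_scale _ _ _ _ _ (- (-1) ^+ b)); first by rewrite oppr_eq0 signr_eq0.
  move=> v hv; rewrite !formE /= (Yj hv) sgintE rmorphB /=.
  by clear hv; case: (b) => /=; rewrite ?expr0 ?expr1; ring.
(* A gap occurs only for U' = -1 and consists of this single value, which comes from the pair of
   opposite sign. *)
have Es : s = (R i)%:Z - (R j)%:Z by clear -st nsti nstj U'1; steps_lia.
exists (form z Y i (Some (j, ~~ b)) s); split.
  apply: sA; right; exists (Some (j, ~~ b)), s; rewrite /= jD ji /= Es.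
  by split=> //; clear; steps_lia.
apply: (@same_trace_scale _ _ _ _ _ 2); first by rewrite pnatr_eq0.
move=> v hv; rewrite !formE /= Yi (Yj hv) Es rmorphB /=.
by clear hv; case: (b) => /=; rewrite ?expr0 ?expr1; ring.
Qed.

(** The pairs with a third coordinate l behave like the lines: those of i cover the lower part of
    the merged range and those of j the upper part, now without any gap since R_l >= 0. The
    equations in [raised] beyond the old star add nothing new, so the restriction does not depend on
    which of them are present. *)
Lemma restr_merge K : K \in restriction A (lker h) <->
  memfam (restr_form h z) (fun k => restr_form h (mergeY k)) (D :\ j) mergeR U W K.
Proof.
have jDi : j \in D :\ i by rewrite !inE ji.
have iDj : i \in D :\ j by rewrite !inE eq_sym ji.
have Aj t : admissible (D :\ i) R U W j None t -> lker (form z Y j None t) \in A.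
  by move=> st; apply: sA; left; right; exists j, None, t.
have Ai t : admissible D R U W i None t -> lker (form z Y i None t) \in A.
  by move=> st; apply: sA; right; exists None, t.
apply: (restr_memfam merge_frame (setSD _ DJ)).
  move=> L /As[/(memfam_star _ _ _ _ _ _ jDi)[|]|] /=.
  - case=> [->|[k [o [t [kD ok ->]]]]] _.
      by exists z, z; split=> //; left.
    exists (form z Y k o t), (form z Y k o t); split=> //.
    move: kD; rewrite !inE => /and3P[kj ki kD].
    right; exists k, o, t; split; first by rewrite !inE kj.
      case: o ok => [[l c]|] /=; rewrite /mergeR (negPf ki) //.
      by rewrite !inE -!andbA => /and5P[lj li lD lk st]; rewrite lj lD lk (negPf li).
    apply/esym/form_ext; first exact: mYl.
    case: o ok => [[l c]|] //=; rewrite !inE -!andbA => /and5P[_ li _ _ _]; exact: mYl.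
  - case=> o [t [ok ->]] _; have [g [gm tg]] := into_merged_j ok.
    by exists (form z Y j o t), g.
  case=> o [t [ok ->]] ne; have [g [gm tg]] := into_merged_i ok ne.
  by exists (form z Y i o t), g.
move=> g gm; have : memfam z mergeY (D :\ j) mergeR U W (lker g).
  by apply/memfamE; exists g.
suff H K' : memfam z mergeY (D :\ j) mergeR U W K' -> exists f g',
    [/\ K' = lker g', lker f \in A & same_trace h f g'].
  by move/H=> [f [g' [E fA T]]]; exists f; split=> //; apply: same_trace_lker T.
case/(memfam_star _ _ _ _ _ _ iDj) => [[->|[k [o [t [kD ok ->]]]]]|[o [s [ok ->]]]].
- by exists z, z; split=> //; apply: sA; left; left.
- exists (form z Y k o t), (form z Y k o t).
  move: kD; rewrite !inE => /and3P[ki kj kD].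
  split=> //.
    congr lker; apply: form_ext; first exact: mYl.
    case: o ok => [[l c]|] //=; rewrite !inE -!andbA => /and5P[li _ _ _ _]; exact: mYl.
  apply: sA; left; right; exists k, o, t; split=> //; first by rewrite !inE ki.
  case: o ok => [[l c]|] /=; rewrite /mergeR (negPf ki) //.
  by rewrite !inE -!andbA => /and5P[li lj lD lk]; rewrite (negPf li) lD lk.
suff [f [fA T]] : exists f, lker f \in A /\ same_trace h f (form z mergeY i o s).
  by exists f, (form z mergeY i o s).
case: o ok => [[l c]|] /=; rewrite /mergeR eqxx; last first.
  case/orP; apply: from_merged_line => // t st; [apply: Ai|apply: Aj|apply: Ai|apply: Aj];
    by rewrite /= st ?orbT.
rewrite !inE => /and3P[/andP[lj lD] li]; rewrite (negPf li) => st.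
have [sti|nsti] := boolP (steps (R i + R l)%N (s + (R j).+1%:Z)).
  exists (form z Y i (Some (l, c)) (s + (R j).+1%:Z)); split.
    apply: sA; right; exists (Some (l, c)), (s + (R j).+1%:Z).
    by rewrite /= lD li.
  apply: (@same_trace_scale _ _ _ _ _ 1); first by rewrite oner_eq0.
  by move=> v hv; rewrite !formE /= Yi (mYl li) rmorphD /=; ring.
exists (form z Y j (Some (l, ~~ (b (+) c))) (sgint b ((R i).+1%:Z - s))); split.
  apply: sA; left; right; exists j, (Some (l, ~~ (b (+) c))), (sgint b ((R i).+1%:Z - s)).
  split=> //=; rewrite !inE li lD lj steps_sgint /=.
  by clear -st nsti; steps_lia.
apply: (@same_trace_scale _ _ _ _ _ (- (-1) ^+ b)); first by rewrite oppr_eq0 signr_eq0.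
move=> v hv; rewrite !formE /= (Yj hv) (mYl li) sgintE rmorphB /=.
by clear hv; case: (b); case: c => /=; rewrite ?expr0 ?expr1; ring.
Qed.

End Merge.
End Restrictions.

(** * Families with thick walls *)

Section Exponents.

(** The exponents 1, c + 1, c + 3, ..., c + 2k - 1, followed by m zeros for inactive coordinates. *)
Definition exps (c k m : nat) : seq nat :=
  1%N :: [seq (c + 2 * i + 1)%N | i <- iota 0 k] ++ nseq m 0%N.

(** Together with [exps_last] this shows that the lists for c and c + 2 differ in one entry: the
    smallest, c + 1, is traded for a new largest one. *)
Lemma exps_head c k m : perm_eq (exps c k.+1 m) (c.+1 :: exps c.+2 k m).
Proof.
rewrite /exps /= muln0 addn0 addn1 -[X in iota X k](addn0 1) iotaDl -map_comp.
rewrite (@eq_map _ _ _ (fun i => c.+2 + 2 * i + 1)%N) => [|i /=]; last by lia.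
by apply/permP => a /=; rewrite addnCA.
Qed.

Lemma exps_last c k m : perm_eq ((c + 2 * k + 1)%N :: exps c k m) (exps c k.+1 m).
Proof.
rewrite /exps -[k.+1]addn1 iotaD map_cat add0n.
by apply/permP => a /=; rewrite !count_cat /=; lia.
Qed.

Lemma exps_zero c k m : perm_eq (exps c k m.+1) (0%N :: exps c k m).
Proof. by apply/permP => a /=; rewrite !count_cat /=; lia. Qed.

Definition step_range (m : int) : seq int :=
  [seq - m + 2 * (i%:Z) | i <- iota 0 (absz (m + 1))].

Lemma mem_step_range m t : -1 <= m -> (t \in step_range m) = steps m t.
Proof.
move=> m1; apply/mapP/idP => [[i]|st].
  by rewrite mem_iota /= => hi ->; rewrite /steps; lia.
exists (absz ((t + m) %/ 2)%Z); first by rewrite mem_iota; move: st; rewrite /steps; lia.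
by move: st; rewrite /steps; lia.
Qed.

Lemma step_range_uniq m : uniq (step_range m).
Proof. by rewrite map_inj_uniq ?iota_uniq // => i j; lia. Qed.

Lemma size_step_range m : size (step_range m) = (absz (m + 1)).
Proof. by rewrite size_map size_iota. Qed.

End Exponents.

Section Partners.
Variable I : finType.

Definition partners (D : {set I}) : seq (I * bool) :=
  [seq (j, b) | j <- enum D, b <- [:: false; true]].

Lemma mem_partners D jb : (jb \in partners D) = (jb.1 \in D).
Proof.
case: jb => j b; apply/allpairsP/idP => [[[k c] /= [kD _ [-> _]]]|jD].
  by rewrite mem_enum in kD.
by exists (j, b); rewrite /= mem_enum; split=> //; case: (b).
Qed.

Lemma partners_uniq D : uniq (partners D).
Proof. by apply: allpairs_uniq; rewrite ?enum_uniq // => -[? ?] [? ?] _ _ [-> ->]. Qed.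

Lemma size_partners D : size (partners D) = (2 * #|D|)%N.
Proof. by rewrite size_allpairs -cardE /= mulnC. Qed.

Lemma sum_partners D (f : I -> nat) :
  (\sum_(x <- partners D) f x.1 = 2 * \sum_(j in D) f j)%N.
Proof.
rewrite big_allpairs_dep /= -big_enum big_distrr /=; apply: eq_bigr => j _.
by rewrite !big_cons big_nil; lia.
Qed.

End Partners.

(** * Induction on coordinates and radii *)

Section FamilyExponents.
Variables (F : realFieldType) (I : finType).

(** In use, U and W are at least -1 and of opposite parity, so not both are -1 and the integer under
    [absz] is nonnegative. *)
Definition base_exp (D : {set I}) (R : I -> nat) (U W : int) : nat :=
  absz (U + W + 1 + 2 * (\sum_(i in D) R i)%N%:Z).

(** The statement ranges over all spaces and frames, since restrictions live in other spaces; n, the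
    sum of the radii, is the second induction variable. *)
Definition good_families (k n : nat) : Prop :=
  forall (V : vectType F) (z : 'Hom(V, F^o)) (Y : I -> 'Hom(V, F^o))
    (J D : {set I}) R U W (A : {fset {vspace V}}),
  #|D| = k -> (\sum_(i in D) R i = n)%N -> frame z Y J -> D \subset J ->
  -1 <= U -> -1 <= W -> ~~ (2 %| U - W)%Z ->
  (forall K, K \in A <-> memfam z Y D R U W K) ->
  good A (exps (base_exp D R U W) k (#|J| - k)).

Lemma memfam_ext (V : vectType F) (z : 'Hom(V, F^o)) (Y Y' : I -> 'Hom(V, F^o))
    (D : {set I}) R R' U W K :
  {in D, Y =1 Y'} -> {in D, R =1 R'} ->
  memfam z Y D R U W K -> memfam z Y' D R' U W K.
Proof.
move=> EY ER [->|[k [o [t [kD ok ->]]]]]; first by left.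
right; exists k, o, t; split=> //.
  by case: o ok => [[l b]|] /=; rewrite -(ER k) // => /and3P[lD -> st]; rewrite lD -(ER l).
congr lker; apply: form_ext; first exact: EY.
by case: o ok => [[l b]|] //= /and3P[lD _ _]; apply: EY.
Qed.

Lemma memfamUW (V : vectType F) (z : 'Hom(V, F^o)) (Y : I -> 'Hom(V, F^o))
    (D : {set I}) R U W K : memfam z Y D R U W K -> memfam z Y D R W U K.
Proof. by move/memfamE=> [g /memformUW gm E]; apply/memfamE; exists g. Qed.

Lemma memstar_sub (V : vectType F) (z : 'Hom(V, F^o)) (Y : I -> 'Hom(V, F^o)) i
    (ok ok' : option (I * bool) -> int -> bool) K :
  (forall o t, ok o t -> ok' o t) -> memstar z Y i ok K -> memstar z Y i ok' K.
Proof. by move=> h [o [t [/h okt ->]]]; exists o, t. Qed.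

Lemma good_families0 n : good_families 0 n.
Proof.
move=> V z Y J D R U W A /cards0_eq -> _ fr _ _ _ _ EA.
rewrite /exps subn0 /=; apply: (@good_single F V A z) => //.
- exact: (frame_z_neq0 fr).
- move=> K; apply/idP/eqP => [/EA[//|[i [o [t []]]]]|->]; first by rewrite inE.
  by apply/EA; left.
by case: fr => <-.
Qed.

(** The new coordinate brings (U + 1) + (W + 1) + 2 sum (R_j + 1) = c + 2k + 1 hyperplanes, the sum
    running over the k other coordinates. This is exactly the new exponent, which grows from a
    zero. *)
Lemma good_activate k (V : vectType F) (z : 'Hom(V, F^o)) (Y : I -> 'Hom(V, F^o))
    (J D : {set I}) R U W (A : {fset {vspace V}}) i :
  (forall n, good_families k n) -> i \in D -> R i = 0%N ->
  #|D| = k.+1 -> frame z Y J -> D \subset J ->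
  -1 <= U -> -1 <= W -> ~~ (2 %| U - W)%Z ->
  (forall K, K \in A <-> memfam z Y D R U W K) ->
  good A (exps (base_exp D R U W) k.+1 (#|J| - k.+1)).
Proof.
move=> IH iD Ri0 Dk fr DJ U1 W1 UW EA.
have iJ := subsetP DJ _ iD.
set D0 := D :\ i; have D0k : #|D0| = k by move: Dk; rewrite (cardsD1 i) iD => -[].
have D0J : D0 \subset J :\ i by apply: setSD.
have D0J' : D0 \subset J by apply: subset_trans D0J (subD1set _ _).
have Ji : #|J :\ i| = #|J|.-1 by rewrite (cardsD1 i J) iJ.
have kJ : (k < #|J|)%N by rewrite -Dk subset_leq_card.
have cE : base_exp D R U W = base_exp D0 R U W by rewrite /base_exp (big_setD1 i iD) /= Ri0.
have adE o t : admissible D R U W i o t = admissible D0 R U W i o t.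
  by case: o => [[j b]|] //=; rewrite !inE; case: eqP => //=; rewrite ?andbF.
pose E : seq (option (I * bool) * int) :=
  [seq (None, t) | t <- step_range U] ++ [seq (None, t) | t <- step_range W] ++
  [seq (Some x, t) | x <- partners D0, t <- step_range (R x.1)].
have memN t : ((None, t) \in E) = steps U t || steps W t.
  rewrite !mem_cat !mem_map; try by move=> ? ? [].
  rewrite !mem_step_range //; case: allpairsPdep => [[x [s [_ _ //]]]|_].
  by rewrite orbF.
have memS x t : ((Some x, t) \in E) = (x.1 \in D0) && steps (R x.1) t.
  rewrite !mem_cat; have nN s : (Some x, t) \in [seq (None, t) | t <- s] = false.
    by apply/negP => /mapP[].
  rewrite !nN /=; apply/allpairsPdep/andP => [[y [s [yD ss [-> ->]]]]|[xD st]].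
    by rewrite -mem_partners yD -mem_step_range.
  by exists x, t; rewrite mem_partners mem_step_range.
have EE o t : ((o, t) \in E) = admissible D0 R U W i o t.
  case: o => [[j b]|]; rewrite ?memN ?memS /= Ri0 ?addr0 ?add0n //.
  by rewrite !inE; case: eqP => //=; rewrite ?andbF.
have uE : uniq E.
  have injN : injective (fun t : int => (None : option (I * bool), t)) by move=> ? ? [].
  rewrite /E cat_uniq map_inj_uniq ?step_range_uniq //=; apply/andP; split.
    apply/hasPn => -[o t]; rewrite mem_cat => h; apply/negP => /mapP[s hs [oN ts]].
    move: h; rewrite oN ts => /orP[/mapP[s' hs' [ss]]|/allpairsPdep[? [? [_ _ //]]]].
    move: hs hs'; rewrite ss !mem_step_range //; clear -UW => ? ?; steps_lia.
  rewrite cat_uniq map_inj_uniq ?step_range_uniq //=; apply/andP; split.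
    by apply/hasPn => -[o t] /allpairsPdep[? [? [_ _ [-> _]]]]; apply/negP => /mapP[].
  apply: allpairs_uniq_dep; rewrite ?partners_uniq //.
  - by move=> x _; apply: step_range_uniq.
  - by move=> [x s] [y t] _ _ [-> ->].
have sE : size E = (base_exp D0 R U W + 2 * k + 1)%N.
  rewrite /E !size_cat size_map size_step_range size_map size_step_range size_allpairs_dep.
  rewrite (eq_map (g := fun x => (R x.1).+1)) => [|x]; last first.
    by rewrite size_step_range; lia.
  rewrite sumnE big_map (sum_partners D0 (fun j => (R j).+1)) /base_exp.
  rewrite (eq_bigr (fun j => R j + 1)%N) => [|j _]; last by rewrite addn1.
  rewrite big_split /= sum1_card D0k; clear -U1 W1 UW; lia.
have -> : exps (base_exp D R U W) k.+1 (#|J| - k.+1) =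
          exps (base_exp D0 R U W) k.+1 (#|J :\ i| - k) by rewrite cE Ji; congr exps; lia.
apply: (good_perm (exps_last _ _ _)); rewrite -sE -[size E]add0n.
apply: (@star_add F I V z Y J fr D0 R U W i (fun _ _ => false)
         (admissible D0 R U W i) E A) => //.
- by move=> o t; apply: admissible_partner.
- by move=> o t; rewrite EE.
- move=> K; rewrite EA (memfam_star _ _ _ _ _ _ iD).
  by split=> -[h|h]; [left|right|left|right] => //; apply: memstar_sub h => o t; rewrite adE.
- move=> A0 EA0; apply: good_perm (exps_zero _ _ _) _.
  rewrite (_ : (_ - k).+1 = #|J| - k)%N; last by rewrite Ji; lia.
  apply: (IH _ V z Y J D0 R U W) => // K; rewrite EA0; split=> [[//|[o [t [//]]]]|h].
  by left.
move=> o t; rewrite EE => ok A1 s0 s1.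
have [|fr' EK] := restr_activate fr iJ D0J Ri0 U1 W1 UW ok _ s1.
  by move=> K h; apply: s0; left.
exact: (IH _ _ _ _ _ _ _ _ _ _ D0k (erefl _) fr' D0J U1 W1 UW EK).
Qed.

(** There are 2k + 2 new hyperplanes, one in each class of lines and one for each of the 2k signed
    partners. They turn the smallest exponent c + 1 into c + 2k + 3, the largest for c + 2, and both
    kinds of restriction have constant c + 2. *)
Lemma good_raise k n (V : vectType F) (z : 'Hom(V, F^o)) (Y : I -> 'Hom(V, F^o))
    (J D : {set I}) R U W (A : {fset {vspace V}}) i :
  (forall n, good_families k n) -> good_families k.+1 n -> i \in D ->
  #|D| = k.+1 -> (\sum_(i in D) R i = n)%N -> frame z Y J -> D \subset J ->
  -1 <= U -> -1 <= W -> ~~ (2 %| U - W)%Z ->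
  (forall K, K \in A <->
     memfam z Y (D :\ i) R U W K \/ memstar z Y i (raised D R U W i) K) ->
  good A (exps (base_exp D R U W).+2 k.+1 (#|J| - k.+1)).
Proof.
move=> IH IHn iD Dk DR fr DJ U1 W1 UW EA.
have iJ := subsetP DJ _ iD.
set D0 := D :\ i; have D0k : #|D0| = k by move: Dk; rewrite (cardsD1 i) iD => -[].
have D0J : D0 \subset J :\ i by apply: setSD.
have Ji j : j \in D -> #|J :\ j| = #|J|.-1.
  by move/(subsetP DJ) => jJ; rewrite (cardsD1 j J) jJ.
have kJ : (k < #|J|)%N by rewrite -Dk subset_leq_card.
pose E : seq (option (I * bool) * int) :=
  (None, U + R i + 2) :: (None, W + R i + 2) ::
  [seq (Some x, (R i + R x.1)%N%:Z + 2) | x <- partners D0].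
have memS x t : ((Some x, t) \in E) = (x.1 \in D0) && (t == (R i + R x.1)%N%:Z + 2).
  rewrite !in_cons /=; apply/mapP/andP => [[y yD [-> ->]]|[xD /eqP ->]].
    by move: yD; rewrite mem_partners eqxx.
  by exists x; rewrite ?mem_partners.
have memN t : ((None, t) \in E) = (t == U + R i + 2) || (t == W + R i + 2).
  rewrite !inE !xpair_eqE /=; case: mapP => [[x _ //]|_]; by rewrite orbF.
have uE : uniq E.
  rewrite /= map_inj_uniq ?partners_uniq ?andbT; last by move=> x y [].
  rewrite inE xpair_eqE /= negb_or; apply/andP; split; last by apply/mapP => -[].
  by apply/andP; split; [clear -UW; lia | apply/mapP => -[]].
have sE : size E = (2 * k + 2)%N by rewrite /= size_map size_partners D0k; lia.
set c := base_exp D R U W.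
apply: (good_perm (exps_last _ _ _)).
rewrite (_ : c.+2 + 2 * k + 1 = c.+1 + size E)%N; last by rewrite sE; lia.
apply: (@star_add F I V z Y J fr D0 R U W i (admissible D R U W i)
         (raised D R U W i) E A) => //.
- move=> o t; case: o => [[j b]|] //= /and3P[jD -> _].
  by rewrite (subsetP DJ).
- move=> o t; case: o => [[j b]|]; rewrite ?memS ?memN /= ?inE.
    by case: (j \in D); case: (j == i) => //=; rewrite ?andbF ?andbT.
  by rewrite -!orbA; do ! (case: (_ == _) => //=; rewrite ?orbT ?orbF).
- move=> o t; case: o => [[j b]|]; rewrite ?memS ?memN /= ?inE.
    by case/andP=> /andP[-> ->] /eqP ->; rewrite /=; clear; steps_lia.
  by clear -UW => h; steps_lia.
- move=> A0 EA0; apply: good_perm (exps_head _ _ _) _.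
  apply: (IHn V z Y J D R U W) => // K; rewrite EA0.
  by rewrite (memfam_star _ _ _ _ _ _ iD).
move=> o t oE A1 s0 s1; rewrite -/D0 in s0 s1.
case: o oE => [[j b]|]; rewrite ?memS ?memN.
  rewrite /= !inE => /andP[/andP[ji jD] /eqP ->].
  have jJ := subsetP DJ _ jD.
  have Djk : #|D :\ j| = k by move: Dk; rewrite (cardsD1 j) jD => -[].
  have fr' := merge_frame fr R b DJ iD jD ji.
  have EK := restr_merge (b := b) fr DJ iD jD ji U1 W1 UW s0 s1.
  have := IH _ _ _ _ _ _ _ _ _ _ Djk (erefl _) fr' (setSD _ DJ) U1 W1 UW EK.
  rewrite (Ji j jD); congr (good _ (exps _ _ _)); last by lia.
  rewrite /c /base_exp (big_setD1 j jD) /= [in RHS](big_setD1 i) /=; last first.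
    by rewrite !inE eq_sym ji iD.
  rewrite (big_setD1 (A := D :\ j) i) /=; last by rewrite !inE eq_sym ji iD.
  rewrite /mergeR eqxx (eq_bigr R) => [|l]; last by rewrite !inE => /and3P[/negPf -> _ _].
  clear -U1 W1 UW; lia.
have cE (U' W' : int) : U' = U + 2 * (R i)%:Z + 2 -> W' = W ->
   base_exp D0 R U' W' = c.+2.
  move=> -> ->; rewrite /c /base_exp (big_setD1 i iD) /= -/D0; clear -U1 W1 UW; lia.
have cE' (U' W' : int) : U' = W + 2 * (R i)%:Z + 2 -> W' = U ->
   base_exp D0 R U' W' = c.+2.
  move=> -> ->; rewrite /c /base_exp (big_setD1 i iD) /= -/D0; clear -U1 W1 UW; lia.
rewrite (_ : #|J| - k.+1 = #|J :\ i| - k)%N; last by rewrite Ji //; lia.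
case/orP=> /eqP ->.
  have [fr' EK] := restr_raise_line fr iJ DJ iD U1 W1 UW (erefl _) s0 s1.
  rewrite -(cE _ _ (erefl _) (erefl _)).
  apply: (IH _ _ _ _ _ _ _ _ _ _ D0k (erefl _) fr' D0J _ _ _ EK); clear -U1 W1 UW; lia.
have WU : ~~ (2 %| W - U)%Z by clear -UW; lia.
have [||fr' EK] := @restr_raise_line _ _ _ _ _ _ fr D R W U i _ A1 iJ DJ iD W1 U1 WU (erefl _).
- move=> K [/memfamUW h|h]; apply: s0; [by left|right].
  by apply: memstar_sub h => o s; rewrite admissibleUW.
- move=> K /s1[/memfamUW h|h]; [by left|right].
  by apply: memstar_sub h => o s; rewrite raisedUW.
rewrite -(cE' _ _ (erefl _) (erefl _)).
apply: (IH _ _ _ _ _ _ _ _ _ _ D0k (erefl _) fr' D0J _ _ _ EK); clear -U1 W1 UW; lia.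
Qed.

(** A coordinate of radius 0 is removed altogether; if there is none, some radius is lowered by 1,
    which lowers the sum n. *)
Theorem good_family k n : good_families k n.
Proof.
elim: k n => [|k IH] n; first exact: good_families0.
elim: n => [|n IHn] V z Y J D R U W A Dk DR fr DJ U1 W1 UW EA.
  have [i iD] : exists i, i \in D by apply/card_gt0P; rewrite Dk.
  have Ri0 : R i = 0%N.
    by move/eqP: DR; rewrite sum_nat_eq0 => /forall_inP/(_ i iD)/eqP.
  exact: (good_activate IH iD Ri0 Dk fr DJ U1 W1 UW EA).
have [/existsP[i /andP[iD /eqP Ri0]]|noz] := boolP [exists i, (i \in D) && (R i == 0%N)].
  exact: (good_activate IH iD Ri0 Dk fr DJ U1 W1 UW EA).
have [i iD] : exists i, i \in D by apply/card_gt0P; rewrite Dk.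
have Ri : (0 < R i)%N.
  by rewrite lt0n; move: noz; rewrite negb_exists => /forallP/(_ i); rewrite iD.
have iJ := subsetP DJ _ iD.
pose R' k := if k == i then (R i).-1 else R k.
(* The translation turns a range symmetric for radius R_i into the range for R_i - 1 with one value
   added at the upper end, as in [raised]. *)
pose Y' k := if k == i then Y i + z else Y k.
have DR' : (\sum_(j in D) R' j = n)%N.
  have S : (\sum_(j in D :\ i) R' j = \sum_(j in D :\ i) R j)%N.
    by apply: eq_bigr => l; rewrite !inE /R' => /andP[/negPf ->].
  move: DR; rewrite !(big_setD1 i iD) /= S {1}/R' eqxx; clear -Ri; lia.
have fr' : frame z Y' J.
  case: fr => dV inj; split=> // v zv Yv; apply: inj => // l lJ.
  by have := Yv l lJ; rewrite /Y'; case: eqP => [->|//]; rewrite add_lfunE zv addr0.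
have cE : base_exp D R U W = (base_exp D R' U W).+2.
  by rewrite /base_exp DR DR'; clear -U1 W1 UW; lia.
rewrite cE; apply: (good_raise IH IHn iD Dk DR' fr' DJ U1 W1 UW) => K.
have EY : {in D :\ i, Y =1 Y'} by move=> l; rewrite !inE /Y' => /andP[/negPf ->].
have ER : {in D :\ i, R =1 R'} by move=> l; rewrite !inE /R' => /andP[/negPf ->].
have fE o t : admissible D R U W i o t -> form z Y i o t = form z Y' i o (t + 1).
  move=> ok; rewrite /form {1}/Y' eqxx rmorphD /= scalerDl scale1r opprD.
  have -> : oapp (fun jb => (-1) ^+ (jb.2 : bool) *: Y' jb.1) 0 o =
            oapp (fun jb => (-1) ^+ (jb.2 : bool) *: Y jb.1) 0 o.
    by case: o ok => [[j b]|] //= /and3P[_ /negPf ji _]; rewrite /Y' ji.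
  by rewrite [in RHS](addrAC _ z) [RHS]addrACA subrr addr0.
have okE o t : admissible D R U W i o t = raised D R' U W i o (t + 1).
  case: o => [[j b]|] /=; rewrite /R' eqxx.
    case: (j \in D) => //=; case: eqP => //= _; clear -Ri; steps_lia.
  by rewrite orbA; clear -Ri U1 W1; congr (_ || _); steps_lia.
rewrite EA (memfam_star _ _ _ _ _ _ iD); split=> -[h|[o [t [ok ->]]]].
- by left; apply: memfam_ext h.
- by right; exists o, (t + 1); rewrite -okE fE.
- by left; apply: memfam_ext h => l lD; [rewrite EY|rewrite ER].
right; exists o, (t - 1); have ok' : admissible D R U W i o (t - 1) by rewrite okE subrK.
by rewrite fE // subrK.
Qed.

End FamilyExponents.

(** * Constant radii *)

Section ConstantRadius.
Variables (F : realFieldType) (I : finType) (a : nat).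
Local Notation R := (fun _ : I => a).

Lemma form_none_inj (V : vectType F) (z : 'Hom(V, F^o)) (Y : I -> 'Hom(V, F^o)) J i k o s t :
  frame z Y J -> i \in J -> k \in J -> partner_in J k o ->
  lker (form z Y k o t) = lker (form z Y i None s) -> [/\ o = None, k = i & t = s].
Proof.
move=> fr iJ kJ oJ E; have [ki|ne] := eqVneq k i.
  rewrite ki in oJ E *; have := @form_inj F I V z Y J fr i o t None s iJ oJ isT E.
  by case=> -> ->.
have [v [zv Yk Yv Ev]] := form_dual fr t kJ oJ.
have : form z Y k o t v = 0.
  apply: (lker_formP (esym E)); rewrite formE /= zv mulr0 subr0 addr0.
  by apply: Yv; rewrite // eq_sym.
by move/eqP; rewrite Ev oner_eq0.
Qed.

(** * Deleting outermost lines *)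

Section Delete.
Variables (V : vectType F) (z : 'Hom(V, F^o)) (Y : I -> 'Hom(V, F^o)) (J D : {set I}).
Variables (U W : int) (E : seq (I * int)) (A A0 : {fset {vspace V}}).
Hypotheses (fr : frame z Y J) (DJ : D \subset J).
Hypotheses (Ua : 0 <= U + a) (UW : ~~ (2 %| U - W)%Z).
Hypothesis ED : forall i s, (i, s) \in E -> i \in D /\ (s = U + a \/ s = - (U + a)).
Let hs := [seq lker (form z Y x.1 None x.2) | x <- E].
Hypothesis EA : forall K, K \in A <-> memfam z Y D R U W K.
Hypothesis EA0 : forall K, (K \in A0) = (K \in A) && (K \notin hs).

Let stays i o t : i \in D -> admissible D R U W i o t ->
  (forall s, o = None -> s = U + a \/ s = - (U + a) -> t <> s) ->
  lker (form z Y i o t) \in A0.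
Proof.
move=> iD ok ne; rewrite EA0; apply/andP; split; first by apply/EA; right; exists i, o, t.
apply/mapP => -[[k s] xE /= EK]; have [kD ks] := ED xE.
have [oN _ ts] := form_none_inj fr (subsetP DJ _ kD) (subsetP DJ _ iD)
  (admissible_partner (subsetP DJ _ iD) DJ ok) EK.
exact: (ne s oN ks ts).
Qed.

(** On Y_i = s with |s| = U + a the pairs of i extend the U class of Y_k from U + a to U + 3a. The
    outermost values U + a and -(U + a) are themselves traces of such pairs, so the restriction is
    the same whichever lines of E are present. *)
Lemma restr_const i s (A1 : {fset {vspace V}}) : (i, s) \in E ->
  {subset A0 <= A1} -> {subset A1 <= A} ->
  let h := form z Y i None s in
  frame (restr_form h z) (fun k => restr_form h (Y k)) (J :\ i) /\
  forall K, K \in restriction A1 (lker h) <->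
    memfam (restr_form h z) (fun k => restr_form h (Y k)) (D :\ i) R (U + 2 * a%:Z) W K.
Proof.
move=> isE s0 s1 h; have [iD hsU] := ED isE; have iJ := subsetP DJ _ iD.
have fr' := @frame_drop F I V z Y J fr i None s iJ isT.
split; first exact: fr'.
have X v (hv : h v = 0) := form_line (erefl h) hv.
apply: (restr_memfam fr' (setSD _ DJ)).
  move=> K /s1/EA/(memfam_star _ _ _ _ _ _ iD)[/memfamE[g gm ->] _|[o [t [ok ->]]] ne].
    exists g, g; split=> //; case: gm => [->|[k [o [t [kD ok ->]]]]]; first by left.
    right; exists k, o, t; split=> //; case: o ok => [[l b]|] //=.
    by clear -Ua; steps_lia.
  exists (form z Y i o t); case: o ok ne => [[k c]|] /=; last first.
    move=> _ ne; exists z; split=> //; first by left.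
    apply: (@same_trace_z _ _ _ _ _ s t).
      by apply: contraNneq ne => st; rewrite -st.
    by move=> v /X Ev; rewrite !formE Ev /=; ring.
  case/and3P=> kD ki st ne.
  exists (form z Y k None (sgint c (t - s))); split=> //.
    right; exists k, None, (sgint c (t - s)); rewrite !inE ki kD; split=> //=.
    by rewrite !steps_sgint; clear -st hsU Ua; steps_lia.
  apply: (@same_trace_scale _ _ _ _ _ ((-1) ^+ c)); first by rewrite signr_eq0.
  move=> v /X Ev; rewrite !formE Ev /= sgintE rmorphB /=.
  by case: c {ne} => /=; rewrite ?expr0 ?expr1; ring.
have old k o t : k \in D -> admissible D R U W k o t ->
    (forall s, o = None -> s = U + a \/ s = - (U + a) -> t <> s) ->
    exists f, lker f \in A1 /\ same_trace h f (form z Y k o t).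
  by move=> kD ok ne; exists (form z Y k o t); split=> //; apply/s0/stays.
move=> g [->|[k [o [t [kD ok ->]]]]].
  exists z; split=> //; apply: s0; rewrite EA0; apply/andP; split; first by apply/EA; left.
  apply/mapP => -[[k r] xE /= EK]; have [kD _] := ED xE.
  apply: (@form_not_memfam F I V z Y J fr set0 R U W k None r) => //.
  - exact: (subsetP DJ).
  - exact: sub0set.
  by left.
move: kD; rewrite !inE => /andP[ki kD].
case: o ok => [[l b]|] /=.
  by rewrite !inE => /and3P[/andP[li lD] lk st]; apply: old => //=; rewrite lD lk.
move=> ok; have [in0|nin0] := boolP (steps (W + a) t || steps (U + a - 2) t).
  apply: old => //=; first by clear -in0; steps_lia.
  by move=> r _ hr; clear -in0 hr Ua UW; steps_lia.
(* Here |s| = U + a and U + a <= |t| <= U + 3a, so the difference of absolute values, which is s - t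
   or s + t up to sign, is at most 2a. *)
have [c stc] : exists c : bool, steps (a + a)%N (if c then s - t else s + t).
  exists (0 <= s * t)%R; clear -ok nin0 hsU Ua.
  have sg : (0 <= s * t) = ((0 <= s) && (0 <= t)) || ((s <= 0) && (t <= 0)).
    by apply/idP/idP => h; nia.
  rewrite sg; case: ifP => h; steps_lia.
exists (form z Y i (Some (k, c)) (if c then s - t else s + t)); split.
  by apply/s0/stays => //=; rewrite kD ki.
apply: (@same_trace_scale _ _ _ _ _ ((-1) ^+ c)); first by rewrite signr_eq0.
move=> v /X Ev; rewrite !formE Ev /=.
by case: c {stc} => /=; rewrite ?expr0 ?expr1 ?rmorphB ?rmorphD /=; ring.
Qed.

Lemma delete_good e0 r : uniq E ->
  (forall i s, (i, s) \in E -> forall A1 : {fset {vspace V}}, {subset A0 <= A1} -> {subset A1 <= A} ->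
     good (restriction A1 (lker (form z Y i None s))) r) ->
  good A (e0 + size E :: r)%N -> good A0 (e0 :: r).
Proof.
move=> uE gr; have -> : size E = size hs by rewrite size_map.
have EJ x : x \in E -> x.1 \in J.
  by case: x => i s /ED[iD _]; apply: (subsetP DJ).
apply: good_chain_del.
- rewrite map_inj_in_uniq // => -[i s] [k t] xE yE /= Ek.
  by have [_ /= -> ->] := form_none_inj (o := None) fr (EJ _ yE) (EJ _ xE) isT Ek.
- by move=> H Hh; rewrite EA0 Hh andbF.
- move=> K; rewrite EA0; case Kh: (K \in hs); rewrite ?andbT ?orbF ?andbF ?orbT //=.
  case/mapP: Kh => -[i s] xE ->; apply/EA; have [iD hsU] := ED xE.
  right; exists i, None, s; split=> //=; clear -hsU Ua; steps_lia.
- move=> H /mapP[[i s] xE ->]; exists (form z Y i None s) => //.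
  exact: (form_neq0 fr (o := None) s (EJ _ xE) isT).
by move=> H /mapP[[i s] xE ->] A1 _ s0 s1; apply: gr.
Qed.

End Delete.

Definition const_good (k : nat) (U W : int) : Prop :=
  forall (V : vectType F) (z : 'Hom(V, F^o)) (Y : I -> 'Hom(V, F^o))
    (J D : {set I}) (A : {fset {vspace V}}),
  #|D| = k -> frame z Y J -> D \subset J ->
  (forall K, K \in A <-> memfam z Y D R U W K) ->
  good A (exps (absz (U + W + 1 + 2 * (k * a)%N%:Z)) k (#|J| - k)).

(** The parameters themselves may lie below -1; only the ranges U + a and W + a of the lines are
    bounded below. *)
Definition valid (U W : int) : Prop :=
  [/\ -1 <= U + a, -1 <= W + a & ~~ (2 %| U - W)%Z].

Lemma const_goodUW k U W : const_good k U W -> const_good k W U.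
Proof.
move=> h V z Y J D A Dk fr DJ EA.
rewrite (_ : W + U = U + W); last by rewrite addrC.
by apply: (h V z Y J D) => // K; rewrite EA; split; apply: memfamUW.
Qed.

(** Losing one coordinate of radius a while U grows by 2a leaves c unchanged. The restrictions thus
    have all exponents but the largest, c + 2k + 1, and it is this one that drops. *)
Lemma const_good_delete k (U W : int) (V : vectType F) (z : 'Hom(V, F^o)) (Y : I -> 'Hom(V, F^o))
    (J D : {set I}) (A A0 : {fset {vspace V}}) (E : seq (I * int)) e0 :
  (forall U W, valid U W -> const_good k U W) ->
  #|D| = k.+1 -> frame z Y J -> D \subset J -> 0 <= U + a -> valid U W ->
  (forall i s, (i, s) \in E -> i \in D /\ (s = U + a \/ s = - (U + a))) -> uniq E ->
  (forall K, K \in A <-> memfam z Y D R U W K) ->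
  (forall K, (K \in A0) = (K \in A) &&
     (K \notin [seq lker (form z Y x.1 None x.2) | x <- E])) ->
  let c := absz (U + W + 1 + 2 * (k.+1 * a)%N%:Z) in
  good A (exps c k.+1 (#|J| - k.+1)) -> (e0 + size E = c + 2 * k + 1)%N ->
  good A0 (e0 :: exps c k (#|J| - k.+1)).
Proof.
move=> IH Dk fr DJ Ua [_ W1 UW] ED uE EA EA0 c gA e0E.
apply: (delete_good fr DJ Ua ED EA EA0 uE); last first.
  rewrite e0E; apply: good_perm gA; rewrite perm_sym; exact: exps_last.
move=> i s xE A1 s0 s1; have [iD _] := ED _ _ xE.
have [fr' EK] := restr_const fr DJ Ua UW ED EA EA0 xE s0 s1.
have Dik : #|D :\ i| = k by move: Dk; rewrite (cardsD1 i) iD => -[].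
have Ji : #|J :\ i| = #|J|.-1 by rewrite (cardsD1 i J) (subsetP DJ).
have vU : valid (U + 2 * a%:Z) W by split=> //; clear -Ua UW; lia.
have := IH _ _ vU _ _ _ _ _ _ Dik fr' (setSD _ DJ) EK.
rewrite Ji (_ : #|J|.-1 - k = #|J| - k.+1)%N; last by lia.
by rewrite /c (_ : U + 2 * a%:Z + W + 1 + 2 * (k * a)%N%:Z = U + W + 1 + 2 * (k.+1 * a)%N%:Z) //; lia.
Qed.

(** Passing from U + 2 to U deletes 2(k + 1) lines. The largest exponent for c + 2, namely c + 2k +
    3, drops to c + 1, the one entry missing from the list for c. *)
Lemma const_good_step k (U W : int) :
  (forall U W, valid U W -> const_good k U W) ->
  valid U W -> const_good k.+1 (U + 2) W -> const_good k.+1 U W.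
Proof.
move=> IH [U1 W1 UW] gU V z Y J D A0 Dk fr DJ EA0.
pose E := [seq (i, s) | i <- enum D, s <- [:: U + 2 + a; - (U + 2 + a)]].
pose hs := [seq lker (form z Y x.1 None x.2) | x <- E].
pose A := A0 `|` [fset K in hs].
have memE i s : ((i, s) \in E) = (i \in D) && ((s == U + 2 + a) || (s == - (U + 2 + a))).
  apply/allpairsP/andP => [[[k' t] /= [kD tU [-> ->]]]|[iD sU]].
    by rewrite mem_enum in kD; rewrite !inE in tU.
  by exists (i, s); rewrite /= mem_enum !inE.
have ED i s : (i, s) \in E -> i \in D /\ (s = U + 2 + a \/ s = - (U + 2 + a)).
  by rewrite memE => /andP[iD /orP[]/eqP ->]; split; auto.
have uE : uniq E.
  apply: allpairs_uniq; rewrite ?enum_uniq //; last by move=> [? ?] [? ?] _ _ [-> ->].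
  by rewrite /= inE andbT; clear -U1; lia.
have sE : size E = (2 * k.+1)%N by rewrite size_allpairs -cardE Dk /= mulnC.
have hsE K : K \in hs -> exists i s, [/\ i \in D, s = U + 2 + a \/ s = - (U + 2 + a)
    & K = lker (form z Y i None s)].
  by case/mapP=> -[i s] xE ->; have [iD sU] := ED _ _ xE; exists i, s.
have EA K : K \in A <-> memfam z Y D R (U + 2) W K.
  rewrite in_fsetU; split=> [/orP[/EA0|]|].
  - case=> [->|[i [o [t [iD ok ->]]]]]; first by left.
    right; exists i, o, t; split=> //; case: o ok => [[l b]|] //=.
    by clear -U1; steps_lia.
  - rewrite !inE => /hsE[i [s [iD sU ->]]]; right; exists i, None, s.
    by split=> //=; clear -sU U1; steps_lia.
  case=> [->|[i [o [t [iD ok ->]]]]]; first by apply/orP; left; apply/EA0; left.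
  apply/orP; case: o ok => [[l b]|] /= ok; first by left; apply/EA0; right; exists i, (Some (l, b)), t.
  have [st|nst] := boolP (steps (U + a) t || steps (W + a) t).
    by left; apply/EA0; right; exists i, None, t.
  right; rewrite !inE; apply/mapP; exists (i, t) => //; rewrite memE iD /=.
  by clear -ok nst; steps_lia.
have iJ i : i \in D -> i \in J by apply: (subsetP DJ).
have EA0' K : (K \in A0) = (K \in A) && (K \notin hs).
  rewrite in_fsetU; have [Kh|nKh] := boolP (K \in hs); last by rewrite andbT !inE (negPf nKh) orbF.
  rewrite andbF; apply/negP => /EA0; have [i [s [iD sU ->]]] := hsE K Kh.
  case/(memfam_star _ _ _ _ _ _ iD).
    exact: (form_not_memfam fr (o := None) (iJ i iD) isT (setSD _ DJ)).
  case=> o [t [ok]]; move/esym => E'.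
  have [oN _ ts] := form_none_inj fr (iJ i iD) (iJ i iD) (admissible_partner (iJ i iD) DJ ok) E'.
  by move: ok; rewrite oN ts /=; clear -sU U1 UW; steps_lia.
have vU : valid (U + 2) W by split=> //; clear -U1 UW; lia.
have U2a : 0 <= U + 2 + a by clear -U1; lia.
have gA := gU V z Y J D A Dk fr DJ EA.
set c := absz (U + W + 1 + 2 * (k.+1 * a)%N%:Z).
have cE : absz (U + 2 + W + 1 + 2 * (k.+1 * a)%N%:Z) = c.+2.
  rewrite /c mulSn; move: (k * a)%N => ka; clear -U1 W1 UW; lia.
have e0E : (c.+1 + size E = absz (U + 2 + W + 1 + 2 * (k.+1 * a)%N%:Z)%R + 2 * k + 1)%N.
  by rewrite cE sE; clear; lia.
have := const_good_delete IH Dk fr DJ U2a vU ED uE EA EA0' gA e0E.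
by rewrite cE; apply: good_perm; rewrite perm_sym; apply: exps_head.
Qed.

Lemma const_good_all k U W : valid U W -> const_good k U W.
Proof.
elim: k U W => [|k IH] U W.
  move=> _ V z Y J D A Dk fr DJ EA.
  have D0 : D = set0 by apply: cards0_eq.
  (* Without coordinates the family is z = 0 alone, so any admissible pair serves, here 0 and -1. *)
  have := @good_families0 F I 0 V z Y J set0 R 0 (-1) A.
  apply; rewrite ?cards0 ?big_set0 ?sub0set // => K; rewrite EA D0.
  by split=> -[->|[i [o [t []]]]]; [left|rewrite inE|left|rewrite inE].
have base U' W' : -1 <= U' -> -1 <= W' -> ~~ (2 %| U' - W')%Z -> const_good k.+1 U' W'.
  move=> U1 W1 UW V z Y J D A Dk fr DJ EA.
  have := good_family Dk (erefl _) fr DJ U1 W1 UW EA.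
  by rewrite /base_exp sum_nat_const Dk.
(* Here n bounds the number of steps of 2 that lift the parameter to at least -1; as U' + a >= -1,
   the choice n = a always suffices. U is lowered while W >= -1, and W afterwards. *)
have stepU n U' W' : -1 - (2 * n)%N%:Z <= U' -> -1 <= W' -> valid U' W' -> const_good k.+1 U' W'.
  elim: n U' => [|n IHn] U' Un W1 vU.
    by case: vU => _ _ UW; apply: base => //; clear -Un; lia.
  apply: const_good_step => //; apply: IHn => //; first by clear -Un; lia.
  by case: vU => ? ? UW; split=> //; [|clear -UW]; lia.
have stepW n U' W' : -1 - (2 * n)%N%:Z <= W' -> valid U' W' -> const_good k.+1 U' W'.
  elim: n W' => [|n IHn] W' Wn vU.
    by apply: (stepU a) => //; case: vU => U1 W1 UW; clear -Wn U1; lia.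
  apply: const_goodUW; apply: const_good_step => //.
    by case: vU => ? ? UW; split=> //; clear -UW; lia.
  apply: const_goodUW; apply: IHn; first by clear -Wn; lia.
  by case: vU => ? ? UW; split=> //; [|clear -UW]; lia.
by move=> vU; apply: (stepW a) => //; case: vU => U1 W1 UW; clear -W1; lia.
Qed.

End ConstantRadius.

(** * The cone *)

Section Cone.
Variables (F : realFieldType) (l : nat).
Local Notation V := 'rV[F]_(l + 1).

Definition entry (j : 'I_(l + 1)) (v : V) : F^o := v 0 j.

Lemma entry_is_linear j : linear (entry j).
Proof. by move=> c u v; rewrite /entry !mxE. Qed.
HB.instance Definition _ j :=
  GRing.isLinear.Build F V F^o _ (entry j) (entry_is_linear j).

Definition cone_z : 'Hom(V, F^o) := linfun (entry (rshift l 0)).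
(* The factor 2 clears the half-integers that occur in restrictions. *)
Definition cone_Y (i : 'I_l) : 'Hom(V, F^o) := 2 *: linfun (entry (lshift 1 i)).

Lemma cone_zE v : cone_z v = v 0 (rshift l 0).
Proof. by rewrite lfunE. Qed.

Lemma cone_YE i v : cone_Y i v = 2 * v 0 (lshift 1 i) :> F.
Proof. by rewrite scale_lfunE lfunE. Qed.

Lemma cone_frame : frame cone_z cone_Y [set: 'I_l].
Proof.
split=> [|v zv Yv]; first by rewrite cardsT card_ord dimvf /dim /= mul1n addn1.
apply/rowP => x; rewrite mxE; case: (split_ordP x) => i ->.
  have /eqP := Yv i (in_setT i); rewrite cone_YE mulf_eq0 pnatr_eq0 /=.
  by move/eqP.
by rewrite ord1 -cone_zE.
Qed.

Lemma mem_cone_hplane (u : 'rV[F]_l) d v : (v \in hplane (row_mx u d%:M)) =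
  (\sum_(i < l) u 0 i * v 0 (lshift 1 i) + d * v 0 (rshift l 0) == 0).
Proof.
rewrite mem_hplane big_split_ord /= big_ord1 row_mxEr mxE eqxx mulr1n.
congr (_ + _ == _); apply: eq_bigr => i _; by rewrite row_mxEl.
Qed.

Lemma sum_delta (f : 'I_l -> F) i :
  \sum_(k < l) (delta_mx 0 i : 'rV[F]_l) 0 k * f k = f i.
Proof.
rewrite (bigD1 i) //= mxE !eqxx mul1r big1 ?addr0 // => k /negPf ne.
by rewrite mxE ne andbF mul0r.
Qed.

Lemma hplane_z : hplane (row_mx (0 : 'rV[F]_l) 1%:M) = lker cone_z.
Proof.
apply/vspaceP => v; rewrite mem_cone_hplane memv_ker cone_zE mul1r.
by rewrite big1 ?add0r // => i _; rewrite mxE mul0r.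
Qed.

Lemma hplane_pair i j (b : bool) (s : int) :
  hplane (row_mx (delta_mx 0 i + (-1) ^+ b *: delta_mx 0 j) (- s%:~R)%:M) =
  lker (form cone_z cone_Y i (Some (j, b)) (2 * s)).
Proof.
apply/vspaceP => v; rewrite mem_cone_hplane memv_ker formE /= !cone_YE cone_zE.
under eq_bigr => k _ do rewrite mxE [X in _ + X]mxE mulrDl -mulrA.
rewrite big_split /= -big_distrr /= !sum_delta rmorphM /=.
rewrite -(inj_eq (mulfI (_ : 2 != 0 :> F))) ?pnatr_eq0 // mulr0.
by congr (_ == _); ring.
Qed.

Lemma hplane_line i (s : int) :
  hplane (row_mx (delta_mx 0 i) (- s%:~R)%:M) =
  lker (form cone_z cone_Y i None (2 * s)).
Proof.
apply/vspaceP => v; rewrite mem_cone_hplane memv_ker formE /= !cone_YE cone_zE.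
rewrite sum_delta rmorphM /=.
rewrite -(inj_eq (mulfI (_ : 2 != 0 :> F))) ?pnatr_eq0 // mulr0.
by congr (_ == _); ring.
Qed.

Lemma mem_cone p m a (K : {vspace V}) : K \in cone (B_arr F l p m a) <->
  [\/ K = lker cone_z,
      exists (i j : 'I_l) (b : bool) (s : int), [/\ (i < j)%N, - a%:Z <= s <= a%:Z
        & K = lker (form cone_z cone_Y i (Some (j, b)) (2 * s))]
    | exists (i : 'I_l) (s : int), [/\ (if (i < p)%N then 1 - m%:Z else - m%:Z) <= s <= m%:Z
        & K = lker (form cone_z cone_Y i None (2 * s))]].
Proof.
have plus i j (s : int) : hplane (row_mx (delta_mx 0 i + delta_mx 0 j) (- s%:~R)%:M) =
    lker (form cone_z cone_Y i (Some (j, false)) (2 * s)).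
  by rewrite -hplane_pair expr0 scale1r.
have minus i j (s : int) : hplane (row_mx (delta_mx 0 i - delta_mx 0 j) (- s%:~R)%:M) =
    lker (form cone_z cone_Y i (Some (j, true)) (2 * s)).
  by rewrite -hplane_pair expr1 scaleN1r.
rewrite /cone !inE hplane_z /B_arr; split.
  case/orP=> [/eqP ->|/mapP[b + ->]]; first by constructor 1.
  rewrite !mem_cat => /or3P[] /allpairsPdep[x [s []]].
  - rewrite mem_filter => /andP[lt _]; rewrite mem_int_range => hs ->.
    by constructor 2; exists x.1, x.2, false, s; rewrite plus.
  - rewrite mem_filter => /andP[lt _]; rewrite mem_int_range => hs ->.
    by constructor 2; exists x.1, x.2, true, s; rewrite minus.
  move=> _; rewrite mem_int_range => hs ->.
  by constructor 3; exists x, s; rewrite hplane_line.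
case=> [->|[i [j [b [s [ij hs ->]]]]]|[i [s [hs ->]]]]; first by rewrite eqxx.
  apply/orP; right; have ijm : (i, j) \in [seq ij : 'I_l * 'I_l <- enum {: 'I_l * 'I_l} | ij.1 < ij.2]%N.
    by rewrite mem_filter /= ij mem_enum.
  apply/mapP; case: b.
    exists (delta_mx 0 i - delta_mx 0 j, s%:~R); last by rewrite minus.
    rewrite !mem_cat; apply/or3P; constructor 2; apply/allpairsPdep.
    by exists (i, j), s; rewrite ijm mem_int_range.
  exists (delta_mx 0 i + delta_mx 0 j, s%:~R); last by rewrite plus.
  rewrite !mem_cat; apply/or3P; constructor 1; apply/allpairsPdep.
  by exists (i, j), s; rewrite ijm mem_int_range.
apply/orP; right; apply/mapP; exists (delta_mx 0 i, s%:~R); last by rewrite hplane_line.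
rewrite !mem_cat; apply/or3P; constructor 3; apply/allpairsPdep.
by exists i, s; rewrite mem_enum mem_int_range.
Qed.

(** In the coordinates Y = 2x a pair has |2s| <= 2a, the lines with U + a = 2m are those with |s| <=
    m, and W + a = -1 leaves the odd class empty. The p hyperplanes Y_i = -2m are outermost in the U
    class, so deleting them lowers the largest exponent c + 2l - 1 by p. *)
Lemma good_cone k p m a : l = k.+1 -> (p <= l)%N ->
  let c := (2 * m + 2 * a * l - 2 * a)%N in
  good (cone (B_arr F l p m a)) ((c + 2 * l - p - 1)%N :: exps c k 0).
Proof.
move=> lk pl c.
pose E : seq ('I_l * int) := [seq (i, - (2 * m%:Z)) | i : 'I_l <- enum 'I_l & (i < p)%N].
pose hs := [seq lker (form cone_z cone_Y x.1 None x.2) | x <- E].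
set A0 := cone _; pose A := A0 `|` [fset K in hs].
pose U : int := 2 * m%:Z - a%:Z; pose W : int := - a%:Z - 1.
have memE i s : ((i, s) \in E) = (i < p)%N && (s == - (2 * m%:Z)).
  apply/mapP/andP => [[j] | [ip /eqP ->]].
    by rewrite mem_filter => /andP[jp _] [-> ->].
  by exists i; rewrite // mem_filter ip mem_enum.
have ED i s : (i, s) \in E -> i \in [set: 'I_l] /\ (s = U + a \/ s = - (U + a)).
  by rewrite memE inE => /andP[_ /eqP ->]; split=> //; right; rewrite /U; lia.
have uE : uniq E.
  rewrite map_inj_uniq; last by move=> i j [].
  by apply: filter_uniq; apply: enum_uniq.
have sE : size E = p.
  rewrite size_map size_filter -sum1_count big_enum_cond /=.
  by rewrite -(big_ord_widen l (fun=> 1%N) pl) sum1_card card_ord.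
have hsE K : K \in hs -> exists2 i : 'I_l, (i < p)%N &
    K = lker (form cone_z cone_Y i None (- (2 * m%:Z))).
  by case/mapP=> -[i s]; rewrite memE => /andP[ip /eqP ->] ->; exists i.
have EA K : K \in A <-> memfam cone_z cone_Y [set: 'I_l] (fun=> a) U W K.
  rewrite in_fsetU; split=> [/orP[/mem_cone|]|].
  - case=> [->|[i [j [b [s [ij hsa ->]]]]]|[i [s [hsm ->]]]]; first by left.
      right; exists i, (Some (j, b)), (2 * s); rewrite /= !inE; split=> //.
      rewrite neq_ltn ij orbT /=; clear -hsa; steps_lia.
    right; exists i, None, (2 * s); rewrite /= !inE; split=> //; rewrite /U /W.
    by apply/orP; left; move: hsm; case: ifP => _; clear; rewrite /steps; lia.
  - rewrite !inE => /hsE[i _ ->]; right; exists i, None, (- (2 * m%:Z)).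
    by rewrite inE /= /U /W; split=> //; apply/orP; left; clear; rewrite /steps; lia.
  case=> [->|[i [o [t [_ ok ->]]]]]; first by apply/orP; left; apply/mem_cone; constructor 1.
  have [s Es] : exists s, t = 2 * s.
    exists (t %/ 2)%Z; case: o ok => [[j b] /= /and3P[_ _ st]|/=]; first by clear -st; steps_lia.
    by rewrite /U /W; clear => st; steps_lia.
  apply/orP; case: o ok => [[j b]|] /=.
    rewrite Es => /and3P[_ ji st]; left; apply/mem_cone; constructor 2.
    have hsa : - a%:Z <= s <= a%:Z by clear -st; steps_lia.
    case: (ltngtP i j) => [ij|ij|/val_inj ij]; first by exists i, j, b, s.
      exists j, i, b, (sgint b s); split=> //; first by clear -hsa; case: b; rewrite /sgint; lia.
      by rewrite form_swap; congr lker; congr form; case: b; rewrite /sgint; lia.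
    by rewrite ij eqxx in ji.
  rewrite Es => ok; have hsm : - m%:Z <= s <= m%:Z.
    by move: ok; rewrite /U /W; clear => st; steps_lia.
  have [/andP[ip /eqP sm]|no] := boolP ((i < p)%N && (s == - m%:Z)).
    right; rewrite !inE; apply/mapP; exists (i, - (2 * m%:Z)).
      by rewrite memE ip eqxx.
    by rewrite /= sm mulrN.
  left; apply/mem_cone; constructor 3; exists i, s; split=> //.
  by move: no; case: ifP => _ /=; clear -hsm; lia.
have fr := cone_frame.
have EA0 K : (K \in A0) = (K \in A) && (K \notin hs).
  rewrite in_fsetU; have [Kh|nKh] := boolP (K \in hs); last by rewrite andbT !inE (negPf nKh) orbF.
  rewrite andbF; apply/negP; have [i ip ->] := hsE K Kh.
  have inj k' o t : partner_in [set: 'I_l] k' o ->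
      lker (form cone_z cone_Y i None (- (2 * m%:Z))) = lker (form cone_z cone_Y k' o t) ->
      [/\ o = None, k' = i & t = - (2 * m%:Z)].
    by move=> ho /esym; apply: (form_none_inj fr) => //; rewrite inE.
  case/mem_cone => [Ez|[i' [j [b [s [ij _ E']]]]]|[i' [s [hsm E']]]].
  - apply: (@form_not_memfam F _ V cone_z cone_Y setT fr set0 (fun=> a) U W i None (- (2 * m%:Z))) => //.
      exact: sub0set.
    by left.
  - have [|//] := inj _ _ _ _ E'.
    by rewrite /= inE neq_ltn ij orbT.
  have [//|_ Ei Es] := inj _ _ _ _ E'; move: hsm; rewrite Ei ip; clear -Es; lia.
have Dk : #|[set: 'I_l]| = k.+1 by rewrite cardsT card_ord.
have vU : valid a U W by rewrite /U /W; split; clear; lia.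
have Ua : 0 <= U + a by rewrite /U; clear; lia.
have gA := const_good_all vU Dk fr (subsetT _) EA.
have cE : absz (U + W + 1 + 2 * (k.+1 * a)%N%:Z) = c.
  rewrite /c /U /W lk -mulnA [(a * _)%N]mulnC mulSn; move: (k * a)%N => ka; clear; lia.
have := const_good_delete (@const_good_all F _ a k) Dk fr (subsetT _) Ua vU ED uE EA EA0 gA.
rewrite cE Dk subnn; apply; rewrite sE; clear -lk pl; lia.
Qed.

End Cone.

Theorem theorem5p10 (R : realType) (a m l p : nat)
    (hl : (1 <= l)%N) (hp : (p <= l)%N) :
  let c := (2 * m + 2 * a * l - 2 * a)%N in
  let A := cone (B_arr R l p m a) in
  recursively_free A /\
  free_with_exponents A
    ([:: 1; c + 2 * l - p - 1] ++ [seq c + 2 * k + 1 | k <- iota 0 (l - 1)])%N.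
Proof.
move=> c A; case: l hl hp @c @A => // k _ hp c A.
have [rA _ fA _] : good A ([:: 1; c + 2 * k.+1 - p - 1] ++
    [seq c + 2 * i + 1 | i <- iota 0 (k.+1 - 1)])%N.
  apply: good_perm (good_cone R m a (erefl k.+1) hp).
  by rewrite -/c !subn1 /exps cats0; apply/permP => P /=; rewrite addnCA.
by split.
Qed.
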